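(* Let $(x_0,u_0)$ be a Pareto optimal solution of the multiobjective Bolza problem $(\mathcal B)$. Assume: (a) for each $i\in\{1,\dots,l\}$, $f_i^0$ is continuous on $[0,T]\times\Omega\times U$; $D_{G,2}f_i^0(t,\xi,\zeta)$ exists for all $(t,\xi,\zeta)\in[0,T]\times\Omega\times U$; $D_{F,2}f_i^0(t,x_0(t),\zeta)$ exists for all $(t,\zeta)\in[0,T]\times U$; and $(t,\zeta)\mapsto D_{F,2}f_i^0(t,x_0(t),\zeta)$ is continuous from $[0,T]\times U$ to $E^*$; (b) for each $i$, for all non-empty compact $K\subset\Omega$ and all non-empty compact $M\subset U$, $\sup_{(t,\xi,\zeta)\in[0,T]\times K\times M}\|D_{G,2}f_i^0(t,\xi,\zeta)\|_{\mathcal L}<+\infty$; (c) $f$ is continuous on $[0,T]\times\Omega\times U$; $D_{G,2}f(t,\xi,\zeta)$ exists for all $(t,\xi,\zeta)\in[0,T]\times\Omega\times U$; $D_{F,2}f(t,x_0(t),\zeta)$ exists for all $(t,\zeta)\in[0,T]\times U$; and $(t,\zeta)\mapsto D_{F,2}f(t,x_0(t),\zeta)$ is continuous from $[0,T]\times U$ to $\mathcal L(E,E)$; (d) for all non-empty compact $K\subset\Omega$ and all non-empty compact $M\subset U$, $\sup_{(t,\xi,\zeta)\in[0,T]\times K\times M}\|D_{G,2}f(t,\xi,\zeta)\|_{\mathcal L}<+\infty$; (e) $g_i^0$ ($1\le i\le l$) and $g^\alpha$ ($1\le\alpha\le m$) are Hadamard differentiable at $x_0(T)$; (f) each $h^\beta$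 ($1\le\beta\le q$) is continuous on a neighborhood of $x_0(T)$ and Hadamard differentiable at $x_0(T)$. Then there exist $\theta=(\theta_i)_{1\le i\le l}\in\mathbb R^l$, $(\lambda_\alpha)_{1\le\alpha\le m}\in\mathbb R^m$, $(\mu_\beta)_{1\le\beta\le q}\in\mathbb R^q$ and $p\in PC^1([0,T],E^* )$ such that: (NN) $((\theta_i)_i,(\lambda_\alpha)_\alpha,(\mu_\beta)_\beta)\ne 0$; (Si) $\theta_i\ge0$ for all $i$ and $\lambda_\alpha\ge 0$ for all $\alpha$; (S$\ell$) $\lambda_\alpha g^\alpha(x_0(T))=0$ for all $\alpha$; (TC) $\sum_{i=1}^l\theta_iD_Hg_i^0(x_0(T))+\sum_{\alpha=1}^m\lambda_\alpha D_Hg^\alpha(x_0(T))+\sum_{\beta=1}^q\mu_\beta D_Hh^\beta(x_0(T))=p(T)$; (AE.B) $\underline{d}p(t)=-D_{F,2}H_B(t,x_0(t),u_0(t),p(t),\theta)$ for all $t\in[0,T]$; (MP.B) for all $t\in[0,T]$ and all $\zeta\in U$, $H_B(t,x_0(t),u_0(t),p(t),\theta)\ge H_B(t,x_0(t),\zeta,p(t),\theta)$; (CH.B) $t\mapsto H_B(t,x_0(t),u_0(t),p(t),\theta)$ is continuous on $[0,T]$.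
   Context: Function spaces. Fix $T\in(0,+\infty)$. Let $Y$ be a Hausdorff space. A function $u:[0,T]\to Y$ is piecewise continuous if there is a subdivision $0=\tau_0<\tau_1<\dots<\tau_{k+1}=T$ such that $u$ is continuous on each $(\tau_i,\tau_{i+1})$, the right limits $u(\tau_i+)$ exist in $Y$ for $0\le i\le k$ and the left limits $u(\tau_i-)$ exist in $Y$ for $1\le i\le k+1$. $NPC^0([0,T],Y)$ is the set of piecewise continuous $u$ that are right continuous on $[0,T)$ and satisfy $u(T-)=u(T)$. If $Y$ is a real Banach space, $PC^1([0,T],Y)$ is the set of continuous $x:[0,T]\to Y$ for which there is a subdivision as before such that $x$ is continuously differentiable on each $(\tau_i,\tau_{i+1})$ and the one-sided limits $x'(\tau_i+)$ ($0\le i\le k$), $x'(\tau_i-)$ ($1\le i\le k+1$) exist in $Y$; for open $G\subset Y$, $PC^1([0,T],G)=\{x\in PC^1([0,T],Y): x([0,T])\subset G\}$. The extended derivative $\underline{d}x:[0,T]\to Y$ of such $x$ is $\underline{d}x(t)=x'(t)$ if $t\notin\{\tau_0,\dots,\tau_{k+1}\}$, $\underline{d}x(\tau_i)=x'(\tau_i+)$ for $0\le i\le k$, $\underline{d}x(T)=x'(T-)$. Differentials. For real normed spaces $X,Y$, $\mathcal L(X,Y)$ is the space of bounded linear maps with operator norm $\|\cdot\|_{\mathcal L}$ and $X^*=\mathcal L(X,\mathbb R)$. Let $G\subset X$ be non-empty open, $\mathfrak f:G\to Y$, $x\in G$. $\mathfrak f$ is Gâteaux differentiable at $x$ if there is $D_G\mathfrak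 f(x)\in\mathcal L(X,Y)$ with $\lim_{t\to0+}\frac{\mathfrak f(x+th)-\mathfrak f(x)}{t}=D_G\mathfrak f(x)\cdot h$ for all $h\in X$; it is Hadamard differentiable at $x$ if there is $D_H\mathfrak f(x)\in\mathcal L(X,Y)$ such that for each compact $K\subset X$, $\lim_{t\to0+}\sup_{h\in K}\|\frac{\mathfrak f(x+th)-\mathfrak f(x)}{t}-D_H\mathfrak f(x)\cdot h\|=0$. $D_F\mathfrak f(x)$ is the Fréchet differential. $D_{G,k}$, $D_{F,k}$ denote partial Gâteaux/Fréchet differentials with respect to the $k$-th variable (e.g. $D_{G,2}f(t,\xi,\zeta)$ is the Gâteaux differential at $\xi$ of $f(t,\cdot,\zeta)$). Problem. $E$ is a real Banach space, $\Omega\subset E$ a non-empty open subset, $U$ a Hausdorff topological space, $\xi_0\in\Omega$, $l,m,q$ positive integers, $f:[0,T]\times\Omega\times U\to E$, $f_i^0:[0,T]\times\Omega\times U\to\mathbb R$, and $g_i^0,g^\alpha,h^\beta:\Omega\to\mathbb R$ ($1\le i\le l$, $1\le\alpha\le m$, $1\le\beta\le q$). The multiobjective Bolza problem $(\mathcal B)$ is: maximize $(J_1(x,u),\dots,J_l(x,u))$, $J_i(x,u)=g_i^0(x(T))+\int_0^Tf_i^0(t,x(t),u(t))\,dt$, over $x\in PC^1([0,T],\Omega)$, $u\in NPC^0([0,T],U)$ subject to $\underline{d}x(t)=f(t,x(t),u(t))$ for all $t\in[0,T]$, $x(0)=\xi_0$, $g^\alpha(x(T))\ge0$ for all $\alpha$,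 $h^\beta(x(T))=0$ for all $\beta$. Pairs $(x,u)$ satisfying these constraints are admissible. An admissible $(\overline x,\overline u)$ is a Pareto optimal solution if there is no admissible $(x,u)$ with $J_i(x,u)\ge J_i(\overline x,\overline u)$ for all $i$ and $J_{i_0}(x,u)>J_{i_0}(\overline x,\overline u)$ for some $i_0$. Hamiltonian: $H_B:[0,T]\times\Omega\times U\times E^*\times\mathbb R^l\to\mathbb R$, $H_B(t,x,u,p,\theta)=\sum_{i=1}^l\theta_if_i^0(t,x,u)+p\cdot f(t,x,u)$. *)

(* Defs.v *)
From HB Require Import structures.
From mathcomp Require Import all_boot all_order all_algebra.
From mathcomp Require Import all_classical all_reals all_analysis.

Set Implicit Arguments.
Unset Strict Implicit.
Unset Printing Implicit Defensive.

Import Order.TTheory GRing.Theory Num.Theory.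
Import numFieldNormedType.Exports.

Local Open Scope classical_set_scope.
Local Open Scope ring_scope.

Section BoundedLinear.
Context {R : realType} (X Y : normedModType R).

Definition blin_set : set (X -> Y) :=
  [set f | linear f /\ exists M : R, forall x, `|f x| <= M * `|x|].

Definition blin_pred : {pred X -> Y} := mem blin_set.

Record blin := Blin { blin_fun :> X -> Y; _ : blin_fun \in blin_pred }.

HB.instance Definition _ := [isSub for blin_fun].
HB.instance Definition _ := [Choice of blin by <:].

Let blin_submod : submod_closed blin_pred.
Proof.
split=> [|a f g /set_mem [lf [Mf bf]] /set_mem [lg [Mg bg]]]; apply/mem_set.
  split=> [a u v|]; first by rewrite scaler0 addr0.
  by exists 0 => x; rewrite normr0 mul0r.
split=> [b u v|].
  have afgE w : (a *: f + g) w = a *: f w + g w by [].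
  rewrite !afgE.
  by rewrite lf lg !scalerDr !scalerA mulrC addrACA.
exists (`|a| * Mf + Mg) => x; rewrite (le_trans (ler_normD _ _))//.
rewrite mulrDl lerD// normrZ -mulrA; exact: ler_wpM2l.
Qed.

HB.instance Definition _ :=
  GRing.isSubmodClosed.Build R (X -> Y) blin_pred blin_submod.
HB.instance Definition _ := [SubChoice_isSubLmodule of blin by <:].

Lemma blin_linear (f : blin) : linear f.
Proof. by case: f => f /= /set_mem []. Qed.

HB.instance Definition _ (f : blin) :=
  GRing.isLinear.Build R X Y *:%R f (blin_linear f).

Lemma blin_bounded (f : blin) : exists M : R, forall x, `|f x| <= M * `|x|.
Proof. by case: f => f /= /set_mem []. Qed.

Lemma blinP (f g : blin) : f =1 g -> f = g.
Proof. by move=> fg; apply/val_inj/funext. Qed.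

Definition blin_norm (f : blin) : R :=
  sup [set `|f x| | x in [set x | `|x| <= 1]].

Let blin_has_sup (f : blin) : has_sup [set `|f x| | x in [set x | `|x| <= 1]].
Proof.
split; first by exists `|f 0|, 0 => //=; rewrite normr0.
have [M bf] := blin_bounded f; exists `|M| => _ [x /= x1 <-].
rewrite (le_trans (bf x))// (le_trans (ler_wpM2r _ (ler_norm M)))//.
by rewrite -[leRHS]mulr1 ler_wpM2l.
Qed.

Lemma blin_norm_ub (f : blin) x : `|f x| <= blin_norm f * `|x|.
Proof.
have [->|x0] := eqVneq x 0; first by rewrite linear0 !normr0 mulr0.
rewrite -ler_pdivrMr ?normr_gt0// mulrC.
rewrite -[X in X * _](@ger0_norm _ (`|x|^-1)) ?invr_ge0// -normrZ -linearZ/=.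
apply: (ub_le_sup (proj2 (blin_has_sup f))); exists (`|x|^-1 *: x) => //=.
by rewrite normfZV.
Qed.

Lemma blin_norm_le (f : blin) (M : R) :
  (forall x, `|x| <= 1 -> `|f x| <= M) -> blin_norm f <= M.
Proof.
move=> fM; apply: ge_sup; first by case: (blin_has_sup f).
by move=> _ [x /= x1 <-]; exact: fM.
Qed.

Lemma blin_norm_ge0 (f : blin) : 0 <= blin_norm f.
Proof.
apply: le_trans (normr_ge0 (f 0)) (ub_le_sup (proj2 (blin_has_sup f)) _).
by exists 0 => //=; rewrite normr0.
Qed.

Let blin_normD (f g : blin) : blin_norm (f + g) <= blin_norm f + blin_norm g.
Proof.
apply: blin_norm_le => x x1; rewrite (le_trans (ler_normD (f x) (g x)))//.
rewrite lerD// (le_trans (blin_norm_ub _ _))// -[leRHS]mulr1.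
  by rewrite ler_wpM2l ?blin_norm_ge0.
by rewrite ler_wpM2l ?blin_norm_ge0.
Qed.

Let blin_normZ (a : R) (f : blin) : blin_norm (a *: f) = `|a| * blin_norm f.
Proof.
have leZ (b : R) (g : blin) : blin_norm (b *: g) <= `|b| * blin_norm g.
  apply: blin_norm_le => x x1.
  have -> : (b *: g) x = b *: g x by [].
  rewrite normrZ ler_wpM2l// (le_trans (blin_norm_ub _ _))// -[leRHS]mulr1.
  by rewrite ler_wpM2l ?blin_norm_ge0.
apply/eqP; rewrite eq_le leZ/=.
have [->|a0] := eqVneq a 0; first by rewrite normr0 mul0r blin_norm_ge0.
rewrite mulrC -ler_pdivlMr ?normr_gt0// mulrC -normfV.
by rewrite (le_trans _ (leZ _ _))// scalerA mulVf// scale1r.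
Qed.

Let blin_norm_eq0 (f : blin) : blin_norm f = 0 -> f = 0.
Proof.
move=> f0; apply: blinP => x; apply/eqP; rewrite -normr_le0.
by rewrite (le_trans (blin_norm_ub _ _))// f0 mul0r.
Qed.

HB.instance Definition _ :=
  Lmodule_isNormed.Build R blin blin_normD blin_normZ blin_norm_eq0.

End BoundedLinear.

Notation "''L' ( X , Y )" := (blin X Y)
  (at level 8, X at level 99, Y at level 99, format "''L' ( X ,  Y )") : type_scope.

Section Differentials.
Context {R : realType} {X Y : normedModType R}.
Implicit Types (f : X -> Y) (x : X) (D : 'L(X, Y)).

Definition is_gateaux f x D : Prop :=
  forall h : X, t^-1 *: (f (x + t *: h) - f x) @[t --> (0 : R)^'+] --> D h.

(** Over the empty [K], [ereal_sup] would be [-oo], not [0]. *)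
Definition is_hadamard f x D : Prop :=
  forall K : set X, compact K -> K !=set0 ->
    ereal_sup [set `|t^-1 *: (f (x + t *: h) - f x) - D h|%:E | h in K]
      @[t --> (0 : R)^'+] --> 0%E.

Definition gateaux_differentiable f x : Prop := exists D, is_gateaux f x D.

Definition hadamard_differentiable f x : Prop := exists D, is_hadamard f x D.

(** Fréchet differentiability is [differentiable f x]. The three differentials
    below are [0] where they do not exist. *)
Definition DG f x : 'L(X, Y) := get [set D | is_gateaux f x D].

Definition DH f x : 'L(X, Y) := get [set D | is_hadamard f x D].

Definition DF f x : 'L(X, Y) := get [set D : 'L(X, Y) | is_diff x f D].

Lemma DGP f x : gateaux_differentiable f x -> is_gateaux f x (DG f x).
Proof. by case=> D fD; exact: (getI fD). Qed.

Lemma DHP f x : hadamard_differentiable f x -> is_hadamard f x (DH f x).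
Proof. by case=> D fD; exact: (getI fD). Qed.

Lemma DFP f x : differentiable f x -> is_diff x f (DF f x).
Proof.
move=> fx.
have dP : ('d f x : X -> Y) \in @blin_pred R X Y.
  apply/mem_set; split; first exact: linearP.
  have /linear_bounded_continuous/linear_boundedP := diff_continuous fx.
  by move=> /pinfty_ex_gt0[M _ fM]; exists M.
have : is_diff x f (Blin dP) by apply: DiffDef.
by move=> fD; exact: (@getI _ [set D : 'L(X, Y) | is_diff x f D] _ fD).
Qed.

End Differentials.

(** A function on [[0, T]] is a total function on [R] whose values outside
    [[0, T]] are ignored; likewise for functions on an open set below. The
    subdivision [0 = tau_0 < ... < tau_(k+1) = T] is [0 :: s] with
    [itv_partition 0 T s], so [size s] is [k + 1]. *)

Section PiecewiseRegular.
Context {R : realType}.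
Implicit Types (T t : R) (s : seq R).

Definition tau T s (i : nat) : R := nth T (0 :: s) i.

Definition pw_continuous_along (Y : topologicalType) T s (u : R -> Y) : Prop :=
  forall i, (i < size s)%N ->
    [/\ {in `]tau T s i, tau T s i.+1[, continuous u},
        exists y : Y, u r @[r --> (tau T s i)^'+] --> y
      & exists y : Y, u r @[r --> (tau T s i.+1)^'-] --> y].

Definition pw_continuous (Y : topologicalType) T (u : R -> Y) : Prop :=
  exists2 s, itv_partition 0 T s & pw_continuous_along T s u.

Definition NPC0 (Y : topologicalType) T (u : R -> Y) : Prop :=
  [/\ pw_continuous T u,
      {in `[0, T[, forall t, u r @[r --> t^'+] --> u t}
    & u r @[r --> T^'-] --> u T].

Definition PC1_along (Y : normedModType R) T s (x : R -> Y) : Prop :=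
  [/\ itv_partition 0 T s, {within `[0, T], continuous x},
      (forall i, (i < size s)%N ->
         {in `]tau T s i, tau T s i.+1[, forall t, derivable x t 1})
    & pw_continuous_along T s (derive1 x)].

Definition PC1 (Y : normedModType R) T (x : R -> Y) : Prop :=
  exists s, PC1_along T s x.

Definition PC1_in (Y : normedModType R) T (G : set Y) (x : R -> Y) : Prop :=
  PC1 T x /\ x @` `[0, T] `<=` G.

Definition ext_derive_along (Y : normedModType R) T s (x : R -> Y) t : Y :=
  if t == T then lim (derive1 x r @[r --> T^'-])
  else if t \in 0 :: s then lim (derive1 x r @[r --> t^'+])
  else derive1 x t.

(** The subdivision is chosen arbitrarily: see [ext_deriveE]. *)
Definition ext_derive (Y : normedModType R) T (x : R -> Y) (t : R) : Y :=
  ext_derive_along T (xget [::] [set s | PC1_along T s x]) x t.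

Lemma itv_partition_tau T s t : itv_partition 0 T s -> 0 <= t <= T ->
  t \notin 0 :: s ->
  exists2 i, (i < size s)%N & t \in `]tau T s i, tau T s i.+1[.
Proof.
rewrite /tau; move: (0 : R) => a; elim: s a => [|b s ih] a.
  move=> /itv_partition_nil <- /andP[a1 a2]; rewrite inE.
  by rewrite eq_le a1 a2.
move=> abs /andP[at_ tT]; rewrite inE negb_or => /andP[ta tbs].
have [tb|bt] := ltP t b.
  by exists 0%N => //=; rewrite in_itv/= lt_neqAle eq_sym ta at_.
have [|i si ti] := ih b (itv_partition_cons abs) _ tbs; first by rewrite bt.
by exists i.+1.
Qed.

Lemma ext_deriveE (Y : normedModType R) T s (x : R -> Y) t :
  PC1_along T s x -> t \in `[0, T] ->
  ext_derive T x t = ext_derive_along T s x t.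
Proof.
move=> xs; rewrite in_itv/= => t0T.
rewrite /ext_derive; set s' := xget _ _.
have xs' : PC1_along T s' x.
  by exact: (@xgetI _ [::] [set s | PC1_along T s x] _ xs).
have cvg_off s1 : PC1_along T s1 x -> t \notin 0 :: s1 ->
    lim (derive1 x r @[r --> t^'+]) = derive1 x t.
  move=> [p _ _ pw] ts1; have [i si ti] := itv_partition_tau p t0T ts1.
  have [xt _ _] := pw i si; apply: cvg_lim => //.
  exact: (cvg_at_right_filter (xt t ti)).
rewrite /ext_derive_along; case: ifP => // _.
case: ifPn => ts'; case: ifPn => ts //; first exact: (cvg_off s).
exact/esym/(cvg_off s').
Qed.

End PiecewiseRegular.

Section Bolza.
Context {R : realType} {E : completeNormedModType R} {U : topologicalType}.
Context {l m q : nat}.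
Variables (T : R) (Omega : set E) (xi0 : E).
Variables (f : R -> E -> U -> E) (f0 : 'I_l -> R -> E -> U -> R).
Variables (g0 : 'I_l -> E -> R) (g : 'I_m -> E -> R) (h : 'I_q -> E -> R).
Implicit Types (t : R) (x : R -> E) (u : R -> U).

Definition admissible x u : Prop :=
  [/\ PC1_in T Omega x /\ NPC0 T u,
      {in `[0, T], forall t, ext_derive T x t = f t (x t) (u t)},
      x 0 = xi0,
      forall a, 0 <= g a (x T)
    & forall b, h b (x T) = 0].

(** For admissible [(x, u)] and continuous [f0 i] the integrand is piecewise
    continuous on [[0, T]] with one-sided limits, so this Lebesgue integral is
    the Riemann integral. *)
Definition bolza_objective (i : 'I_l) x u : R :=
  g0 i (x T) + \int[lebesgue_measure]_(t in `[0, T]) f0 i t (x t) (u t).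

Definition pareto_optimal x u : Prop :=
  admissible x u /\
  ~ exists x' u',
      [/\ admissible x' u',
          forall i, bolza_objective i x u <= bolza_objective i x' u'
        & exists i, bolza_objective i x u < bolza_objective i x' u'].

Definition hamiltonian t (xi : E) (zeta : U)
    (p : 'L(E, R^o)) (theta : 'rV[R]_l) : R :=
  \sum_(i < l) theta 0 i * f0 i t xi zeta + p (f t xi zeta).

End Bolza.

(* Main.v *)
(** Adjoin the running costs to the state as coordinates [w]. Needle variations,
    which replace [u0] by [zeta_i] on disjoint intervals of length [a_i] near
    [t_i], move the end point [(x0 T, w0 T)] by [\sum_i a_i *: y_i T + o(|a|)],
    where [y_i] solves the linearized equation and [y_i t_i] is the jump of the
    right-hand side; Hadamard differentiability is exactly what transports this
    expansion to the terminal functions. The first-order images of the needles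
    generate a convex cone in a finite-dimensional space. If the cone is dense,
    finitely many needles improve all objectives at once, and since the end point
    is Lipschitz in [a >= 0], the Poincaré-Miranda theorem finds lengths for which
    the equality constraints hold exactly; this contradicts Pareto optimality.
    Otherwise a linear functional separates: its coefficients are the multipliers,
    and the adjoint equation transports it from [T] back to each [t < T], where it
    becomes the maximum principle. At [T], and for the continuity of the
    Hamiltonian, one passes to the limit. *)

Require Import Defs.
From HB Require Import structures.
From mathcomp Require Import all_boot all_order all_fingroup all_algebra.
From mathcomp Require Import all_classical all_reals all_analysis.
From mathcomp Require Import ring lra zify.

Set Implicit Arguments.
Unset Strict Implicit.
Unset Printing Implicit Defensive.

Import Order.TTheory GRing.Theory Num.Theory.
Import numFieldNormedType.Exports.

Local Open Scope classical_set_scope.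
Local Open Scope ring_scope.

(** * Right derivatives and right primitives *)

(** Trajectories live in a Banach space and are only piecewise smooth, so integrals are replaced by
    [right_primitive]: left continuity together with a right derivative at every time. For a càdlàg
    right-hand side this makes sense at the jumps too, involves no subdivision, and carries
    Gronwall's inequality and Picard's theorem. Lebesgue integrals occur only for scalars, in the
    cost and in dominated convergence.

    Three weak hypotheses shape the rest. Differentials are bounded only over compact sets, while
    balls of [E] need not be compact: [tube_bound] extracts a uniform tube from compact sets made of
    one convergent sequence. The dynamics are given on [Omega] only: a radial retraction onto the
    tube makes them globally Lipschitz, so perturbed trajectories exist for all lengths, and short
    needles never leave the tube. The terminal functions are differentiable at a single point, so
    the implicit function theorem cannot solve the equality constraints: a topological zero theorem
    asks for continuity alone, and it is proved by a parity count. *)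

Section RightDerivative.
Context {R : realType}.
Implicit Types (a b t s K : R) (X Y : normedModType R).

Lemma near_rightP t (P : R -> Prop) :
  (\forall s \near t^'+, P s) <->
  exists2 e, 0 < e & forall s, t < s < t + e -> P s.
Proof.
split=> [|[e e0 eP]].
  rewrite /at_right near_withinE => /nbhs_ballP [e /= e0 eP].
  exists e => // s /andP[ts se]; apply: eP => //.
  by rewrite -ball_normE/= distrC gtr0_norm ?subr_gt0// ltrBlDl.
near=> s; apply: eP; apply/andP; split; near: s; first exact: nbhs_right_gt.
by apply: nbhs_right_lt; rewrite ltrDl.
Unshelve. all: by end_near. Qed.

Lemma near_leftP t (P : R -> Prop) :
  (\forall s \near t^'-, P s) <->
  exists2 e, 0 < e & forall s, t - e < s < t -> P s.
Proof.
split=> [|[e e0 eP]].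
  rewrite /at_left near_withinE => /nbhs_ballP [e /= e0 eP].
  exists e => // s /andP[se st]; apply: eP => //.
  by rewrite -ball_normE/= gtr0_norm ?subr_gt0// ltrBlDl -ltrBlDr.
near=> s; apply: eP; apply/andP; split; near: s; last exact: nbhs_left_lt.
by apply: nbhs_left_gt; rewrite gtrBl.
Unshelve. all: by end_near. Qed.

(** Real induction. Let [c] be the supremum of the times up to which [P] holds throughout; the
    left-hand hypothesis gives [P c], and if [c < b] the right-hand one pushes past [c]. *)
Lemma continuous_induction a b (P : R -> Prop) :
  a <= b -> P a ->
  (forall t, a <= t < b -> (forall s, a <= s <= t -> P s) ->
     \forall s \near t^'+, P s) ->
  (forall t, a < t <= b -> (forall s, a <= s < t -> P s) -> P t) ->
  forall t, a <= t <= b -> P t.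
Proof.
move=> ab Pa Pr Pl.
pose S := [set t | a <= t <= b /\ forall s, a <= s <= t -> P s].
have Sa : S a by split; [rewrite lexx ab|move=> s; rewrite -eq_le => /eqP <-].
have hS : has_sup S by split; [exists a|exists b => t [/andP[]]].
set c := sup S.
have ac : a <= c by apply: ub_le_sup => //; case: hS.
have cb : c <= b by apply: ge_sup; [exists a|move=> t [/andP[]]].
have Pc s : a <= s < c -> P s.
  move=> /andP[as_ sc]; have [t [_ tP] st] := sup_gt (proj1 hS) sc.
  by apply: tP; rewrite as_ ltW.
have Sc : forall s, a <= s <= c -> P s.
  move=> s /andP[as_]; rewrite le_eqVlt => /orP[/eqP -> {s as_}|sc]; last first.
    by apply: Pc; rewrite as_.
  have [<-//|ca] := eqVneq a c.
  by apply: Pl => //; rewrite lt_neqAle ca ac.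
have [cbE|cb'] := eqVneq c b.
  by move=> t; rewrite -cbE; exact: Sc.
have {cb'} cb' : c < b by rewrite lt_neqAle cb' cb.
have : \forall s \near c^'+, P s by apply: Pr => //; rewrite ac.
move=> /near_rightP [e e0 eP].
pose d := Num.min (c + e / 2) b.
have cd : c < d by rewrite lt_min cb' andbT ltrDl divr_gt0.
suff : S d by move=> /(ub_le_sup (proj2 hS)); rewrite leNgt cd.
split; first by rewrite (le_trans ac (ltW cd)) ge_min lexx orbT.
move=> s /andP[as_ sd]; have [sc|cs] := leP s c; first by apply: Sc; rewrite as_.
apply: eP; rewrite cs (le_lt_trans sd)// gt_min ltrD2l.
by rewrite ltr_pdivrMr// mulr_natr mulr2n ltrDl e0.
Qed.

(** Only right difference quotients are controlled, and only up to [e], so no mean value theorem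
    applies. Allowing [v] a slope [d > 0] above its initial value leaves room for real induction;
    [d] is then sent to 0. *)
Lemma right_dini_nonincreasing a b (v : R -> R) :
  a <= b ->
  (forall t, a < t <= b -> v s @[s --> t^'-] --> v t) ->
  (forall t, a <= t < b -> forall e, 0 < e ->
     \forall s \near t^'+, v s <= v t + e * (s - t)) ->
  v b <= v a.
Proof.
move=> ab vl vr; apply/ler_addgt0Pr => e e0.
pose d := e / (b - a + 1).
have ba1 : 0 < b - a + 1 by rewrite ltr_wpDl// subr_ge0.
have d0 : 0 < d by rewrite divr_gt0.
have : v b <= v a + d * (b - a).
  apply: (@continuous_induction a b (fun t => v t <= v a + d * (t - a))) => //.
  - by rewrite subrr mulr0 addr0.
  - move=> t /andP[at_ tb] tP; near=> s.
    have := tP t; rewrite at_ lexx => /(_ isT) vt.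
    have : v s <= v t + d * (s - t) by near: s; apply: vr => //; rewrite at_.
    by move: vt; lra.
  - move=> t /andP[at_ tb] tP; have vt := vl t; rewrite at_ tb in vt.
    apply: (cvgr_to_le (vt isT)).
    near=> s; have st : s < t by near: s; exact: nbhs_left_lt.
    have as_ : a < s by near: s; exact: nbhs_left_gt.
    have := tP s; rewrite (ltW as_) st => /(_ isT); have : d * s <= d * t by rewrite ler_wpM2l ?ltW.
    lra.
  by rewrite ab lexx.
move=> /le_trans; apply; rewrite lerD2l /d.
by rewrite mulrAC ler_pdivrMr// ler_wpM2l ?(ltW e0)// lerDl.
Unshelve. all: by end_near. Qed.

Definition rderiv X (x : R -> X) t (v : X) : Prop :=
  forall e, 0 < e ->
    \forall s \near t^'+, `|x s - x t - (s - t) *: v| <= e * (s - t).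

(** The substitute for the integral of a Banach-valued càdlàg [g]. Right derivatives exist at the
    jumps of [g] as well and imply right continuity of [x]; left continuity is asked separately,
    since otherwise [x] could jump. *)
Definition right_primitive X a b (x g : R -> X) : Prop :=
  (forall t, a < t <= b -> x s @[s --> t^'-] --> x t) /\
  (forall t, a <= t < b -> rderiv x t (g t)).

Lemma rderiv_cst X (c : X) t : rderiv (fun=> c) t 0.
Proof.
move=> e e0; near=> s; have ts : t < s by near: s; exact: nbhs_right_gt.
by rewrite subrr scaler0 subrr normr0 mulr_ge0 ?(ltW e0)// subr_ge0 ltW.
Unshelve. all: by end_near. Qed.

Lemma rderivD X (x y : R -> X) t u v :
  rderiv x t u -> rderiv y t v -> rderiv (fun s => x s + y s) t (u + v).
Proof.
move=> xu yv e e0; have e2 : 0 < e / 2 by rewrite divr_gt0.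
near=> s; rewrite scalerDr.
have -> : x s + y s - (x t + y t) - ((s - t) *: u + (s - t) *: v) =
    (x s - x t - (s - t) *: u) + (y s - y t - (s - t) *: v).
  by rewrite addrACA -opprD; congr (_ - _); rewrite opprD addrACA.
rewrite (le_trans (ler_normD _ _))// [e]splitr mulrDl lerD//; near: s.
  exact: xu.
exact: yv.
Unshelve. all: by end_near. Qed.

Lemma rderiv_linear X Y (L : {linear X -> Y}) M (x : R -> X) t u :
  (forall z, `|L z| <= M * `|z|) ->
  rderiv x t u -> rderiv (L \o x) t (L u).
Proof.
move=> LM xu e e0; pose d := e / (`|M| + 1).
near=> s; rewrite /= -linearZ -!linearB.
have : `|x s - x t - (s - t) *: u| <= d * (s - t).
  by near: s; apply: xu; rewrite divr_gt0.
move=> xs; rewrite (le_trans (LM _))//.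
rewrite (@le_trans _ _ ((`|M| + 1) * (d * (s - t))))//.
  rewrite (le_trans (ler_wpM2r _ (ler_norm _)))// ler_pM//.
  by rewrite lerDl.
by rewrite mulrA /d mulrCA divff ?mulr1// gt_eqF.
Unshelve. all: by end_near. Qed.

Lemma rderiv_cvg X (x : R -> X) t u :
  rderiv x t u -> x s @[s --> t^'+] --> x t.
Proof.
move=> xu; apply/cvgrPdistC_le => e e0.
have d0 : 0 < e / (`|u| + 1) by rewrite divr_gt0// ltr_wpDl.
near=> s; have ts : t < s by near: s; exact: nbhs_right_gt.
have : `|x s - x t - (s - t) *: u| <= 1 * (s - t) by near: s; exact: xu.
have : s - t < e / (`|u| + 1) by near: s; exact: nbhs_right_ltDr.
rewrite ltr_pdivlMr ?ltr_wpDl// => st1 st2.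
rewrite -[x s - x t](subrK ((s - t) *: u)) (le_trans (ler_normD _ _))//.
rewrite normrZ gtr0_norm ?subr_gt0//; lra.
Unshelve. all: by end_near. Qed.

Lemma right_primitive_cst X a b (c : X) : right_primitive a b (fun=> c) (fun=> 0).
Proof. by split=> t _; [exact: cvg_cst|exact: rderiv_cst]. Qed.

Lemma right_primitiveD X a b (x y f g : R -> X) :
  right_primitive a b x f -> right_primitive a b y g ->
  right_primitive a b (fun s => x s + y s) (fun s => f s + g s).
Proof.
move=> [xl xr] [yl yr]; split=> t ti; last by apply: rderivD; [exact: xr|exact: yr].
by apply: cvgD; [exact: xl|exact: yl].
Qed.

Lemma right_primitive_linear X Y (L : {linear X -> Y}) M a b (x f : R -> X) :
  (forall z, `|L z| <= M * `|z|) ->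
  right_primitive a b x f -> right_primitive a b (L \o x) (L \o f).
Proof.
move=> LM [xl xr]; split=> t ti; last by apply: (rderiv_linear LM); exact: xr.
have /linear_boundedP/linear_bounded_continuous Lc : \forall r \near +oo, forall z, `|L z| <= r * `|z|.
  by near=> r => z; rewrite (le_trans (LM z))// ler_wpM2r//; near: r; exact: nbhs_pinfty_ge.
by apply: cvg_comp (xl _ ti) (Lc _).
Unshelve. all: by end_near. Qed.

Lemma right_primitiveZ X a b k (x f : R -> X) :
  right_primitive a b x f ->
  right_primitive a b (fun s => k *: x s) (fun s => k *: f s).
Proof.
by apply: (@right_primitive_linear _ _ ( *:%R k) `|k|) => z; rewrite normrZ.
Qed.

Lemma right_primitiveB X a b (x y f g : R -> X) :
  right_primitive a b x f -> right_primitive a b y g ->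
  right_primitive a b (fun s => x s - y s) (fun s => f s - g s).
Proof.
move=> xf yg; apply: right_primitiveD => //.
have := right_primitiveZ (-1) yg.
by under [X in right_primitive _ _ X _]eq_fun do rewrite scaleN1r;
   under [X in right_primitive _ _ _ X]eq_fun do rewrite scaleN1r.
Qed.

Lemma right_primitive_sub X a b c d (x g : R -> X) :
  a <= c -> d <= b -> right_primitive a b x g -> right_primitive c d x g.
Proof.
move=> ac db [xl xr]; split=> t /andP[ct td].
  by apply: xl; rewrite (le_lt_trans ac ct) (le_trans td db).
by apply: xr; rewrite (le_trans ac ct) (lt_le_trans td db).
Qed.

Lemma right_primitive_eq X a b (x g h : R -> X) :
  (forall t, a <= t < b -> g t = h t) ->
  right_primitive a b x g -> right_primitive a b x h.
Proof. by move=> gh [xl xr]; split=> // t ti; rewrite -gh//; exact: xr. Qed.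

(** The scalar function [|w t - w a| - phi t] has nonpositive upper right derivative, whatever the
    norm. The bound is a function [psi] rather than a constant because needles contribute bounds
    concentrated on short intervals. *)
Lemma right_primitive_increment X a b (w g : R -> X) (phi psi : R -> R^o) :
  a <= b -> right_primitive a b w g -> right_primitive a b phi psi ->
  (forall t, a <= t < b -> `|g t| <= psi t) ->
  `|w b - w a| <= phi b - phi a.
Proof.
move=> ab [wl wr] [pl pr] gp.
have := @right_dini_nonincreasing a b (fun t => `|w t - w a| - phi t) ab.
rewrite subrr normr0 sub0r => H.
suff : `|w b - w a| - phi b <= - phi a by lra.
apply: H => t ti.
  apply: cvgB; last exact: pl.
  by apply: cvg_norm; apply: cvgB; [exact: wl|exact: cvg_cst].
move=> e e0; have e2 : 0 < e / 2 by rewrite divr_gt0.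
near=> s.
have ts : t < s by near: s; exact: nbhs_right_gt.
have ws : `|w s - w t - (s - t) *: g t| <= e / 2 * (s - t) by near: s; exact: wr.
have ps : `|phi s - phi t - (s - t) *: psi t| <= e / 2 * (s - t) by near: s; exact: pr.
have gs : (s - t) * `|g t| <= (s - t) * psi t by rewrite ler_wpM2l ?subr_ge0 ?(ltW ts)// gp.
have := ler_normD (w s - w t - (s - t) *: g t) ((s - t) *: g t).
rewrite subrK normrZ gtr0_norm ?subr_gt0// => w1.
have := ler_normD (w s - w t) (w t - w a); rewrite addrA subrK => w2.
by move: ps; rewrite ler_norml /GRing.scale/= => /andP[]; lra.
Unshelve. all: by end_near. Qed.

(** The weighted function [E t * |w t| - phi t] is nonincreasing. As the weight is at most 1 and
    [psi >= 0], the primitive [phi] can stay outside the weight, so no integral of [psi] against an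
    exponential is needed. *)
Lemma gronwall X a b K (w g : R -> X) (phi psi : R -> R^o) :
  a <= b -> 0 <= K -> right_primitive a b w g -> right_primitive a b phi psi ->
  (forall t, a <= t < b -> 0 <= psi t) ->
  (forall t, a <= t < b -> `|g t| <= K * `|w t| + psi t) ->
  `|w b| <= expR (K * (b - a)) * (`|w a| + (phi b - phi a)).
Proof.
move=> ab K0 [wl wr] [pl pr] p0 gp.
pose E t := expR (- (K * (t - a))).
have : E b * `|w b| - phi b <= E a * `|w a| - phi a.
  apply: (@right_dini_nonincreasing a b (fun t => E t * `|w t| - phi t)) => // t ti.
    apply: cvgB; last exact: pl.
    apply: cvgM; last by apply: cvg_norm; exact: wl.
    apply: cvg_at_left_filter.
    apply: continuous_comp; last exact: continuous_expR.
    apply: cvgN; apply: cvgM; first exact: cvg_cst.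
    by apply: cvgB; [exact: cvg_id|exact: cvg_cst].
  move=> e e0; have e2 : 0 < e / 2 by rewrite divr_gt0.
  have /andP[at_ _] := ti; near=> s.
  have ts : t < s by near: s; exact: nbhs_right_gt.
  have ws : `|w s - w t - (s - t) *: g t| <= e / 2 * (s - t) by near: s; exact: wr.
  have ps : `|phi s - phi t - (s - t) *: psi t| <= e / 2 * (s - t) by near: s; exact: pr.
  have gs : (s - t) * `|g t| <= (s - t) * (K * `|w t| + psi t).
    by rewrite ler_wpM2l ?subr_ge0 ?(ltW ts)// gp.
  have := ler_normD (w s - w t - (s - t) *: g t) ((s - t) *: g t).
  rewrite subrK normrZ gtr0_norm ?subr_gt0// => w1.
  have := ler_normD (w s - w t) (w t); rewrite subrK => w2.
  have Es0 : 0 <= E s by exact: expR_ge0.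
  have Es1 : E s <= 1.
    rewrite /E -expR0 ler_expR oppr_le0 mulr_ge0// subr_ge0.
    by rewrite (le_trans at_ (ltW ts)).
  (* By [1 + x <= exp x], the decay of the weight from [t] to [s] absorbs the growth factor
     [1 + K * (s - t)] of the norm. *)
  have Est : E s * (1 + K * (s - t)) <= E t.
    rewrite /E (_ : - (K * (t - a)) = - (K * (s - a)) + K * (s - t)); last by ring.
    by rewrite expRD ler_wpM2l ?expR_ge0// expR_ge1Dx.
  have p0t := p0 t ti.
  have Ew : E s * `|w s| <= E s * (`|w t| * (1 + K * (s - t)) + (s - t) * (psi t + e / 2)).
    by rewrite ler_wpM2l//; lra.
  have Ew2 : E s * (1 + K * (s - t)) * `|w t| <= E t * `|w t| by rewrite ler_wpM2r.
  have Ew3 : E s * ((s - t) * (psi t + e / 2)) <= (s - t) * (psi t + e / 2).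
    by rewrite ler_piMl// mulr_ge0 ?subr_ge0 ?ltW// ltr_wpDl.
  by move: ps; rewrite ler_norml /GRing.scale/= => /andP[]; lra.
rewrite {2}/E subrr mulr0 oppr0 expR0 mul1r => H.
have -> : `|w b| = expR (K * (b - a)) * (E b * `|w b|).
  by rewrite mulrA /E -expRD subrr expR0 mul1r.
by rewrite ler_wpM2l ?expR_ge0//; lra.
Unshelve. all: by end_near. Qed.

End RightDerivative.

(** * Càdlàg functions, step functions and uniform limits of primitives *)

Section Cadlag.
Context {R : realType}.
Implicit Types (a b t s K : R) (X Y : normedModType R).

(** The value at [b] is left free, because a right primitive on [[a, b]] reads its derivative only
    on [[a, b)]. *)
Definition cadlag (Y : topologicalType) a b (g : R -> Y) : Prop :=
  (forall t, a <= t < b -> g s @[s --> t^'+] --> g t) /\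
  (forall t, a < t <= b -> exists y : Y, g s @[s --> t^'-] --> y).

Definition cont_on (Y : topologicalType) a b (g : R -> Y) : Prop :=
  (forall t, a <= t < b -> g s @[s --> t^'+] --> g t) /\
  (forall t, a < t <= b -> g s @[s --> t^'-] --> g t).

Lemma cont_on_cadlag (Y : topologicalType) a b (g : R -> Y) :
  cont_on a b g -> cadlag a b g.
Proof. by move=> [gr gl]; split=> // t ti; exists (g t); exact: gl. Qed.

Lemma cont_on_within (Y : normedModType R) a b (g : R -> Y) : a < b ->
  {within `[a, b], continuous g} <-> cont_on a b g.
Proof.
move=> ab; rewrite continuous_within_itvP//; split=> [[gi ga gb]|[gr gl]].
  split=> t /andP[].
    rewrite le_eqVlt => /predU1P[<-//|at_ tb].
    by apply: cvg_at_right_filter; apply: gi; rewrite in_itv/= at_.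
  rewrite le_eqVlt => at_ /predU1P[->//|tb].
  by apply: cvg_at_left_filter; apply: gi; rewrite in_itv/= at_.
split; [|by apply: gr; rewrite lexx|by apply: gl; rewrite lexx andbT].
move=> t; rewrite in_itv/= => /andP[at_ tb].
apply/left_right_continuousP; split; first by apply: gl; rewrite at_ ltW.
by apply: gr; rewrite tb ltW.
Qed.

Lemma right_primitive_cont X a b (x g : R -> X) :
  right_primitive a b x g -> cont_on a b x.
Proof. by move=> [xl xr]; split=> // t ti; exact: rderiv_cvg (xr t ti). Qed.

(** A step function is stored as its list of jumps, each a time with an increment. Its primitive is
    then a sum of ramps, and the jump times need no order. *)
Definition stepfun X (p : seq (R * X)) r : X := \sum_(c <- p | c.1 <= r) c.2.

(** Real induction on the time up to which an approximation exists. The invariant that all jumps of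
    [p] occur before [t] makes [stepfun p] constant from [t] on, so one further jump at [t] sets it
    to any value [y]: the value of [g] when moving right, its left limit when closing up. *)
Lemma step_approx X a b (g : R -> X) e : a <= b -> cadlag a b g -> 0 < e ->
  exists p : seq (R * X), forall t, a <= t < b -> `|g t - stepfun p t| <= e.
Proof.
move=> ab [gr gl] e0.
pose P t := exists2 p : seq (R * X), (forall c, c \in p -> c.1 <= t) &
  forall s, a <= s < t -> `|g s - stepfun p s| <= e.
suff : P b by move=> [p _ pP]; exists p.
have ext t s y : a <= t -> t <= s -> P t ->
    (forall r, t <= r < s -> `|g r - y| <= e) -> P s.
  move=> at_ ts [p pt pP] yP.
  exists ((t, y - stepfun p t) :: p) => [c|r /andP[ar rs]].
    by rewrite inE => /predU1P[->//|/pt ct]; rewrite (le_trans ct).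
  rewrite /stepfun big_cons /=; case: ifPn => [tr|]; last first.
    by rewrite -ltNge => rt; apply: pP; rewrite ar.
  rewrite (_ : \sum_(c <- p | c.1 <= r) c.2 = stepfun p t); last first.
    rewrite /stepfun big_seq_cond [RHS]big_seq_cond; apply: eq_bigl => c.
    by have [/pt ct|//] := boolP (c \in p); rewrite /= ct (le_trans ct).
  by rewrite subrK; apply: yP; rewrite tr.
apply: (@continuous_induction _ a b P) => //.
- by exists [::] => // s /andP[as_ sa]; have := le_lt_trans as_ sa; rewrite ltxx.
- move=> t /andP[at_ tb] /(_ t); rewrite at_ lexx => /(_ isT) Pt.
  have /cvgrPdistC_le/(_ e e0)/near_rightP[d d0 dP] : g s @[s --> t^'+] --> g t.
    by apply: gr; rewrite at_.
  apply/near_rightP; exists d => // s /andP[ts sd].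
  apply: (ext t s (g t)) => //; first exact: ltW.
  move=> r /andP[]; rewrite le_eqVlt => /predU1P[<- _|tr rs].
    by rewrite subrr normr0 ltW.
  by apply: dP; rewrite tr (lt_trans rs).
- move=> t /andP[at_ tb] Pt; have [|y] := gl t; first by rewrite at_.
  move=> /cvgrPdistC_le/(_ e e0)/near_leftP[d d0 dP].
  pose s := Num.max a (t - d / 2).
  have st : s < t by rewrite gt_max at_ gtrBl divr_gt0.
  have as_ : a <= s by rewrite le_max lexx.
  apply: (ext s t y) => //; [exact: ltW|by apply: Pt; rewrite as_|].
  move=> r /andP[sr rt]; apply: dP; rewrite rt andbT.
  have : t - d / 2 <= r by apply: le_trans sr; rewrite le_max lexx orbT.
  by apply: lt_le_trans; rewrite ltrD2l ltrN2 ltr_pdivrMr// ltr_pMr// ltr1n.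
- by rewrite ab lexx.
Qed.

Lemma cadlag_bounded X a b (g : R -> X) : a <= b -> cadlag a b g ->
  exists2 M, 0 < M & forall t, a <= t < b -> `|g t| <= M.
Proof.
move=> ab cg; have [p pP] := step_approx ab cg ltr01.
have S0 : 0 <= \sum_(c <- p) `|c.2| by exact: sumr_ge0.
exists (1 + \sum_(c <- p) `|c.2|); first by rewrite ltr_pwDl.
move=> t ti; rewrite -(subrK (stepfun p t) (g t)).
rewrite (le_trans (ler_normD _ _))// lerD ?pP//.
rewrite (le_trans (ler_norm_sum _ _ _))// big_mkcond/=.
by apply: ler_sum => c _; case: ifP.
Qed.

Lemma right_primitive_ramp X a b c (v : X) :
  right_primitive a b (fun r => Num.max (r - c) 0 *: v)
                      (fun r => if c <= r then v else 0).
Proof.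
split=> t ti.
  apply: cvg_at_left_filter; apply: cvgZl; apply: (@continuous_max _ _ (fun r => r - c) (fun=> 0)).
    by apply: cvgB; [exact: cvg_id|exact: cvg_cst].
  exact: cvg_cst.
move=> e e0; case: ifPn => ct.
  near=> s; have ts : t < s by near: s; exact: nbhs_right_gt.
  rewrite !max_l ?subr_ge0// ?(le_trans ct (ltW ts))//.
  rewrite -!scalerBl (_ : _ - _ - _ = 0); last by ring.
  by rewrite scale0r normr0 mulr_ge0 ?(ltW e0)// subr_ge0 ltW.
rewrite -ltNge in ct; near=> s.
have ts : t < s by near: s; exact: nbhs_right_gt.
have sc : s < c by near: s; exact: nbhs_right_lt.
rewrite !max_r ?subr_le0 ?(ltW sc) ?(ltW ct)//.
by rewrite scale0r scaler0 !subrr normr0 mulr_ge0 ?(ltW e0)// subr_ge0 ltW.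
Unshelve. all: by end_near. Qed.

Lemma right_primitive_sum X a b (I : Type) (r : seq I) (x g : I -> R -> X) :
  (forall i, right_primitive a b (x i) (g i)) ->
  right_primitive a b (fun t => \sum_(i <- r) x i t) (fun t => \sum_(i <- r) g i t).
Proof.
move=> xg; elim: r => [|i r ih].
  under eq_fun do rewrite big_nil.
  under [X in right_primitive _ _ _ X]eq_fun do rewrite big_nil.
  exact: right_primitive_cst.
under eq_fun do rewrite big_cons.
under [X in right_primitive _ _ _ X]eq_fun do rewrite big_cons.
exact: right_primitiveD.
Qed.

Lemma right_primitive_step X a b (p : seq (R * X)) :
  exists x, right_primitive a b x (stepfun p).
Proof.
exists (fun t => \sum_(c <- p) Num.max (t - c.1) 0 *: c.2).
have -> : stepfun p = fun t => \sum_(c <- p) if c.1 <= t then c.2 else 0.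
  by apply/funext => t; rewrite /stepfun big_mkcond.
by apply: right_primitive_sum => c; exact: right_primitive_ramp.
Qed.

Lemma right_primitive_increment_cst X a b (w g : R -> X) M : a <= b ->
  right_primitive a b w g -> (forall t, a <= t < b -> `|g t| <= M) ->
  `|w b - w a| <= M * (b - a).
Proof.
move=> ab wg gM.
have [pl pr] := @right_primitive_ramp R^o a b a (M : R^o).
have := right_primitive_increment ab wg (conj pl pr).
rewrite subrr maxxx max_l ?subr_ge0// scale0r subr0 /GRing.scale/= mulrC; apply.
by move=> t /[dup] ti /andP[-> _]; exact: gM.
Qed.

(* Approximants of [x] with derivatives close to [g] need not be indexed:
   any two of them have close increments. *)
Lemma right_primitive_closed X a b (x g : R -> X) :
  (forall e, 0 < e -> exists y h, [/\ right_primitive a b y h,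
     forall t, a <= t <= b -> `|y t - x t| <= e
   & forall t, a <= t < b -> `|h t - g t| <= e]) ->
  right_primitive a b x g.
Proof.
move=> H.
have incr d y h s t : right_primitive a b y h ->
    (forall t, a <= t < b -> `|h t - g t| <= d) -> a <= t -> t <= s -> s <= b ->
    `|x s - x t - (y s - y t)| <= d * (s - t).
  move=> yh hg at_ ts sb; apply/ler_addgt0Pr => e e0.
  have st0 : 0 < s - t + 2 by rewrite ltr_wpDl ?subr_ge0.
  (* A second approximant of precision [d'] costs [d'] at each of the times [t] and [s], and
     [d' * (s - t)] in between; hence the divisor [s - t + 2]. *)
  have [y' [h' [y'h' y'x h'g]]] := H (e / (s - t + 2)) (divr_gt0 e0 st0).
  set d' := e / _ in y'x h'g; have d'E : e = d' * (s - t + 2) by rewrite divfK// gt_eqF.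
  have I1 : `|y' s - y s - (y' t - y t)| <= (d' + d) * (s - t).
    apply: (right_primitive_increment_cst ts
      (right_primitive_sub at_ sb (right_primitiveB y'h' yh))) => r /andP[tr rs].
    have ri : a <= r < b by rewrite (le_trans at_ tr) (lt_le_trans rs sb).
    rewrite -(subrK (g r) (h' r)) -addrA (le_trans (ler_normD _ _))// lerD//; first exact: h'g.
    by rewrite distrC; exact: hg.
  have I2 : `|x s - y' s| <= d' by rewrite distrC y'x// sb (le_trans at_ ts).
  have I3 : `|y' t - x t| <= d' by rewrite y'x// at_ (le_trans ts sb).
  have -> : x s - x t - (y s - y t) = (x s - y' s) + ((y' s - y s) - (y' t - y t)) + (y' t - x t).
    have -> : y' s - y s - (y' t - y t) = (y' s - y' t) - (y s - y t).
      by rewrite !opprD !opprK addrACA.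
    by rewrite -[RHS]addrA [X in _ = _ + X]addrAC subrKA [RHS]addrA subrKA.
  rewrite (le_trans (ler_normD _ _))// (le_trans (lerD (ler_normD _ _) (lexx _)))//.
  by rewrite d'E; lra.
split=> t /andP[at_ tb].
  apply/cvgrPdistC_le => e e0; have e3 : 0 < e / 3 by rewrite divr_gt0.
  have [y [h [yh yx hg]]] := H _ e3.
  have [yl _] := yh; have := yl t; rewrite at_ tb => /(_ isT) /cvgrPdistC_le/(_ _ e3) ys.
  near=> s; have st : s < t by near: s; exact: nbhs_left_lt.
  have as_ : a < s by near: s; exact: nbhs_left_gt.
  have I1 : `|y s - y t| <= e / 3 by near: s.
  have I2 : `|x s - y s| <= e / 3 by rewrite distrC yx// (ltW as_) (ltW (lt_le_trans st tb)).
  have I3 : `|y t - x t| <= e / 3 by rewrite yx// (ltW at_).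
  rewrite -(subrKA (y s)) (le_trans (ler_normD _ _))//.
  rewrite -(subrKA (y t) (y s)); have := ler_normD (y s - y t) (y t - x t); lra.
move=> e e0; have e3 : 0 < e / 3 by rewrite divr_gt0.
have [y [h [yh yx hg]]] := H _ e3.
have [_ yr] := yh; have := yr t; rewrite at_ tb => /(_ isT) yt.
near=> s; have ts : t < s by near: s; exact: nbhs_right_gt.
have sb : s <= b by near: s; exact: nbhs_right_le.
have I1 := incr _ _ _ _ _ yh hg at_ (ltW ts) sb.
have I2 : `|y s - y t - (s - t) *: h t| <= e / 3 * (s - t) by near: s; exact: yt.
have I3 : `|(s - t) *: (h t - g t)| <= e / 3 * (s - t).
  rewrite normrZ gtr0_norm ?subr_gt0// mulrC ler_wpM2r ?subr_ge0 ?(ltW ts)//.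
  by apply: hg; rewrite at_.
rewrite -(subrK (y s - y t) (x s - x t)) -addrA (le_trans (ler_normD _ _))//.
rewrite -(subrK ((s - t) *: h t) (y s - y t)) -[X in _ + `|X|]addrA.
rewrite -scalerBr subrK.
have := ler_normD (y s - y t - (s - t) *: h t) ((s - t) *: (h t - g t)); lra.
Unshelve. all: by end_near. Qed.

End Cadlag.

(** * Existence of primitives and Picard's theorem *)

Section InitialValueProblem.
Context {R : realType}.
Implicit Types (a b t s K : R) (X Y : normedModType R).

(** A predicate rather than a structure, so that it can be proved for operator spaces, products and
    row vectors and then fed to the same existence theorems. *)
Definition seq_complete X : Prop := forall u : nat -> X,
  (forall e : R, 0 < e -> exists N, forall n m, (N <= n)%N -> (N <= m)%N ->
     `|u n - u m| <= e) ->
  exists v : X, u @ \oo --> v.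

Lemma complete_seq_complete (X : completeNormedModType R) : seq_complete X.
Proof.
move=> u uC; exists (lim (u @ \oo)); apply: cauchy_cvg.
apply: cauchy_exP => e e0.
have e2 : 0 < e / 2 by rewrite divr_gt0.
have [N NP] := uC _ e2.
exists (u N); exists N => // n /= Nn.
by rewrite -ball_normE /= (le_lt_trans (NP _ _ _ _))// gtr_pMr ?ltr_pdivrMr// invf_lt1 ?ltr1n.
Qed.

Lemma exists_nat_inv_le (e : R) : 0 < e -> exists N, forall n, (N <= n)%N -> n.+1%:R^-1 <= e :> R.
Proof.
move=> e0; have /cvgrPdist_le/(_ e e0)[N _ NP] := @cvg_harmonic R.
exists N => n /NP; rewrite sub0r normrN ger0_norm ?invr_ge0//.
Qed.

(** Primitives of step approximations, normalized to vanish at [a], are uniformly Cauchy because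
    their derivatives are close; [right_primitive_closed] identifies the derivative of the limit. *)
Lemma exists_right_primitive X a b (g : R -> X) : seq_complete X -> a <= b ->
  cadlag a b g -> exists x, right_primitive a b x g.
Proof.
move=> cX ab cg.
have /choice[y0 y0P] (n : nat) : exists y : R -> X, exists2 h, right_primitive a b y h &
    forall t, a <= t < b -> `|h t - g t| <= n.+1%:R^-1.
  have n0 : 0 < n.+1%:R^-1 :> R by rewrite invr_gt0 ltr0n.
  have [p pP] := step_approx ab cg n0.
  have [y yp] := right_primitive_step a b p; exists y; exists (stepfun p) => // t ti.
  by rewrite distrC pP.
pose y n t := y0 n t - y0 n a.
have yP n : exists2 h, right_primitive a b (y n) h &
    forall t, a <= t < b -> `|h t - g t| <= n.+1%:R^-1.
  have [h yh hg] := y0P n; exists h => //.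
  have := right_primitiveB yh (right_primitive_cst a b (y0 n a)).
  by apply: right_primitive_eq => t _; rewrite subr0.
have yC n m t : a <= t <= b -> `|y n t - y m t| <= (n.+1%:R^-1 + m.+1%:R^-1) * (b - a).
  move=> /andP[at_ tb]; have [h yh hg] := yP n; have [k yk kg] := yP m.
  have ymk := right_primitive_sub (lexx a) tb (right_primitiveB yh yk).
  have := @right_primitive_increment_cst _ _ _ _ _ _ (n.+1%:R^-1 + m.+1%:R^-1) at_ ymk.
  rewrite /y !subrr subr0 => H; apply: le_trans (H _) _ => [s /andP[as_ st]|].
    have si : a <= s < b by rewrite as_ (lt_le_trans st).
    rewrite -(subrKA (g s)) (le_trans (ler_normD _ _))// lerD ?hg//.
    by rewrite distrC kg.
  by rewrite ler_wpM2l ?addr_ge0 ?invr_ge0// lerD2r.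
have ba : 0 < b - a + 1 by rewrite ltr_wpDl// subr_ge0.
have yl t : a <= t <= b -> exists v : X, y n t @[n --> \oo] --> v.
  move=> ti; apply: (cX (fun n => y n t)) => e e0; pose d := e / (b - a + 1) / 2.
  have d0 : 0 < d by rewrite !divr_gt0.
  have [N NP] := exists_nat_inv_le d0.
  exists N => n m /NP nd /NP md; rewrite (le_trans (yC n m t ti))//.
  rewrite (@le_trans _ _ ((d + d) * (b - a + 1)))//.
    by apply: ler_pM; rewrite ?subr_ge0 ?lerDl//; exact: lerD.
  by rewrite /d -splitr divfK// gt_eqF.
have /choice[x xP] : forall t : R, exists v : X, a <= t <= b -> y n t @[n --> \oo] --> v.
  move=> t; have [ti|nti] := boolP (a <= t <= b); last by exists 0.
  by have [v] := yl t ti; exists v.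
exists x; apply: right_primitive_closed => e e0; pose d := e / (b - a + 1).
have d0 : 0 < d by rewrite divr_gt0.
have d2 : 0 < d / 2 by rewrite divr_gt0.
have [N NP] := exists_nat_inv_le d2.
have de : d * (b - a + 1) = e by rewrite divfK// gt_eqF.
have [h yh hg] := yP N; exists (y N), h; split=> // t ti.
- have xN : `|y N t - y m t| @[m --> \oo] --> `|y N t - x t|.
    by apply: cvg_norm; apply: cvgB; [exact: cvg_cst|exact: xP t ti].
  apply: (cvgr_to_le xN); exists N => // m /= Nm; rewrite (le_trans (yC N m t ti))//.
  apply: (@le_trans _ _ (d * (b - a + 1))); last by rewrite de.
  apply: ler_pM; rewrite ?subr_ge0 ?lerDl//.
  by rewrite [d]splitr; apply: lerD; exact: NP.
- rewrite (le_trans (hg t ti))// (le_trans (NP N _))// -de.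
  have : d <= d * (b - a + 1) by rewrite ler_peMr ?(ltW d0)// lerDr subr_ge0.
  by move: d0; lra.
Qed.

Lemma rderiv_derive1 X (x : R -> X) t : derivable x t 1 -> rderiv x t (derive1 x t).
Proof.
move=> xt e e0.
have := xt; rewrite /derivable.
move=> /cvg_ex[v vP]; have -> : derive1 x t = v.
  by rewrite derive1E; apply: cvg_lim.
move: vP => /cvgrPdistC_le/(_ e e0); rewrite /dnbhs near_withinE.
move=> /nbhs_ballP[d /= d0 dP]; apply/near_rightP; exists d => // s /andP[ts sd].
have st0 : 0 < s - t by rewrite subr_gt0.
have := dP (s - t); rewrite -ball_normE /= sub0r normrN gtr0_norm// ltrBlDl sd.
move=> /(_ isT); rewrite gt_eqF// => /(_ isT).
rewrite /= scaler1 subrK => H.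
rewrite -[X in `|X - _|](@scalerKV _ _ (s - t))// ?unitfE ?gt_eqF//.
by rewrite -scalerBr normrZ gtr0_norm// mulrC ler_wpM2r// ltW.
Qed.

Lemma right_primitive_expR a b (k c t0 : R) : k != 0 ->
  right_primitive a b (fun t => c * expR (k * (t - t0)) : R^o)
     (fun t => c * k * expR (k * (t - t0)) : R^o).
Proof.
move=> k0.
have D (t : R) : is_derive t 1 (fun t => c * expR (k * (t - t0)) : R^o) (c * k * expR (k * (t - t0))).
  apply: is_derive_eq; rewrite /GRing.scale/=; ring.
split=> t ti.
  apply: cvg_at_left_filter; have /derivable1_diffP/differentiable_continuous := @ex_derive _ _ _ _ _ _ _ (D t).
  by [].
have := rderiv_derive1 (@ex_derive _ _ _ _ _ _ _ (D t)).
by rewrite derive1E derive_val.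
Qed.

Lemma geometric_cvg X (u : nat -> X) B : seq_complete X -> 0 <= B ->
  (forall n, `|u n.+1 - u n| <= B * 2^-1 ^+ n) ->
  exists v, forall n, `|u n - v| <= 2 * B * 2^-1 ^+ n.
Proof.
move=> cX B0 uB.
have H n k : `|u (n + k)%N - u n| <= 2 * B * 2^-1 ^+ n * (1 - 2^-1 ^+ k).
  elim: k => [|k ih]; first by rewrite addn0 !subrr normr0 mulr0.
  rewrite addnS -(subrKA (u (n + k)%N)) (le_trans (ler_normD _ _))//.
  rewrite (le_trans (lerD (uB _) ih))// exprD exprS.
  by rewrite le_eqVlt; apply/orP; left; apply/eqP; field.
have H' n m : (n <= m)%N -> `|u m - u n| <= 2 * B * 2^-1 ^+ n.
  move=> nm; rewrite -(subnKC nm) (le_trans (H _ _))//.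
  apply: ler_piMr; first by rewrite !mulr_ge0// exprn_ge0// invr_ge0.
  by rewrite gerBl exprn_ge0// invr_ge0.
have c0 : 2 * B * 2^-1 ^+ n @[n --> \oo] --> (0 : R).
  have h1 : `|2^-1| < 1 :> R by rewrite ger0_norm ?invr_ge0// invf_lt1 ?ltr1n.
  exact: (@cvg_geometric _ (2 * B) _ h1).
have [v vP] : exists v : X, u @ \oo --> v.
  apply: cX => e e0; have e2 : 0 < e / 2 by rewrite divr_gt0.
  have /cvgrPdist_le/(_ _ e2)[N _ NP] := c0.
  exists N => n m Nn Nm.
  have := NP N (leqnn N); rewrite sub0r normrN => /(le_trans (ler_norm _)) NP'.
  rewrite -(subrKA (u N)) (le_trans (ler_normD _ _))// [e]splitr lerD//.
    exact: le_trans (H' _ _ _) NP'.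
  by rewrite distrC; exact: le_trans (H' _ _ _) NP'.
exists v => n; have vn : `|u n - u m| @[m --> \oo] --> `|u n - v|.
  by apply: cvg_norm; apply: cvgB; [exact: cvg_cst|exact: vP].
by apply: (cvgr_to_le vn); exists n => // m /= nm; rewrite distrC H'.
Qed.

End InitialValueProblem.

Section Picard.
Context {R : realType}.
Implicit Types (a b t s K : R) (X Y : normedModType R).

(** Bielecki's weight: integrating [exp (2 K |t - t0|)] away from [t0] divides it by [2 K], so one
    Picard step with Lipschitz constant [K] halves the weighted norm. This makes the iteration
    contract on the whole interval, on both sides of [t0]. *)
Lemma right_primitive_weighted X a b t0 K C (w g : R -> X) :
  a <= t0 <= b -> 0 < K -> 0 <= C -> right_primitive a b w g -> w t0 = 0 ->
  (forall t, a <= t < b -> `|g t| <= K * (C * expR (2 * K * `|t - t0|))) ->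
  forall t, a <= t <= b -> `|w t| <= C / 2 * expR (2 * K * `|t - t0|).
Proof.
move=> /andP[at0 t0b] K0 C0 wg w0 gC t /andP[at_ tb].
have K2 : 2 * K != 0 by rewrite mulf_neq0// gt_eqF.
have [t0t|tt0] := leP t0 t.
  have := right_primitive_increment t0t (right_primitive_sub at0 tb wg)
     (right_primitive_expR t0 t (C / 2) t0 K2).
  rewrite w0 subr0 subrr mulr0 expR0 mulr1 => H.
  rewrite ger0_norm ?subr_ge0//; apply: le_trans (H _) _ => [s /andP[t0s st]|].
    have := gC s; rewrite (le_trans at0 t0s) (lt_le_trans st tb) => /(_ isT).
    by rewrite ger0_norm ?subr_ge0//; lra.
  by rewrite gerBl divr_ge0.
have K2N : - (2 * K) != 0 by rewrite oppr_eq0.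
have := right_primitive_increment (ltW tt0) (right_primitive_sub at_ t0b wg)
   (right_primitive_expR t t0 (- (C / 2)) t0 K2N).
rewrite w0 sub0r normrN subrr mulr0 expR0 mulr1 => H.
rewrite ltr0_norm ?subr_lt0// mulrN -mulNr.
apply: le_trans (H _) _ => [s /andP[ts st0]|].
  have := gC s; rewrite (le_trans at_ ts) (lt_le_trans st0 t0b) => /(_ isT).
  by rewrite ltr0_norm ?subr_lt0// mulrN -mulNr; lra.
have : 0 <= C / 2 by rewrite divr_ge0.
lra.
Qed.

(** Picard iteration in Bielecki's weighted norm. The base time [t0] is arbitrary because the
    equation is started at 0 for trajectories, at the needle time for the linearized equation, and
    at [T] for the adjoint one. *)
Theorem initial_value_problem X a b t0 K (F : R -> X -> X) (xi : X) :
  seq_complete X -> a <= t0 <= b -> 0 < K ->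
  (forall x, cont_on a b x -> cadlag a b (fun t => F t (x t))) ->
  (forall t, a <= t < b -> forall x y, `|F t x - F t y| <= K * `|x - y|) ->
  exists2 x, right_primitive a b x (fun t => F t (x t)) & x t0 = xi.
Proof.
move=> cX /[dup] t0ab /andP[at0 t0b] K0 Fc Fl.
have ab : a <= b by exact: le_trans t0b.
have /choice[Phi PhiP] : forall x : R -> X, exists y : R -> X, cont_on a b x ->
    right_primitive a b y (fun t => F t (x t)) /\ y t0 = xi.
  move=> x; have [xc|] := pselect (cont_on a b x); last by exists x.
  have [y yP] := exists_right_primitive cX ab (Fc x xc).
  exists (fun t => y t + (xi - y t0)) => _; split; last by rewrite addrC subrK.
  have := right_primitiveD yP (right_primitive_cst a b (xi - y t0)).
  by apply: right_primitive_eq => t _; rewrite addr0.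
pose x n := iter n Phi (fun=> xi).
have xc n : cont_on a b (x n).
  elim: n => [|n ih] /=; first by split=> t _; exact: cvg_cst.
  exact: right_primitive_cont (PhiP _ ih).1.
have xP n : right_primitive a b (x n.+1) (fun t => F t (x n t)) by exact: (PhiP _ (xc n)).1.
have xt0 n : x n t0 = xi by case: n => // n; exact: (PhiP _ (xc n)).2.
have [M M0 MP] := cadlag_bounded ab (Fc _ (xc 0%N)).
pose C := 2 * M / K.
have C0 : 0 <= C by rewrite !mulr_ge0 ?invr_ge0// ltW.
have E1 (t : R) : 1 <= expR (2 * K * `|t - t0|).
  by rewrite -expR0 ler_expR !mulr_ge0// ltW.
have step n t : a <= t <= b ->
    `|x n.+1 t - x n t| <= C * 2^-1 ^+ n * expR (2 * K * `|t - t0|).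
  elim: n t => [|n ih] t ti.
    have := @right_primitive_weighted _ _ _ _ _ (2 * C) _ _ t0ab K0 _
      (right_primitiveB (xP 0%N) (right_primitive_cst a b xi)).
    rewrite expr0 mulr1 (mulrC 2) mulfK//; apply=> //.
    - by rewrite mulr_ge0.
    - by rewrite xt0 subrr.
    - move=> s si; rewrite subr0 (le_trans (MP s si))//.
      rewrite mulrA (_ : K * (C * 2) = 4 * M); last by rewrite /C; field; rewrite gt_eqF.
      have := E1 s; have : M * 1 <= M * expR (2 * K * `|s - t0|) by rewrite ler_wpM2l// ltW.
      by nra.
  have := @right_primitive_weighted _ _ _ _ _ (C * 2^-1 ^+ n) _ _ t0ab K0 _
      (right_primitiveB (xP n.+1) (xP n)).
  rewrite exprSr mulrA; apply=> //.
  - by rewrite mulr_ge0// exprn_ge0// invr_ge0.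
  - by rewrite !xt0 subrr.
  - move=> s /[dup] si /andP[as_ sb]; rewrite (le_trans (Fl s si _ _))//.
    by rewrite ler_wpM2l ?(ltW K0)// ih// as_ ltW.
pose B := C * expR (2 * K * (b - a)).
have B0 : 0 <= B by rewrite mulr_ge0// expR_ge0.
have stepB n t : a <= t <= b -> `|x n.+1 t - x n t| <= B * 2^-1 ^+ n.
  move=> /[dup] ti /andP[at_ tb]; rewrite (le_trans (step n t ti))//.
  rewrite /B mulrAC ler_wpM2r ?exprn_ge0 ?invr_ge0// ler_wpM2l//.
  by rewrite ler_expR ler_wpM2l ?mulr_ge0 ?(ltW K0)// ler_norml; apply/andP; split; lra.
have /choice[y yP] : forall t : R, exists v : X, a <= t <= b ->
    forall n, `|x n t - v| <= 2 * B * 2^-1 ^+ n.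
  move=> t; have [ti|nti] := boolP (a <= t <= b); last by exists 0.
  have [v vP] := geometric_cvg cX B0 (fun n => stepB n t ti).
  by exists v.
exists y; last first.
  apply/eqP; rewrite -subr_eq0 -normr_le0; apply/ler_addgt0Pr => e e0.
  have h1 : `|2^-1| < 1 :> R by rewrite ger0_norm ?invr_ge0// invf_lt1 ?ltr1n.
  have /cvgrPdist_le/(_ _ e0)[N _ NP] := @cvg_geometric _ (2 * B) _ h1.
  have := yP t0 t0ab N; rewrite xt0 distrC => /le_trans; apply.
  have := NP N (leqnn N); rewrite /= sub0r normrN add0r.
  exact: le_trans (ler_norm _).
apply: right_primitive_closed => e e0.
have h1 : `|2^-1| < 1 :> R by rewrite ger0_norm ?invr_ge0// invf_lt1 ?ltr1n.
pose d := e / (K + 1).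
have d0 : 0 < d by rewrite divr_gt0// ltr_wpDl// ltW.
have dK : d * (K + 1) = e by rewrite divfK// gt_eqF// ltr_wpDl// ltW.
have /cvgrPdist_le/(_ _ d0)[N _ NP] := @cvg_geometric _ (2 * B) _ h1.
have Nd n : (N <= n)%N -> 2 * B * 2^-1 ^+ n <= d.
  by move=> /NP; rewrite /= sub0r normrN; apply: le_trans (ler_norm _).
exists (x N.+1), (fun t => F t (x N t)); split=> // t ti.
  have := yP t ti N.+1; have := Nd N.+1 (leqnSn N); have : 0 <= d * K by rewrite mulr_ge0 ?(ltW d0) ?(ltW K0).
  lra.
have ti' : a <= t <= b by case/andP: ti => -> /ltW ->.
rewrite (le_trans (Fl t ti _ _))//.
have : K * `|x N t - y t| <= K * d.
  by rewrite ler_wpM2l ?(ltW K0)// (le_trans (yP t ti' N))// Nd.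
lra.
Qed.

End Picard.

(** * Integrals of càdlàg functions *)

Section LebesguePrimitive.
Context {R : realType}.
Implicit Types (a b t s : R) (g G : R -> R).
Local Notation mu := (@lebesgue_measure R).

Let mu_co a b : (mu `[a, b[ < +oo)%E.
Proof. by rewrite lebesgue_measure_itv/=; case: ifP => _; rewrite ltry. Qed.

Let fine_mu_co a b : fine (mu `[a, b[) = Num.max (b - a) 0.
Proof.
transitivity (fine (if (a%:E < b%:E)%E then (b%:E - a%:E)%E else 0%E)).
  by congr fine; exact: lebesgue_measure_itv.
rewrite lte_fin; case: ltP => ab; rewrite /=.
  by rewrite max_l// subr_ge0 ltW.
by rewrite max_r// subr_le0.
Qed.

Lemma heaviside_integral a b c (v : R) : a <= b ->
  mu.-integrable `[a, b[ (EFin \o (fun t => if c <= t then v else 0)) /\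
  \int[mu]_(t in `[a, b[) (if c <= t then v else 0) =
    (Num.max (b - c) 0 - Num.max (a - c) 0) * v.
Proof.
move=> ab; have E : (fun t => if c <= t then v else 0) = cst v \_ `[c, +oo[.
  by apply/funext => t; rewrite patchE mem_setE in_itv/= andbT.
split.
  apply: (measurable_bounded_integrable _ (mu_co a b)) => //.
  - have : measurable_fun `[a, b[ (cst v \_ `[c, +oo[).
      by apply/measurable_restrict => //; exact: measurable_cst.
    by rewrite -E.
  - exists `|v|; split; first exact: num_real.
    by move=> x vx t _ /=; case: ifP => _; rewrite ?normr0; rewrite (le_trans _ (ltW vx)).
have -> : \int[mu]_(t in `[a, b[) (if c <= t then v else 0) =
    \int[mu]_(t in `[a, b[) (cst v \_ `[c, +oo[) t by rewrite -E.
rewrite -Rintegral_mkcondr.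
have -> : `[a, b[ `&` `[c, +oo[ = `[Num.max a c, b[%classic.
  apply/seteqP; split=> t /=; rewrite !in_itv/= ge_max ?andbT.
    by move=> [/andP[-> ->] ->].
  by move=> /andP[/andP[-> ->] ->].
rewrite Rintegral_cst// mulrC; congr (_ * _).
rewrite [LHS]fine_mu_co.
case: (leP a c) => ac; [rewrite (@max_r _ _ (a - c)) ?subr_le0 ?subr0//|].
rewrite (@max_l _ _ (a - c)) ?subr_ge0 ?(ltW ac)//.
rewrite !max_l ?subr_ge0 ?(le_trans (ltW ac))//; lra.
Qed.

Lemma stepfun_integral a b (p : seq (R * R^o)) : a <= b ->
  mu.-integrable `[a, b[ (EFin \o (stepfun p : R -> R)) /\
  \int[mu]_(t in `[a, b[) (stepfun p t : R) =
   \sum_(c <- p) (Num.max (b - c.1) 0 - Num.max (a - c.1) 0) * (c.2 : R).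
Proof.
move=> ab; elim: p => [|[c v] p [ip Ip]].
  have E : stepfun [::] = (fun=> 0) :> (R -> R^o).
    by apply/funext => t; rewrite /stepfun big_nil.
  rewrite E big_nil Rintegral_cst// mul0r; split=> //.
  exact: integrable0.
have E : stepfun ((c, v) :: p) = (fun t => (if c <= t then v else 0) + stepfun p t) :> (R -> R^o).
  by apply/funext => t; rewrite /stepfun big_cons/=; case: ifP => // _; rewrite add0r.
have [ic Ic] := heaviside_integral c v ab.
rewrite E big_cons/= RintegralD// Ic Ip; split=> //.
have -> : (EFin \o (fun t => (if c <= t then v else 0) + stepfun p t)) =
  (EFin \o (fun t => if c <= t then v else 0)) \+ (EFin \o (stepfun p)) by [].
exact: integrableD.
Qed.

Lemma cadlag_integrable a b (g : R -> R) : a <= b -> cadlag a b (g : R -> R^o) ->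
  mu.-integrable `[a, b[ (EFin \o g).
Proof.
move=> ab cg; apply: (measurable_bounded_integrable _ (mu_co a b)) => //.
- have /choice[p pP] : forall n : nat, exists p : seq (R * R^o), forall t, a <= t < b -> `|g t - stepfun p t| <= n.+1%:R^-1.
    by move=> n; apply: (step_approx ab cg); rewrite invr_gt0 ltr0n.
  apply: (@measurable_realfun.measurable_fun_cvg _ _ _ _ (fun n => stepfun (p n) : R -> R)).
    move=> n; have [ip _] := stepfun_integral (p n) ab.
    by have /measurable_realfun.measurable_EFinP := measurable_int mu ip.
  move=> t /=; rewrite in_itv/= => ti; apply/cvgrPdist_le => e e0.
  have [N NP] := exists_nat_inv_le e0.
  by exists N => // n /= Nn; rewrite (le_trans (pP n t ti))// NP.
- have [M M0 MP] := cadlag_bounded ab cg.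
  exists M; split; first exact: num_real.
  by move=> x Mx t /=; rewrite in_itv/= => ti; rewrite (le_trans (MP t ti))// ltW.
Qed.

(** Both sides can be computed explicitly for a step function; replacing [g] by one within [d]
    changes each side by at most [d * (b - a)]. *)
Lemma cadlag_integral a b (g G : R -> R) : a <= b -> cadlag a b (g : R -> R^o) ->
  right_primitive a b (G : R -> R^o) g ->
  \int[mu]_(t in `[a, b[) g t = G b - G a.
Proof.
move=> ab cg gG; apply/eqP; rewrite -subr_eq0 -normr_le0; apply/ler_addgt0Pr => e e0.
rewrite add0r; pose d := e / 2 / (b - a + 1).
have ba : 0 < b - a + 1 by rewrite ltr_wpDl// subr_ge0.
have d0 : 0 < d by rewrite !divr_gt0.
have [p pP] := step_approx ab cg d0.
have [ip Ip] := stepfun_integral p ab.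
have ig := cadlag_integrable ab cg.
have pr : right_primitive a b (fun t => \sum_(c <- p) Num.max (t - c.1) 0 *: c.2 : R^o) (stepfun p).
  have -> : stepfun p = fun t => \sum_(c <- p) if c.1 <= t then c.2 else 0.
    by apply/funext => t; rewrite /stepfun big_mkcond.
  by apply: right_primitive_sum => c; exact: right_primitive_ramp.
have I1 := right_primitive_increment_cst ab (right_primitiveB gG pr) pP.
have I2 : `|\int[mu]_(t in `[a, b[) g t - \int[mu]_(t in `[a, b[) (stepfun p t : R)| <= d * (b - a).
  have ii : mu.-integrable `[a, b[ (EFin \o (fun t => g t - (stepfun p t : R))).
    have -> : EFin \o (fun t => g t - (stepfun p t : R)) = ((EFin \o g) \- (EFin \o (stepfun p : R -> R)))%E by [].
    exact: integrableB.
  rewrite -RintegralB//; apply: le_trans (le_normr_Rintegral _ ii) _ => //.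
  apply: (@le_trans _ _ (\int[mu]_(t in `[a, b[) d)).
    apply: le_Rintegral => //.
    - exact: integrable_norm ii.
    - apply: (measurable_bounded_integrable (f := cst d) _ (mu_co a b)) => //.
      exists `|d|; split; first exact: num_real.
      by move=> x dx t _ /=; rewrite ltW.
  rewrite Rintegral_cst// ler_wpM2l ?(ltW d0)//.
  by rewrite [X in X <= _]fine_mu_co max_l// subr_ge0.
have E : \int[mu]_(t in `[a, b[) (stepfun p t : R) = \sum_(c <- p) Num.max (b - c.1) 0 *: c.2 - \sum_(c <- p) Num.max (a - c.1) 0 *: c.2.
  by rewrite Ip -sumrB; apply: eq_bigr => c _; rewrite mulrBl.
have dE : d * (b - a) <= e / 2.
  by rewrite /d mulrAC ler_pdivrMr// ler_wpM2l ?divr_ge0 ?(ltW e0)// lerDl.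
move: I1 I2; rewrite E.
by rewrite !ler_norml => /andP[? ?] /andP[? ?]; apply/andP; split; lra.
Qed.

(** Lebesgue's theorem restated for increments of primitives, the form in which remainders enter
    Gronwall's inequality. *)
Lemma cadlag_dominated_cvg a b M (g G : nat -> R -> R) : a <= b ->
  (forall n, cadlag a b (g n : R -> R^o)) ->
  (forall n, right_primitive a b (G n : R -> R^o) (g n)) ->
  (forall n t, a <= t < b -> `|g n t| <= M) ->
  (forall t, a <= t < b -> g n t @[n --> \oo] --> 0) ->
  G n b - G n a @[n --> \oo] --> 0.
Proof.
move=> ab cg gG gM g0.
have ig n := cadlag_integrable ab (cg n).
have mD : measurable (`[a, b[%classic : set R) by [].
have H : (\int[mu]_(t in `[a, b[) (g n t)%:E)%E @[n --> \oo] --> (0 : R)%:E.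
  have -> : (0 : R)%:E = (\int[mu]_(t in `[a, b[) (cst 0%E t))%E by rewrite integral0.
  apply: (@dominated_cvg _ _ _ mu _ mD (fun n => EFin \o g n) (cst 0%E) (cst M%:E)) => //.
  - by move=> n; have := measurable_int mu (ig n).
  - move=> t /=; rewrite in_itv/= => ti; apply: cvg_EFin; last exact: g0.
    by near=> n.
  - apply: (measurable_bounded_integrable (f := cst M) _ (mu_co a b)) => //.
    exists `|M|; split; first exact: num_real.
    by move=> x dx t _ /=; rewrite ltW.
have : fine (\int[mu]_(t in `[a, b[) (g n t)%:E)%E @[n --> \oo] --> (0 : R).
  exact: (fine_cvg H).
by under eq_fun do rewrite [fine _](cadlag_integral ab (cg _) (gG _)).
Unshelve. all: by end_near. Qed.

Lemma cadlag_integral_cc a b (g G : R -> R) : a <= b -> cadlag a b (g : R -> R^o) ->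
  right_primitive a b (G : R -> R^o) g ->
  \int[mu]_(t in `[a, b]) g t = G b - G a.
Proof.
move=> ab cg gG; rewrite -Rintegral_itv_bndo_bndc; first exact: cadlag_integral.
exact: cadlag_integrable.
Qed.

End LebesguePrimitive.

(** * Needle perturbations of a differential equation *)

Section CadlagClosure.
Context {R : realType}.
Implicit Types (a b t s : R) (Y Z W : topologicalType) (X : normedModType R).

Lemma cadlag_comp Y Z a b (u : R -> Y) (phi : Y -> Z) :
  continuous phi -> cadlag a b u -> cadlag a b (phi \o u).
Proof.
move=> cphi [ur ul]; split=> t ti; first exact: (cvg_comp _ _ (ur t ti) (cphi _)).
by have [y uy] := ul t ti; exists (phi y); exact: (cvg_comp _ _ uy (cphi _)).
Qed.

Lemma cadlag_pair Y Z a b (u : R -> Y) (v : R -> Z) :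
  cadlag a b u -> cadlag a b v -> cadlag a b (fun t => (u t, v t)).
Proof.
move=> [ur ul] [vr vl]; split=> t ti.
  by apply: cvg_pair; [exact: ur|exact: vr].
have [y uy] := ul t ti; have [z vz] := vl t ti.
by exists (y, z); apply: cvg_pair.
Qed.

Lemma cadlag_cst Y a b (c : Y) : cadlag a b (fun=> c).
Proof. by split=> t _; [|exists c]; exact: cvg_cst. Qed.

Lemma cadlagD X a b (u v : R -> X) :
  cadlag a b u -> cadlag a b v -> cadlag a b (fun t => u t + v t).
Proof.
move=> cu cv; apply: (cadlag_comp (phi := fun z : X * X => z.1 + z.2)) (cadlag_pair cu cv).
move=> z; exact: add_continuous.
Qed.

Lemma cadlagN X a b (u : R -> X) : cadlag a b u -> cadlag a b (fun t => - u t).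
Proof. by apply: (cadlag_comp (phi := fun z : X => - z)); exact: opp_continuous. Qed.

Lemma cadlagB X a b (u v : R -> X) :
  cadlag a b u -> cadlag a b v -> cadlag a b (fun t => u t - v t).
Proof. by move=> cu cv; apply: cadlagD => //; exact: cadlagN. Qed.

Lemma cadlagZ X a b (k : R -> R^o) (u : R -> X) :
  cadlag a b k -> cadlag a b u -> cadlag a b (fun t => (k t : R) *: u t).
Proof.
move=> ck cu; apply: (cadlag_comp (phi := fun z : R^o * X => (z.1 : R) *: z.2)) (cadlag_pair ck cu).
move=> z; exact: scale_continuous.
Qed.

Lemma cadlag_norm X a b (u : R -> X) : cadlag a b u -> cadlag a b (fun t => `|u t| : R^o).
Proof. by apply: (cadlag_comp (phi := fun z : X => `|z| : R^o)); exact: norm_continuous. Qed.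

Lemma cadlag_sum X a b (I : Type) (r : seq I) (u : I -> R -> X) :
  (forall i, cadlag a b (u i)) -> cadlag a b (fun t => \sum_(i <- r) u i t).
Proof.
move=> cu; elim: r => [|i r ih].
  by under eq_fun do rewrite big_nil; exact: cadlag_cst.
by under eq_fun do rewrite big_cons; exact: cadlagD.
Qed.

Lemma cadlag_heaviside X a b c (v : X) : cadlag a b (fun t => if c <= t then v else 0).
Proof.
split=> t _.
  case: ifPn => ct; apply: cvg_near_cst; near=> s.
    by rewrite (le_trans ct)//; near: s; exact: nbhs_right_ge.
  by rewrite leNgt; suff -> : s < c by []; near: s; apply: nbhs_right_lt; rewrite ltNge.
have [ct|tc] := ltP c t.
  exists v; apply: cvg_near_cst; near=> s.
  by suff -> : c <= s by []; near: s; exact: nbhs_left_ge.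
exists 0; apply: cvg_near_cst; near=> s.
by rewrite leNgt; suff -> : s < c by []; rewrite (lt_le_trans _ tc)//; near: s; exact: nbhs_left_lt.
Unshelve. all: by end_near. Qed.

End CadlagClosure.

Section Needles.
Context {R : realType}.
Implicit Types (s t d : R).

Definition heaviside s t : R := if s <= t then 1 else 0.
Definition ramp s t : R := Num.max (t - s) 0.

(** For [d >= 0] the indicator of [[s, s + d)]. As a difference of two Heaviside functions it
    depends separately on its two ends, which is how two needles of different lengths are
    compared. *)
Definition pulse s d t : R := heaviside s t - heaviside (s + d) t.
Definition pulse_primitive s d t : R := ramp s t - ramp (s + d) t.

Lemma pulseE s d t : 0 <= d -> pulse s d t = if s <= t < s + d then 1 else 0.
Proof.
move=> d0; rewrite /pulse /heaviside ltNge.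
have [st|ts] := leP s t; case: leP => //= sdt; rewrite ?subrr ?subr0//.
by have := lt_le_trans ts (le_trans _ sdt); rewrite lerDl d0 ltxx => /(_ isT).
Qed.

Lemma pulse_primitive_ge0 s d t : 0 <= d -> 0 <= pulse_primitive s d t.
Proof.
move=> d0; rewrite subr_ge0 /ramp ge_max !le_max lexx orbT andbT.
by rewrite lerD2l lerN2 lerDl d0.
Qed.

Lemma pulse_primitive_le s d t : 0 <= d -> pulse_primitive s d t <= d.
Proof.
move=> d0; rewrite lerBlDr /ramp ge_max; apply/andP; split.
  by rewrite -lerBlDl le_max; apply/orP; left; lra.
by rewrite addr_ge0// le_max lexx orbT.
Qed.

Lemma pulse_primitive0 s d t : 0 <= d -> t <= s -> pulse_primitive s d t = 0.
Proof.
move=> d0 ts; rewrite /pulse_primitive /ramp !max_r ?subrr// subr_le0//.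
by rewrite (le_trans ts)// lerDl.
Qed.

Lemma right_primitive_pulse a b s d :
  right_primitive a b (pulse_primitive s d : R -> R^o) (pulse s d : R -> R^o).
Proof.
have E c : right_primitive a b (ramp c : R -> R^o) (heaviside c : R -> R^o).
  have := @right_primitive_ramp _ R^o a b c (1 : R^o).
  have -> : (fun r => Num.max (r - c) 0 *: (1 : R^o)) = ramp c.
    by apply/funext => r; rewrite /GRing.scale/= mulr1.
  by [].
exact: right_primitiveB.
Qed.

Lemma cadlag_pulse a b s d : cadlag a b (pulse s d : R -> R^o).
Proof. by apply: cadlagB; exact: (@cadlag_heaviside _ R^o). Qed.

(* The two pulses differ between their left ends and between their right ends. *)
Lemma pulse_dist a b s d s' d' : a <= b ->
  exists phi psi : R -> R^o, [/\ right_primitive a b phi psi,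
    forall t, `|pulse s d t - pulse s' d' t| <= psi t
  & phi b - phi a <= `|s - s'| + `|s + d - (s' + d')|].
Proof.
have H c c' : a <= b -> exists phi psi : R -> R^o, [/\ right_primitive a b phi psi,
    forall t, `|heaviside c t - heaviside c' t| <= psi t & phi b - phi a <= `|c - c'|].
  wlog cc' : c c' / c <= c' => [hw ab|ab].
    have [|c'c] := leP c c'; first by move/hw => /(_ ab).
    have [phi [psi [pp P1 P2]]] := hw c' c (ltW c'c) ab; exists phi, psi; split => //.
      by move=> t; rewrite distrC.
    by rewrite distrC.
  exists (pulse_primitive c (c' - c)), (pulse c (c' - c)).
  have d0 : 0 <= c' - c by rewrite subr_ge0.
  split; first exact: right_primitive_pulse.
    move=> t; rewrite pulseE// (addrC c) subrK /heaviside.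
    rewrite (leNgt c' t); case: (leP c t) => tc; case: (ltP t c') => c't /=;
      rewrite ?subrr ?normr0 ?subr0 ?normr1//.
    by have := lt_le_trans tc (le_trans cc' c't); rewrite ltxx.
  have := pulse_primitive_ge0 c a d0; have := pulse_primitive_le c b d0.
  by rewrite distrC ger0_norm//; lra.
move=> ab; have [f [g [fg P1 P2]]] := H s s' ab.
have [f' [g' [fg' P1' P2']]] := H (s + d) (s' + d') ab.
exists (fun t => f t + f' t), (fun t => g t + g' t); split.
- exact: right_primitiveD.
- move=> t; have -> : pulse s d t - pulse s' d' t =
    (heaviside s t - heaviside s' t) - (heaviside (s + d) t - heaviside (s' + d') t).
    by rewrite /pulse; ring.
  by rewrite (le_trans (ler_normB _ _))// lerD.
- by move: P2 P2'; lra.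
Qed.

End Needles.

(** * Bounded bilinear maps: limits and the product rule *)

Section BilinearCalculus.
Context {R : realType} {X Y Z : normedModType R}.
Variables (B : X -> Y -> Z) (M : R).
Hypothesis B_additivel : forall y, {morph B^~ y : x x' / x - x'}.
Hypothesis B_additiver : forall x, {morph B x : y y' / y - y'}.
Hypothesis B_scalel : forall k x y, B (k *: x) y = k *: B x y.
Hypothesis B_scaler : forall k x y, B x (k *: y) = k *: B x y.
Hypothesis M_gt0 : 0 < M.
Hypothesis B_bounded : forall x y, `|B x y| <= M * (`|x| * `|y|).
Implicit Types (a b s t : R).

Lemma cvg_bilinear (I : Type) (G : set_system I) {FG : Filter G}
    (u : I -> X) (v : I -> Y) (x : X) (y : Y) :
  u i @[i --> G] --> x -> v i @[i --> G] --> y -> B (u i) (v i) @[i --> G] --> B x y.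
Proof.
move=> ux vy; apply/cvgrPdistC_le => e e0.
have c0 : 0 < M * (`|x| + `|y| + 1) by rewrite mulr_gt0// ltr_wpDl// addr_ge0.
pose d := Num.min 1 (e / (M * (`|x| + `|y| + 1))).
have d0 : 0 < d by rewrite lt_min ltr01 divr_gt0.
have d1 : d <= 1 by rewrite ge_min lexx.
have de : d * (M * (`|x| + `|y| + 1)) <= e.
  by rewrite -ler_pdivlMr// ge_min lexx orbT.
near=> i.
have ui : `|u i - x| <= d by near: i; move/cvgrPdistC_le : ux; exact.
have vi : `|v i - y| <= d by near: i; move/cvgrPdistC_le : vy; exact.
have -> : B (u i) (v i) - B x y = B (u i - x) (v i) + B x (v i - y).
  by rewrite B_additivel B_additiver subrKA.
rewrite (le_trans (ler_normD _ _))// (le_trans (lerD (B_bounded _ _) (B_bounded _ _)))//.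
have v1 : `|v i| <= `|y| + 1.
  have := ler_normD (v i - y) y; rewrite subrK; lra.
apply: le_trans de; rewrite -mulrDr mulrCA ler_wpM2l ?(ltW M_gt0)//.
have H1 : `|u i - x| * `|v i| <= d * (`|y| + 1) by rewrite ler_pM.
have H2 : `|x| * `|v i - y| <= `|x| * d by rewrite ler_wpM2l.
lra.
Unshelve. all: by end_near. Qed.

Lemma rderiv_bilinear (u : R -> X) (v : R -> Y) t x y :
  rderiv u t x -> rderiv v t y ->
  rderiv (fun s => B (u s) (v s)) t (B x (v t) + B (u t) y).
Proof.
move=> ux vy e e0.
pose c := `|v t| + 1 + `|x| + `|u t|.
have c0 : 0 < c.
  by have := normr_ge0 (v t); have := normr_ge0 x; have := normr_ge0 (u t); rewrite /c; lra.
pose d := Num.min 1 (e / (M * c)).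
have d0 : 0 < d by rewrite lt_min ltr01 divr_gt0// mulr_gt0.
have d1 : d <= 1 by rewrite ge_min lexx.
have de : M * (d * c) <= e.
  by rewrite mulrCA -ler_pdivlMr ?mulr_gt0// ge_min lexx orbT.
near=> s.
have us : `|u s - u t - (s - t) *: x| <= d * (s - t) by near: s; exact: ux.
have vs : `|v s - v t - (s - t) *: y| <= d * (s - t) by near: s; exact: vy.
have vd : `|v s - v t| <= d.
  by near: s; have /cvgrPdistC_le := rderiv_cvg vy; exact.
have st0 : 0 < s - t by rewrite subr_gt0.
(* Three errors: the remainder of [u] against [v s], the linear part of [u] against the increment of
   [v], and the remainder of [v] against [u t]. The constant [c] adds up their cofactors. *)
have -> : B (u s) (v s) - B (u t) (v t) - (s - t) *: (B x (v t) + B (u t) y) =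
    B (u s - u t - (s - t) *: x) (v s) + B ((s - t) *: x) (v s - v t)
     + B (u t) (v s - v t - (s - t) *: y).
  rewrite !B_additivel !B_additiver !B_scalel !B_scaler scalerDr.
  set b1 := B (u s) (v s); set b2 := B (u t) (v s); set b3 := B (u t) (v t).
  set b4 := _ *: B x (v s); set b5 := _ *: B x (v t); set b6 := _ *: B (u t) y.
  rewrite subrKA [b1 - b2 - b5]addrAC [RHS]addrA subrKA.
  by rewrite opprD addrA [b1 - b3 - b5]addrAC.
have v1 : `|v s| <= `|v t| + 1.
  have := ler_normD (v s - v t) (v t); rewrite subrK; lra.
rewrite (le_trans (ler_normD _ _))// (le_trans (lerD (ler_normD _ _) (lexx _)))//.
rewrite (le_trans (lerD (lerD (B_bounded _ _) (B_bounded _ _)) (B_bounded _ _)))//.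
rewrite -!mulrDr; apply: (@le_trans _ _ (M * (d * c * (s - t)))); last first.
  by rewrite mulrA ler_wpM2r ?(ltW st0).
rewrite ler_wpM2l ?(ltW M_gt0)// normrZ gtr0_norm//.
have H1 : `|u s - u t - (s - t) *: x| * `|v s| <= d * (s - t) * (`|v t| + 1) by rewrite ler_pM.
have H2 : (s - t) * `|x| * `|v s - v t| <= (s - t) * `|x| * d.
  by rewrite ler_wpM2l// mulr_ge0// ltW.
have H3 : `|u t| * `|v s - v t - (s - t) *: y| <= `|u t| * (d * (s - t)) by rewrite ler_wpM2l.
rewrite /c; lra.
Unshelve. all: by end_near. Qed.

Lemma right_primitive_bilinear a b (u f : R -> X) (v g : R -> Y) :
  right_primitive a b u f -> right_primitive a b v g ->
  right_primitive a b (fun t => B (u t) (v t)) (fun t => B (f t) (v t) + B (u t) (g t)).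
Proof.
move=> [ul ur] [vl vr]; split=> t ti; first by apply: cvg_bilinear; [exact: ul|exact: vl].
by apply: rderiv_bilinear; [exact: ur|exact: vr].
Qed.

End BilinearCalculus.

Lemma right_primitive_scale {R : realType} {X : normedModType R} (a b : R)
    (k f : R -> R^o) (v g : R -> X) :
  right_primitive a b k f -> right_primitive a b v g ->
  right_primitive a b (fun t => (k t : R) *: v t) (fun t => (f t : R) *: v t + (k t : R) *: g t).
Proof.
apply: (@right_primitive_bilinear R R^o X X (fun k v => (k : R) *: v) 1) => //.
- by move=> y x x' /=; rewrite scalerBl.
- by move=> x y y' /=; rewrite scalerBr.
- by move=> c x y /=; rewrite scalerA.
- by move=> c x y /=; rewrite !scalerA mulrC.
- by move=> x y; rewrite mul1r normrZ.
Qed.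

Section NeedlePerturbation.
Context {R : realType} {X : normedModType R} {N : nat}.
Variables (T K C : R) (x0 : R -> X) (F : R -> X -> X).
Variables (V : 'I_N -> R -> X -> X) (tt : 'I_N -> R).
Variables (A : R -> X -> X) (y : 'I_N -> R -> X).
Implicit Types (s t : R) (a b : 'I_N -> R).

(** The shift by the total length of the earlier needles keeps needles disjoint even when several
    share one time [tt i]; this relies on the times being sorted. *)
Definition needle_start a (i : 'I_N) : R := tt i + \sum_(j < N | (j < i)%N) a j.
Definition needle a i t : R := pulse (needle_start a i) (a i) t.
(** The additive form of a switched control: [V i] is the change of the right-hand side caused by
    the [i]-th control value. It separates the dependence on the lengths, carried by scalar pulses
    alone, from the dependence on the state. *)
Definition needle_rhs a t (x : X) : X := F t x + \sum_i needle a i t *: V i t x.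

Hypotheses (cX : seq_complete X) (T0 : 0 < T) (K0 : 0 < K) (C0 : 0 <= C).
Hypothesis tt_ge0 : forall i, 0 <= tt i.
Hypothesis F_cadlag : forall x, cont_on 0 T x -> cadlag 0 T (fun t => F t (x t)).
Hypothesis V_cadlag :
  forall i x, cont_on 0 T x -> cadlag 0 T (fun t => V i t (x t)).
Hypothesis F_lip :
  forall t, 0 <= t < T -> forall x z, `|F t x - F t z| <= K * `|x - z|.
Hypothesis V_lip :
  forall i t, 0 <= t < T -> forall x z, `|V i t x - V i t z| <= K * `|x - z|.
Hypothesis V_bounded : forall i t, 0 <= t < T -> forall x, `|V i t x| <= C.
Hypothesis x0P : right_primitive 0 T x0 (fun t => F t (x0 t)).

Let ab_ge0 a i (a0 : forall i, 0 <= a i) : 0 <= needle_start a i.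
Proof. by rewrite addr_ge0// sumr_ge0. Qed.

Let pulse01 (s d t : R) : 0 <= d -> 0 <= pulse s d t <= 1.
Proof. by move=> d0; rewrite pulseE//; case: ifP; rewrite ?lexx ler01. Qed.

Let K1 := K * (1 + N%:R).
Let K10 : 0 < K1. Proof. by rewrite mulr_gt0// ltr_wpDr. Qed.

Lemma needle_rhs_lip a t : (forall i, 0 <= a i) -> 0 <= t < T ->
  forall x z, `|needle_rhs a t x - needle_rhs a t z| <= K1 * `|x - z|.
Proof.
move=> a0 ti x z; rewrite /needle_rhs opprD addrACA -sumrB.
rewrite (le_trans (ler_normD _ _))// /K1 mulrDr mulr1 mulrDl lerD ?F_lip//.
rewrite (le_trans (ler_norm_sum _ _ _))//.
apply: (@le_trans _ _ (\sum_(i < N) K * `|x - z|)); last first.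
  by rewrite sumr_const card_ord -mulr_natr; lra.
apply: ler_sum => i _; rewrite -scalerBr normrZ.
have /andP[p0 p1] := pulse01 (needle_start a i) t (a0 i).
rewrite ger0_norm// (le_trans (ler_piMl _ p1))//; exact: V_lip.
Qed.

Lemma needle_rhs_cadlag a x : cont_on 0 T x ->
  cadlag 0 T (fun t => needle_rhs a t (x t)).
Proof.
move=> xc; apply: cadlagD; first exact: F_cadlag.
apply: cadlag_sum => i; apply: cadlagZ; first exact: cadlag_pulse.
exact: V_cadlag.
Qed.

Lemma needle_trajectory_exists a : (forall i, 0 <= a i) ->
  exists2 x, right_primitive 0 T x (fun t => needle_rhs a t (x t)) & x 0 = x0 0.
Proof.
move=> a0; apply: (initial_value_problem (K := K1)) => //.
- by rewrite lexx ltW.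
- by move=> x; exact: needle_rhs_cadlag.
- by move=> t ti; exact: needle_rhs_lip.
Qed.

(** The exponential is Gronwall's factor. The term [C] serves the distance to [x0]; [2 N C] serves
    the dependence on the lengths, since changing them from [a] to [b] moves each end of each of the
    [N] pulses by at most [\sum_i |a i - b i|]. *)
Definition needle_constant : R := expR (K1 * T) * (C * (1 + 2 * N%:R)).

Let expK t : 0 <= t <= T -> expR (K * t) <= expR (K1 * T).
Proof.
move=> /andP[t0 tT]; rewrite ler_expR ler_pM ?(ltW K0)// ler_peMr ?(ltW K0)//.
by rewrite lerDl.
Qed.

Lemma needle_trajectory_dist a x : (forall i, 0 <= a i) ->
  right_primitive 0 T x (fun t => needle_rhs a t (x t)) -> x 0 = x0 0 ->
  forall t, 0 <= t <= T -> `|x t - x0 t| <= needle_constant * \sum_i a i.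
Proof.
move=> a0 xP x00 t /[dup] ti /andP[t0 tT].
pose phi t : R^o := \sum_i C *: (pulse_primitive (needle_start a i) (a i) t : R^o).
pose psi t : R^o := \sum_i C *: (needle a i t : R^o).
have pp : right_primitive 0 t phi psi.
  by apply: right_primitive_sum => i; apply: right_primitiveZ; exact: right_primitive_pulse.
have wP := right_primitive_sub (lexx 0) tT (right_primitiveB xP x0P).
have n0 i s : 0 <= needle a i s by have /andP[] := pulse01 (needle_start a i) s (a0 i).
have := gronwall t0 (ltW K0) wP pp.
rewrite /= x00 subrr normr0 add0r => H; apply: le_trans (H _ _) _.
- by move=> s _; apply: sumr_ge0 => i _; rewrite /GRing.scale/= mulr_ge0.
- move=> s /andP[s0 st]; have si : 0 <= s < T by rewrite s0 (lt_le_trans st).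
  rewrite /needle_rhs addrAC (le_trans (ler_normD _ _))// lerD ?F_lip//.
  rewrite (le_trans (ler_norm_sum _ _ _))//; apply: ler_sum => i _.
  by rewrite normrZ ger0_norm// mulrC ler_wpM2r// V_bounded.
have phi0 : phi 0 = 0.
  rewrite /phi big1// => i _; rewrite pulse_primitive0 ?scaler0//.
  exact: ab_ge0.
have phit : phi t <= C * \sum_i a i.
  rewrite /phi mulr_sumr; apply: ler_sum => i _; rewrite ler_wpM2l//.
  exact: pulse_primitive_le.
rewrite phi0 !subr0 /needle_constant -mulrA ler_pM ?expR_ge0 ?expK//.
  by rewrite /phi; apply: sumr_ge0 => i _; rewrite mulr_ge0// pulse_primitive_ge0.
rewrite (le_trans phit)// ler_wpM2r ?sumr_ge0// ler_peMr// lerDl mulr_ge0//.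
Qed.

(** The two equations differ by the bounded [V i] times differences of pulses, and [pulse_dist]
    bounds a primitive of these by the displacement of their ends. The estimate holds up to the
    boundary of the orthant, where some lengths vanish. *)
Lemma needle_trajectory_lipschitz a b x z : (forall i, 0 <= a i) -> (forall i, 0 <= b i) ->
  right_primitive 0 T x (fun t => needle_rhs a t (x t)) -> x 0 = x0 0 ->
  right_primitive 0 T z (fun t => needle_rhs b t (z t)) -> z 0 = x0 0 ->
  `|x T - z T| <= needle_constant * \sum_i `|a i - b i|.
Proof.
move=> a0 b0 xP x00 zP z00.
have /choice[phi /choice[psi pp]] i := pulse_dist (needle_start a i) (a i) (needle_start b i) (b i) (ltW T0).
pose Phi t : R^o := \sum_i C *: phi i t.
pose Psi t : R^o := \sum_i C *: psi i t.
have PP : right_primitive 0 T Phi Psi.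
  by apply: right_primitive_sum => i; apply: right_primitiveZ; case: (pp i).
have psi0 i s : 0 <= psi i s by case: (pp i) => _ /(_ s) + _; exact: le_trans.
have := gronwall (ltW T0) (ltW K10) (right_primitiveB xP zP) PP.
rewrite /= x00 z00 subrr normr0 add0r => H; apply: le_trans (H _ _) _.
- by move=> s _; apply: sumr_ge0 => i _; rewrite /GRing.scale/= mulr_ge0.
- move=> s si.
  rewrite -(subrKA (needle_rhs a s (z s))) (le_trans (ler_normD _ _))// lerD ?needle_rhs_lip//.
  rewrite /needle_rhs opprD addrACA subrr add0r -sumrB.
  rewrite (le_trans (ler_norm_sum _ _ _))//; apply: ler_sum => i _.
  rewrite -scalerBl normrZ [leRHS]mulrC ler_pM ?V_bounded//.
  by case: (pp i) => _ /(_ s).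
rewrite subr0 /needle_constant -mulrA ler_wpM2l ?expR_ge0//.
have E i : phi i T - phi i 0 <= 2 * \sum_i `|a i - b i|.
  have S (P : pred 'I_N) : `|\sum_(j < N | P j) a j - \sum_(j < N | P j) b j| <= \sum_(j < N | P j) `|a j - b j|.
    by rewrite -sumrB ler_norm_sum.
  have [_ _ /le_trans] := pp i; apply.
  rewrite mulr2n mulrDl mul1r lerD//.
    rewrite /needle_start opprD addrACA subrr add0r (le_trans (S _))//.
    rewrite [leRHS](bigID (fun j : 'I_N => (j < i)%N))/= lerDl sumr_ge0//.
  have -> : needle_start a i + a i - (needle_start b i + b i) =
     (\sum_(j < N | (j < i)%N) a j - \sum_(j < N | (j < i)%N) b j) + (a i - b i).
    by rewrite /needle_start; ring.
  rewrite (le_trans (ler_normD _ _))// (le_trans (lerD (S _) (lexx _)))//.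
  rewrite [leRHS](bigID (fun j : 'I_N => (j < i)%N))/= lerD2l.
  by rewrite (bigD1 i) ?ltnn//= lerDl sumr_ge0.
rewrite /Phi -sumrB; apply: (@le_trans _ _ (\sum_(i < N) C * (2 * \sum_i `|a i - b i|))).
  by apply: ler_sum => i _; rewrite -scalerBr ler_wpM2l.
rewrite sumr_const card_ord -mulr_natr; set S := \sum_i _.
have : 0 <= C * S by rewrite mulr_ge0// sumr_ge0.
by lra.
Qed.

Hypothesis tt_ltT : forall i, tt i < T.
Hypothesis A_linear : forall t, linear (A t).
Hypothesis A_bounded : forall t, 0 <= t < T -> forall v, `|A t v| <= K * `|v|.
Hypothesis A_cadlag : forall x, cont_on 0 T x -> cadlag 0 T (fun t => A t (x t)).
Hypothesis F_frechet : forall t, 0 <= t < T -> forall e, 0 < e ->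
  exists2 d, 0 < d & forall v, `|v| <= d ->
    `|F t (x0 t + v) - F t (x0 t) - A t v| <= e * `|v|.
Hypothesis yP : forall i, right_primitive 0 T (y i) (fun t => A t (y i t)).
Hypothesis y_tt : forall i, y i (tt i) = V i (tt i) (x0 (tt i)).

Let AB t u v : A t (u - v) = A t u - A t v.
Proof. by rewrite addrC -[- v]scaleN1r A_linear scaleN1r addrC. Qed.

Let A0 t : A t 0 = 0.
Proof. by have := AB t 0 0; rewrite !subrr. Qed.

Let AZ t k u : A t (k *: u) = k *: A t u.
Proof. by rewrite -[k *: u]addr0 A_linear A0 addr0. Qed.

Let Asum t (c : 'I_N -> R) (u : 'I_N -> X) :
  A t (\sum_i c i *: u i) = \sum_i c i *: A t (u i).
Proof.
apply: (big_ind2 (fun u v => A t u = v)) => [|u1 v1 u2 v2 <- <-|i _].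
- exact: A0.
- by rewrite -[u1]scale1r A_linear !scale1r.
- exact: AZ.
Qed.

Let remainder x t : R := `|F t (x t) - F t (x0 t) - A t (x t - x0 t)|.

Let remainder_cadlag x : cont_on 0 T x -> cadlag 0 T (remainder x : R -> R^o).
Proof.
have x0c := right_primitive_cont x0P; move=> xc; apply: cadlag_norm.
apply: cadlagB; first by apply: cadlagB; exact: F_cadlag.
apply: A_cadlag; split=> t ti.
  by apply: cvgB; [exact: xc.1|exact: x0c.1].
by apply: cvgB; [exact: xc.2|exact: x0c.2].
Qed.

Let remainder_le x t : 0 <= t < T -> remainder x t <= 2 * K * `|x t - x0 t|.
Proof.
move=> ti; rewrite (le_trans (ler_normB _ _))//.
by have := F_lip ti (x t) (x0 t); have := A_bounded ti (x t - x0 t); lra.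
Qed.

(* Fréchet differentiability along [x0] is only pointwise in [t], so the
   smallness of the remainder comes from dominated convergence. *)
Lemma remainder_small e : 0 < e -> \forall d \near 0^'+,
  forall a x (G : R -> R^o), (forall i, 0 <= a i) -> \sum_i a i <= d ->
    right_primitive 0 T x (fun t => needle_rhs a t (x t)) -> x 0 = x0 0 ->
    right_primitive 0 T G (remainder x) -> G T - G 0 <= e * \sum_i a i.
Proof.
move=> e0; apply/near_rightP; apply: contrapT => H.
have {}H (n : nat) : exists aa xx (G : R -> R^o), [/\ (forall i, 0 <= aa i) /\ \sum_i aa i <= n.+1%:R^-1,
    right_primitive 0 T xx (fun t => needle_rhs aa t (xx t)), xx 0 = x0 0,
    right_primitive 0 T G (remainder xx) & e * \sum_i aa i < G T - G 0].
  apply: contrapT => nH; apply: H; exists n.+1%:R^-1; first by rewrite invr_gt0 ltr0n.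
  move=> d /andP[_ dn] aa xx G aa0 aad xxP xx0 GP.
  rewrite leNgt; apply/negP => lt; apply: nH; exists aa, xx, G; split=> //.
  by split=> //; rewrite (le_trans aad)// ltW// -[ltRHS]add0r.
have [aa /choice[xx /choice[G HP]]] := choice H.
pose S n := \sum_i aa n i.
have xxc n : cont_on 0 T (xx n) by case: (HP n) => _ /right_primitive_cont.
have c0 : 0 <= needle_constant by rewrite mulr_ge0 ?expR_ge0// mulr_ge0// addr_ge0// mulr_ge0.
have dist n t : 0 <= t < T -> `|xx n t - x0 t| <= needle_constant * S n.
  move=> /andP[t0 tT]; have [[aa0 _] xxP xx0 _ _] := HP n.
  by apply: needle_trajectory_dist => //; rewrite t0 ltW.
have S0 n : 0 <= S n by apply: sumr_ge0 => i _; case: (HP n) => -[].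
(* The lengths may all vanish; then [(S n)^-1] is 0 by convention and the bound is trivial. *)
have rS n t : 0 <= t < T -> (S n)^-1 * remainder (xx n) t <= 2 * K * needle_constant.
  move=> ti; have [->|Sn] := eqVneq (S n) 0.
    by rewrite invr0 mul0r !mulr_ge0// ltW.
  have Sn0 : 0 < S n by rewrite lt_neqAle eq_sym Sn S0.
  rewrite mulrC ler_pdivrMr// (le_trans (remainder_le _ ti))// -[leRHS]mulrA ler_wpM2l ?dist//.
  by rewrite mulr_ge0// ltW.
have r0 n t : 0 <= (S n)^-1 * remainder (xx n) t.
  by rewrite mulr_ge0 ?invr_ge0 ?S0// normr_ge0.
(* Divided by [S n], the remainders are dominated thanks to the Lipschitz bounds and tend to 0 at
   each [t] by Fréchet differentiability, whereas their integrals were assumed to exceed [e]. *)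
have := @cadlag_dominated_cvg R 0 T (2 * K * needle_constant)
   (fun n t => (S n)^-1 * remainder (xx n) t) (fun n t => (S n)^-1 * G n t) (ltW T0).
move=> /(_ _ _ _ _)/cvgrPdist_lt/(_ e e0) []; [| | | |].
- move=> n; have := cadlagZ (cadlag_cst 0 T ((S n)^-1 : R^o)) (remainder_cadlag (xxc n)).
  by [].
- by move=> n; have [_ _ _ GP _] := HP n; exact: (right_primitiveZ (S n)^-1 GP).
- by move=> n t ti; rewrite ger0_norm// rS.
- move=> t ti; apply/cvgrPdist_le => e' e'0.
  pose e1 := e' / (needle_constant + 1).
  have n1 : 0 < needle_constant + 1 by rewrite ltr_wpDl.
  have e10 : 0 < e1 by rewrite divr_gt0.
  have e1E : e1 * (needle_constant + 1) = e' by rewrite divfK// gt_eqF.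
  have [d d0 dP] := F_frechet ti e10.
  have [m mP] := exists_nat_inv_le (divr_gt0 d0 n1).
  exists m => // n /= mn; rewrite sub0r normrN ger0_norm//.
  have [-> |Sn] := eqVneq (S n) 0; first by rewrite invr0 mul0r ltW.
  have Sn0 : 0 < S n by rewrite lt_neqAle eq_sym Sn S0.
  have Sd : S n * (needle_constant + 1) <= d.
    by rewrite -ler_pdivlMr// (le_trans _ (mP n mn))//; case: (HP n) => -[].
  have := dP (xx n t - x0 t); rewrite (addrC (x0 t)) subrK => H1.
  rewrite mulrC ler_pdivrMr// -e1E; apply: le_trans (H1 _) _.
    by rewrite (le_trans (dist n t ti))//; lra.
  rewrite -[leRHS]mulrA ler_wpM2l ?(ltW e10)// (le_trans (dist n t ti))//; lra.
move=> n _ /(_ n (leqnn n)); have [[aa0 aan] xxP xx0 GP lt] := HP n.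
have Sn : S n != 0.
  apply/negP => /eqP Sn; move: lt; rewrite -/(S n) Sn mulr0.
  suff : G n T - G n 0 <= 0 by lra.
  have := right_primitive_increment_cst (M := 0) (ltW T0) GP.
  rewrite mul0r => H1; rewrite (le_trans (ler_norm _))// H1// => t ti.
  rewrite normr_id; apply: le_trans (remainder_le _ ti) _.
  by have := dist n t ti; rewrite Sn mulr0 normr_le0 => /eqP ->; rewrite normr0 mulr0.
have Sn0 : 0 < S n by rewrite lt_neqAle eq_sym Sn S0.
rewrite /= sub0r normrN -mulrBr => /(le_lt_trans (ler_norm _)).
by rewrite mulrC ltr_pdivrMr// => /(lt_trans lt); rewrite ltxx.
Qed.

(** The candidate [\sum_i c i t *: y i t], with [c i t] the length of needle [i] already spent at
    time [t], has the needles themselves in its derivative. Its difference [w] with [x - x0]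
    therefore solves the linearized equation up to small errors, and Gronwall applies. *)
Lemma needle_trajectory_differential e : 0 < e -> \forall d \near 0^'+,
  forall a x, (forall i, 0 <= a i) -> \sum_i a i <= d ->
    right_primitive 0 T x (fun t => needle_rhs a t (x t)) -> x 0 = x0 0 ->
    `|x T - x0 T - \sum_i a i *: y i T| <= e * \sum_i a i.
Proof.
move=> e0.
pose k := expR (K * T).
have k0 : 0 < k by exact: expR_gt0.
have c0 : 0 <= needle_constant by rewrite mulr_ge0 ?expR_ge0// mulr_ge0// addr_ge0// mulr_ge0.
(* Three errors of relative size [e1]: the Fréchet remainder, the change of [V i] between [x] and
   [x0], and the distance of [V i t (x0 t)] to [y i t] along a short needle. Gronwall multiplies
   their sum by [k]. *)
pose e1 := e / k / 3.
have e10 : 0 < e1 by rewrite !divr_gt0.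
have e1E : e = k * (3 * e1) by rewrite /e1; field; rewrite gt_eqF.
have x0c := right_primitive_cont x0P.
have Kc : 0 < K * needle_constant + 1 by rewrite ltr_wpDl// mulr_ge0// ltW.
near=> d => a x a0 ad xP x00.
pose S := \sum_i a i.
have d0 : 0 < d by near: d; exact: nbhs_right_gt.
(* Keeps every needle inside [[0, T]], so that it is fully spent at [T] and [c i T = a i]. *)
have dT i : tt i + d <= T.
  rewrite -lerBrDl; move: i; near: d; apply: filter_forall => i.
  by apply: nbhs_right_le; rewrite subr_gt0.
have dy i t : tt i <= t < tt i + d -> `|V i t (x0 t) - y i t| <= e1.
  move: i t; near: d; apply: filter_forall => i.
  have := (V_cadlag i x0c).1 (tt i); rewrite tt_ge0 tt_ltT => /(_ isT) Vc.
  have := (right_primitive_cont (yP i)).1 (tt i); rewrite tt_ge0 tt_ltT => /(_ isT) yc.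
  have : (fun t => V i t (x0 t) - y i t) t @[t --> (tt i)^'+] --> V i (tt i) (x0 (tt i)) - y i (tt i).
    exact: cvgB.
  rewrite y_tt subrr => /cvgrPdist_le/(_ e1 e10)/near_rightP[d' d'0 d'P].
  near=> d => t /andP[]; rewrite le_eqVlt => /predU1P[<- _|tt_ td].
    by rewrite y_tt subrr normr0 ltW.
  have := d'P t; rewrite sub0r normrN; apply; rewrite tt_ (lt_le_trans td)// lerD2l.
  by near: d; exact: nbhs_right_le.
have Kd : K * (needle_constant * d) <= e1.
  have : d <= e1 / (K * needle_constant + 1).
    by near: d; apply: nbhs_right_le; rewrite divr_gt0.
  by rewrite ler_pdivlMr//; move: d0; lra.
have RS : forall a x (G : R -> R^o), (forall i, 0 <= a i) -> \sum_i a i <= d ->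
    right_primitive 0 T x (fun t => needle_rhs a t (x t)) -> x 0 = x0 0 ->
    right_primitive 0 T G (remainder x) -> G T - G 0 <= e1 * \sum_i a i.
  by near: d; exact: remainder_small.
have dist := needle_trajectory_dist a0 xP x00.
have [G GP] := exists_right_primitive (@complete_seq_complete _ R^o) (ltW T0) (remainder_cadlag (right_primitive_cont xP)).
have GS := RS _ _ _ a0 ad xP x00 GP.
pose c i t : R^o := pulse_primitive (needle_start a i) (a i) t.
have cP i : right_primitive 0 T (c i) (needle a i : R -> R^o) by exact: right_primitive_pulse.
have YP := right_primitive_sum (index_enum 'I_N) (fun i => right_primitive_scale (cP i) (yP i)).
have wP := right_primitiveB (right_primitiveB xP x0P) YP.
have phiP := right_primitiveD GP (right_primitive_sum (index_enum 'I_N) (fun i => right_primitiveZ (2 * e1) (cP i))).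
have n0 i s : 0 <= needle a i s by have /andP[] := pulse01 (needle_start a i) s (a0 i).
have endS i : needle_start a i + a i <= tt i + S.
  rewrite -addrA lerD2l /S [leRHS](bigID (fun j : 'I_N => (j < i)%N))/= lerD2l.
  by rewrite (bigD1 i) ?ltnn//= lerDl sumr_ge0.
have c00 i : c i 0 = 0 by rewrite /c pulse_primitive0//; exact: ab_ge0.
have cT i : c i T = a i.
  rewrite /c /pulse_primitive /ramp.
  have aT : needle_start a i + a i <= T.
    by rewrite (le_trans (endS i))// (le_trans _ (dT i))// lerD2l.
  have sT : needle_start a i <= T by rewrite (le_trans _ aT)// lerDl.
  by rewrite !max_l ?subr_ge0//; ring.
have := gronwall (ltW T0) (ltW K0) wP phiP.
rewrite subr0 -/k x00 subrr sub0r.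
have -> : \sum_i (c i 0 : R) *: y i 0 = 0.
  by rewrite big1// => i _; rewrite c00 scale0r.
have -> : \sum_i (c i T : R) *: y i T = \sum_i a i *: y i T.
  by apply: eq_bigr => i _; rewrite cT.
rewrite oppr0 normr0 add0r => H; apply: le_trans (H _ _) _.
- move=> t _; rewrite addr_ge0 ?normr_ge0// sumr_ge0// => i _.
  by rewrite /GRing.scale/= mulr_ge0// mulr_ge0// ltW.
- move=> t ti; set w := x t - x0 t - _.
  have -> : needle_rhs a t (x t) - F t (x0 t) -
      \sum_i ((needle a i t : R) *: y i t + (c i t : R) *: A t (y i t)) =
      (F t (x t) - F t (x0 t) - A t (x t - x0 t)) + A t w
      + \sum_i needle a i t *: (V i t (x t) - y i t).
    rewrite /w (AB t _ (\sum_i _)) (Asum t (fun i => c i t) (fun i => y i t)) subrKA big_split /=.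
    under [X in _ = _ + X]eq_bigr do rewrite scalerBr.
    rewrite sumrB /needle_rhs addrACA -opprD [X in _ = _ - X]addrC.
    by congr (_ - _); rewrite addrAC.
  rewrite (le_trans (ler_normD _ _))// (le_trans (lerD (ler_normD _ _) (lexx _)))//.
  have Aw := A_bounded ti w.
  suff : `|\sum_i needle a i t *: (V i t (x t) - y i t)| <= \sum_i (2 * e1) *: (needle a i t : R^o).
    by rewrite /remainder; move: Aw; lra.
  rewrite (le_trans (ler_norm_sum _ _ _))//; apply: ler_sum => i _.
  rewrite normrZ ger0_norm//; have : needle a i t = if needle_start a i <= t < needle_start a i + a i then 1 else 0.
    exact: pulseE.
  case: ifPn => [/andP[st ta] ->|_ ->]; last by rewrite mul0r scaler0.
  rewrite mul1r [leRHS]mulr1 -(subrKA (V i t (x0 t))) (le_trans (ler_normD _ _))//.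
  rewrite mulr2n mulrDl mul1r lerD//.
    rewrite (le_trans (V_lip _ _ _ _))// (le_trans _ Kd)// ler_wpM2l ?(ltW K0)//.
    have /andP[t0 tT] := ti; rewrite (le_trans (dist t _)) ?t0 ?(ltW tT)//.
    by rewrite ler_wpM2l.
  apply: dy; rewrite (le_trans _ st) ?lerDl ?sumr_ge0//=.
  by rewrite (lt_le_trans ta)// (le_trans (endS i))// lerD2l.
rewrite e1E -mulrA ler_wpM2l ?(ltW k0)//.
have -> : \sum_i (2 * e1) *: c i 0 = 0.
  by rewrite big1// => i _; rewrite c00 scaler0.
have -> : \sum_i (2 * e1) *: c i T = 2 * e1 * S.
  by rewrite /S mulr_sumr; apply: eq_bigr => i _; rewrite cT.
move: GS; rewrite -/S; lra.
Unshelve. all: by end_near. Qed.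

End NeedlePerturbation.

(** * The Poincaré-Miranda theorem *)

Section CubicalParity.
Variables (n p : nat) (b : nat -> ('I_n -> nat) -> bool).
Local Open Scope nat_scope.
Hypothesis b0 : forall (c : 'I_n) x, x c = 0 -> b c x = false.
Hypothesis bp : forall (c : 'I_n) x, x c = p.+1 -> b c x = true.

Local Notation F2 := 'F_2.
Local Notation cell := ({ffun 'I_n -> 'I_p.+1} * 'S_n)%type.

Let beta k x : F2 := (b k x)%:R.

Let addxx (x : F2) : (x + x = 0)%R.
Proof. by case: x => [[|[|]]] // i; apply/val_inj. Qed.

(* The monotone edge path [v = y_0, ..., y_n = v + (1, ..., 1)] of a cell in
   which coordinate [c] jumps at step [tau c]. *)
Definition path_point (z : cell) s : 'I_n -> nat := fun c => z.1 c + (z.2 c < s).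
Local Notation y := path_point.

(** Over [F_2] this is the coboundary of label [k] on the [s]-th edge of the path of [z]. Cells with
    their paths are the simplices of the Kuhn triangulation of the grid cube, and [A 0] below
    evaluates the cup product of the [n] coboundaries on all of them: the parity of the number of
    paths on which label [k] changes along edge [k] for every [k]. Stokes' formula reduces it one
    face at a time. *)
Let step k z s : F2 := (beta k (y z s) + beta k (y z s.+1))%R.
(** Labels [j + 1, ..., n - 1] read along the edges [j, ..., n - 1] other than [r]. *)
Let skip j r z : F2 := (\prod_(j <= k < n.-1) step k.+1 z (bump r k))%R.

(* The coordinates below [j] sit on the far face and jump first, in order. *)
Let D j (z : cell) := [forall c : 'I_n, (c < j) ==> (z.1 c == ord_max) && (z.2 c == c)].
Let A j : F2 := (\sum_(z : cell | D j z) \prod_(j <= k < n) step k z k)%R.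

Let DP j z (c : 'I_n) : D j z -> c < j -> z.1 c = ord_max /\ z.2 c = c.
Proof. by move=> /forallP/(_ c) /implyP H /H /andP[/eqP ? /eqP ?]. Qed.

Let swap (r r1 : 'I_n) (z : cell) : cell := (z.1, (z.2 * tperm r r1)%g).

(** Modulo 2, the sum of the two products does not involve vertex [r + 1] of the path. Exchanging
    the jumps [r] and [r + 1] changes that vertex only, so terms cancel in pairs: an inner face
    belongs to two simplices. *)
Let sum_skipS j (r r1 : 'I_n) : j <= r -> r1 = r.+1 :> nat ->
  (\sum_(z | D j z) beta j (y z j) * skip j r z = \sum_(z | D j z) beta j (y z j) * skip j r1 z)%R.
Proof.
move=> jr r1E.
apply/eqP; rewrite -subr_eq0 -sumrB; apply/eqP.
have swapK : involutive (swap r r1).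
  by move=> [v t]; rewrite /swap/= -mulgA tperm2 mulg1.
have swapy z s : s != r1 :> nat -> y (swap r r1 z) s = y z s.
  move=> sr; apply/funext => c; rewrite /y /swap/= permM.
  congr (_ + nat_of_bool _); case: tpermP => // ->; rewrite r1E in sr *; lia.
have swapD z : D j (swap r r1 z) = D j z.
  apply: eq_forallb => c; rewrite /swap /= permM.
  case cj: (c < j) => //=; congr (_ && _).
  case: tpermP => [->|->|//].
    have -> : (r1 == c) = false by apply/eqP => E; move: cj; rewrite -E; lia.
    by apply/esym/eqP => E; move: cj; rewrite -E; lia.
  have -> : (r == c) = false by apply/eqP => E; move: cj; rewrite -E; lia.
  by apply/esym/eqP => E; move: cj; rewrite -E; lia.
(* Compares the coordinates that jump at steps [r] and [r1]; the swap exchanges them, so [Q] selects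
   exactly one cell of each pair. *)
pose Q (z : cell) := ((z.2^-1)%g r < (z.2^-1)%g r1).
have swapQ z : Q (swap r r1 z) = ~~ Q z.
  rewrite /Q /swap/= invMg tpermV !permM tpermL tpermR -leqNgt ltn_neqAle.
  suff -> : (nat_of_ord ((z.2)^-1%g r1) != (z.2)^-1%g r) by [].
  by apply/eqP => /val_inj/perm_inj E; move: r1E; rewrite E; lia.
pose G z : F2 := (beta j (y z j) * skip j r z - beta j (y z j) * skip j r1 z)%R.
have swapG z : G (swap r r1 z) = G z.
  rewrite /G -!mulrBr swapy; last by apply/eqP; lia.
  congr (_ * _)%R.
  have opp (x : F2) : (- x = x)%R by apply/eqP; rewrite -subr_eq0 -opprD addxx oppr0.
  rewrite !opp /skip.
  have [rn|] := ltnP r n.-1; last by have := ltn_ord r1; lia.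
  have E (w : cell) : (\prod_(j <= k < n.-1) step k.+1 w (bump r k) + \prod_(j <= k < n.-1) step k.+1 w (bump r1 k) =
      (\prod_(j <= k < r) step k.+1 w k * (beta r.+1 (y w r) + beta r.+1 (y w r.+2)) * \prod_(r.+1 <= k < n.-1) step k.+1 w k.+1))%R.
    rewrite !(@big_cat_nat _ _ _ r j n.-1)//= ?(ltnW rn)//.
    rewrite !(@big_ltn _ _ _ r n.-1)//=.
    have l1 q : r <= q -> (\prod_(j <= k < r) step k.+1 w (bump q k) = \prod_(j <= k < r) step k.+1 w k)%R.
      move=> rq; apply: eq_big_nat => k /andP[_ kr]; congr step.
      by rewrite /bump leqNgt (leq_trans kr rq).
    have l2 q : q <= r.+1 -> (\prod_(r.+1 <= k < n.-1) step k.+1 w (bump q k) = \prod_(r.+1 <= k < n.-1) step k.+1 w k.+1)%R.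
      by move=> qr; apply: eq_big_nat => k /andP[rk _]; congr step; rewrite /bump (leq_trans qr rk).
    rewrite !l1 ?r1E// !l2 ?r1E// -mulrDr -mulrDl mulrA; congr (_ * _ * _)%R.
    rewrite /bump leqnn ltnn add1n add0n /step.
    by rewrite [LHS]addrC -addrA [X in (_ + X)%R]addrA addxx add0r.
  rewrite !E; congr (_ * _ * _)%R.
  - by apply: eq_big_nat => k /andP[jk kr]; rewrite /step !swapy//; apply/eqP; lia.
  - by rewrite !swapy//; apply/eqP; lia.
  - by apply: eq_big_nat => k /andP[rk kn]; rewrite /step !swapy//; apply/eqP; lia.
rewrite -[LHS]/(\sum_(z | D j z) G z)%R (bigID Q)/=.
rewrite [X in (_ + X)%R](reindex_inj (inv_inj swapK))/=.
under [X in (_ + X)%R]eq_big => [z|z _] do [rewrite swapD swapQ negbK|rewrite swapG].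
exact: addxx.
Qed.

Let sum_skip j (r : 'I_n) : j <= r -> forall r1 : 'I_n, r <= r1 ->
  (\sum_(z | D j z) beta j (y z j) * skip j r z = \sum_(z | D j z) beta j (y z j) * skip j r1 z)%R.
Proof.
move=> jr [r1 r1n] /=; elim: r1 r1n => [|k ih] kn; rewrite /= leq_eqVlt => /orP[/eqP E|].
- by apply: eq_bigr => z _; rewrite /= E.
- by rewrite ltn0.
- by apply: eq_bigr => z _; rewrite /= E.
rewrite ltnS => rk; rewrite (ih (ltnW kn) rk).
by apply: (@sum_skipS j (Ordinal (ltnW kn)) (Ordinal kn)) => //=; exact: leq_trans rk.
Qed.

(** The two values of label [j] on edge [j] are separated, and in one of the two sums the omitted
    edge is moved to the end. Then [z] from vertex [j + 1] on and [h z] from vertex [j] on run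
    through the same vertices and their terms cancel, unless the coordinate jumping at step [j] sits
    in the last layer. There its label is constant, 1 on the far face and 0 on the near one, which
    annihilates every product except when that coordinate is [j] itself; what remains is
    [A j.+1]. *)
Let A_step j : j < n -> A j = A j.+1.
Proof.
move=> jn; have n0 : n.-1 < n by lia.
pose jo := Ordinal jn; pose la := Ordinal n0.
(* Renumbers the jumps: jump [j] becomes the last one, the later ones come one step earlier. *)
pose cyc (s : 'I_n) : 'I_n := if s < j then s else if s == jo then la else ord_pred s.
have cycE (s : 'I_n) : nat_of_ord (cyc s) = if s < j then nat_of_ord s else if nat_of_ord s == j then n.-1 else s.-1.
  rewrite /cyc; case: ltnP => // js; rewrite -val_eqE /=; case: eqVneq => //= sj.
  have sn := ltn_ord s; rewrite (_ : (s + n).-1 = s.-1 + n); last by lia.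
  by rewrite modnDr modn_small//; lia.
have cyc_inj : injective cyc.
  move=> s s' /(congr1 val); rewrite /= !cycE => E; apply/val_inj => /=.
  have := ltn_ord s; have := ltn_ord s'; move: E.
  by do 2![case: ltnP => ?; [|case: eqP => ?]]; lia.
(* The base moves by one along the coordinate of jump [j]; [ordS] wraps the last layer back to layer
   0, so that [h] permutes all cells. *)
pose h (z : cell) : cell :=
  ([ffun c => if z.2 c == jo then ordS (z.1 c) else z.1 c], (z.2 * perm cyc_inj)%g).
have h_inj : injective h.
  move=> [v t] [v' t'] [/ffunP E /mulIg tt']; rewrite -tt' in E *.
  congr pair; apply/ffunP => c; have := E c; rewrite !ffunE /=.
  by case: ifP => // _; exact: ordS_inj.
have hD z : D j (h z) = D j z.
  apply: eq_forallb => c; case cj: (c < j) => //=; rewrite !ffunE permM permE.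
  have [zc|zc] := eqVneq (z.2 c) c.
    have -> : (z.2 c == jo) = false by apply/eqP; rewrite zc => E; move: cj; rewrite E ltnn.
    by congr (_ && _); apply/eqP/val_inj; rewrite /= cycE zc cj.
  rewrite andbF; apply/negbTE; rewrite negb_and; apply/orP; right.
  apply: contra zc => /eqP zc; apply/eqP; apply: (@cyc_inj _ _); rewrite zc.
  by apply/val_inj; rewrite /= cycE cj.
pose c_ (z : cell) := ((z.2)^-1%g jo).
have zc_ (z : cell) : z.2 (c_ z) = jo by rewrite /c_ permKV.
have c_ge (z : cell) : D j z -> j <= c_ z.
  by move=> Dz; rewrite leqNgt; apply/negP => cj; have [_] := DP Dz cj; rewrite zc_ => /(congr1 val)/= E; lia.
have hy (z : cell) s : D j z -> j <= s -> z.1 (c_ z) != ord_max -> s < n -> y (h z) s = y z s.+1.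
  move=> Dz js zm sn; apply/funext => c; rewrite /y /h /= ffunE permM permE.
  have [E|zj] := eqVneq (z.2 c) jo.
    have {E} -> : c = c_ z by rewrite /c_ -E permK.
    rewrite cycE zc_ ltnn eqxx /= modn_small; last first.
      by have := ltn_ord (z.1 (c_ z)); move: zm; rewrite -val_eqE /=; lia.
    have -> : (n.-1 < s) = false by lia.
    by rewrite ltnS js addn0 addn1.
  congr (_ + nat_of_bool _); rewrite cycE; move: zj; rewrite -val_eqE /= => zj.
  by case: (ltnP (z.2 c) j) => ?; rewrite ?(negbTE zj); apply/idP/idP; lia.
have hy0 (z : cell) s : z.1 (c_ z) = ord_max -> s < n -> y (h z) s (c_ z) = 0.
  move=> zm sn; rewrite /y /h /= ffunE permM permE zc_ eqxx cycE /= ltnn eqxx zm /= modnn.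
  by have -> : (n.-1 < s) = false by lia.
have yp (z : cell) s : z.1 (c_ z) = ord_max -> j < s -> y z s (c_ z) = p.+1.
  by move=> zm js; rewrite /y zc_ zm /= js addn1.
have beta0 (c : 'I_n) x : x c = 0 -> beta c x = 0%R by move=> /b0 E; rewrite /beta E.
have betap (c : 'I_n) x : x c = p.+1 -> beta c x = 1%R by move=> /bp E; rewrite /beta E.
have prod0 k (F : nat -> F2) : j <= k < n.-1 -> F k = 0%R -> (\prod_(j <= i < n.-1) F i = 0)%R.
  by move=> kn Fk; rewrite (bigD1_seq k) ?mem_index_iota ?iota_uniq//= Fk mul0r.
have skipj z : skip j j z = (\prod_(j.+1 <= k < n) step k z k)%R.
  transitivity (\prod_(j.+1 <= k < n.-1.+1) step k z k)%R; last by rewrite (ltn_predK jn).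
  rewrite big_add1 /=.
  by apply: eq_big_nat => k /andP[jk _]; rewrite /bump jk.
have S1 : A j = (\sum_(z | D j z) (beta j (y z j.+1) * skip j j z + beta j (y (h z) j) * skip j la (h z)))%R.
  transitivity (\sum_(z | D j z) (beta j (y z j.+1) * skip j j z + beta j (y z j) * skip j j z))%R.
    apply: eq_bigr => z Dz; rewrite skipj -mulrDl big_ltn//.
    by congr (_ * _)%R; rewrite /step addrC.
  rewrite !big_split/=; congr (_ + _)%R.
  rewrite (@sum_skip j jo (leqnn j) la) /=; last by lia.
  by rewrite (reindex_inj h_inj)/=; apply: eq_bigl => z; rewrite hD.
rewrite S1; transitivity (\sum_(z | D j z) if (z.1 jo == ord_max) && (z.2 jo == jo) then \prod_(j.+1 <= k < n) step k z k else 0)%R.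
  apply: eq_bigr => z Dz.
  have cE : (z.2 jo == jo) = (c_ z == jo).
    by apply/eqP/eqP => [E|E]; rewrite ?/c_; [rewrite -{1}E permK|rewrite -{1}E zc_].
  have [zm|zm] := eqVneq (z.1 (c_ z)) ord_max; last first.
    rewrite (_ : _ && _ = false); last first.
      by apply/negP => /andP[/eqP zj]; rewrite cE => /eqP E; move: zm; rewrite E zj eqxx.
    rewrite -(hy z j)//; rewrite (_ : skip j la (h z) = skip j j z) ?addxx//.
    apply: eq_big_nat => k /andP[jk kn]; rewrite /step /bump jk /= leqNgt kn add0n add1n.
    by rewrite !hy//; lia.
  have jc := c_ge z Dz; rewrite cE.
  have [E|cj] := eqVneq (c_ z) jo.
    rewrite -E zm eqxx /= skipj.
    rewrite (_ : beta j (y (h z) j) = 0)%R ?mul0r ?addr0; last first.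
      by apply: (@beta0 jo); rewrite -E hy0.
    rewrite (_ : beta j (y z j.+1) = 1)%R ?mul1r//.
    by apply: (@betap jo); rewrite -E yp.
  rewrite andbF; move: cj; rewrite -val_eqE /= => cj.
  have cn := ltn_ord (c_ z).
  rewrite {1}/skip (@prod0 (c_ z).-1) ?mulr0 ?add0r; first last.
  - rewrite /bump (_ : (j <= (c_ z).-1)) /=; last by lia.
    rewrite add1n prednK; last by lia.
    by rewrite /step !betap ?yp//; lia.
  - by lia.
  rewrite /skip (@prod0 (c_ z).-1) ?mulr0//; first by lia.
  rewrite /bump leqNgt (_ : (c_ z).-1 < n.-1) /=; last by lia.
  rewrite add0n prednK; last by lia.
  by rewrite /step !beta0 ?hy0//; lia.
rewrite -big_mkcondr; apply: eq_bigl => z.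
apply/andP/forallP => [[/forallP Dz zj] c|Dz].
  apply/implyP; rewrite ltnS leq_eqVlt => /predU1P[cj|]; last exact/implyP.
  by have -> : c = jo by apply/val_inj.
split; last by have /implyP := Dz jo; apply => /=.
by apply/forallP => c; apply/implyP => cj; have /implyP := Dz c; apply; exact: ltnW.
Qed.

(** The parity [A 0 = A n] is 1, because [D n] leaves a single cell with an empty product. Hence
    some cell has all its factors non-zero, and each label takes both values on its path. *)
Lemma kuhn_cell : exists2 v : 'I_n -> nat, (forall c, v c <= p) &
  forall k : 'I_n, exists s t : 'I_n -> nat,
    [/\ forall c, v c <= s c <= (v c).+1, forall c, v c <= t c <= (v c).+1,
        b k s = false & b k t].
Proof.
have A1 : A 0 = 1%R.
  transitivity (A n).
    have : forall j, j <= n -> A 0 = A j.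
      by elim=> // j ih jn; rewrite (ih (ltnW jn)) A_step.
    exact.
  rewrite /A (big_pred1 ([ffun=> ord_max], 1%g)); first by rewrite big_geq.
  move=> [v t]; apply/forallP/eqP => [Dz|[-> ->] c]; last first.
    by rewrite ffunE perm1 !eqxx implybT.
  congr pair; [apply/ffunP|apply/permP] => c; have /implyP/(_ (ltn_ord c))/andP[/eqP/= E1 /eqP/= E2] := Dz c.
    by rewrite ffunE.
  by rewrite perm1.
have [z zP] : exists z, (\prod_(0 <= k < n) step k z k != 0)%R.
  apply/existsP; apply: contraTT isT => /existsPn/= z0.
  have : A 0 = 0%R by rewrite /A big1// => z _; apply/eqP/negPn/z0.
  by rewrite A1 => /eqP; rewrite oner_eq0.
exists (fun c => z.1 c) => [c|k]; first by rewrite -ltnS.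
have {zP} : (step k z k != 0)%R.
  by move: zP; rewrite big_mkord prodf_seq_neq0 => /allP/(_ k); rewrite mem_index_enum; apply.
have yv s c : z.1 c <= y z s c <= (z.1 c).+1.
  by rewrite /y leq_addr/=; case: (_ < s) => /=; lia.
rewrite /step /beta; case E1: (b k (y z k)); case E2: (b k (y z k.+1)) => //=; rewrite ?addxx ?eqxx// => _.
  by exists (y z k.+1), (y z k).
by exists (y z k), (y z k.+1).
Qed.

End CubicalParity.

Section MatrixNorm.
Context {R : realType}.

Lemma mx_norm_coord m n (x : 'M[R]_(m, n)) i j : `|x i j| <= `|x|.
Proof.
rewrite [leRHS]/Num.norm/= mx_normrE.
exact: (@le_bigmax _ _ _ 0 (fun ij : 'I_m * 'I_n => `|x ij.1 ij.2|) (i, j)).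
Qed.

Lemma mx_norm_le m n (x : 'M[R]_(m, n)) M : 0 <= M ->
  (forall i j, `|x i j| <= M) -> `|x| <= M.
Proof. by move=> M0 xM; rewrite /Num.norm/= mx_normrE; apply: bigmax_le => // ij _. Qed.

End MatrixNorm.

Section PoincareMiranda.
Context {R : realType} (n : nat).
Implicit Types (x y : 'rV[R]_n).

Definition in_cube x : Prop := forall c, `|x 0 c| <= 1.

Lemma cube_compact : compact [set x | in_cube x].
Proof.
have -> : [set x | in_cube x] = [set x : 'rV[R]_n | forall c, `[-1, 1]%classic (x ord0 c)].
  by apply/seteqP; split => x xc c; have := xc c; rewrite /= in_itv/= ler_norml.
apply: (@rV_compact R n (fun=> `[-1, 1]%classic)) => c; exact: segment_compact.
Qed.

(** Ever finer grids contain Kuhn cells on which each [F i] takes both signs. By compactness of the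
    cube these cells accumulate at a point, where continuity forces every [F i] to vanish. *)
Theorem poincare_miranda (F : 'rV[R]_n -> 'I_n -> R) :
  (forall x, in_cube x -> forall e, 0 < e -> exists2 d, 0 < d &
     forall y, in_cube y -> (forall c, `|y 0 c - x 0 c| <= d) ->
     forall i, `|F y i - F x i| <= e) ->
  (forall x i, in_cube x -> x 0 i = -1 -> F x i <= 0) ->
  (forall x i, in_cube x -> x 0 i = 1 -> 0 <= F x i) ->
  exists2 x, in_cube x & forall i, F x i = 0.
Proof.
move=> Fc Fm Fp.
pose pt (p : nat) (v : 'I_n -> nat) : 'rV[R]_n := \row_c (- 1 + 2 * (v c)%:R / p.+1%:R).
have pt_cube p v : (forall c, (v c <= p.+1)%N) -> in_cube (pt p v).
  move=> vp c; rewrite mxE ler_norml lerDl -lerBrDl opprK -[1 + 1]/(2%:R : R).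
  by rewrite !mulr_ge0 ?invr_ge0//= ler_pdivrMr// ler_wpM2l// ler_nat.
have cell p : exists v : 'I_n -> nat, (forall c, (v c <= p)%N) /\ forall k, exists s t : 'I_n -> nat,
   [/\ forall c, (v c <= s c <= (v c).+1)%N, forall c, (v c <= t c <= (v c).+1)%N,
     F (pt p s) k <= 0 & 0 <= F (pt p t) k].
  (* The label is the strict sign of [F], overridden on the faces as [kuhn_cell] demands; the face
     hypotheses make the overridden labels correct as weak inequalities. *)
  pose b k (v : 'I_n -> nat) : bool := if insub k is Some c then
    (v c != 0%N) && ((v c == p.+1) || (0 < F (pt p v) c)) else false.
  have bE (c : 'I_n) v : b c v = (v c != 0%N) && ((v c == p.+1) || (0 < F (pt p v) c)).
    by rewrite /b valK.
  have [c v vc|c v vc|v vp vP] := @kuhn_cell n p b.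
  - by rewrite bE vc.
  - by rewrite bE vc eqxx.
  exists v; split=> // k; have [s [t [vs vt]]] := vP k.
  rewrite !bE => bs bt; exists s, t; split=> //.
    have sp c : (s c <= p.+1)%N by have := vs c; have := vp c; lia.
    move/negbT: bs; rewrite negb_and negbK => /orP[/eqP s0|].
      by apply: Fm; [exact: pt_cube|rewrite mxE s0 mulr0 mul0r addr0].
    by rewrite negb_or -leNgt => /andP[].
  have tp c : (t c <= p.+1)%N by have := vt c; have := vp c; lia.
  move: bt => /andP[_ /orP[/eqP t1|/ltW//]].
  apply: Fp; [exact: pt_cube|rewrite mxE t1 mulfK ?pnatr_eq0//].
  by rewrite addrC -[2]/(1 + 1) addrK.
have /choice[v vP] := cell.
pose u (p : nat) := pt p (v p).
have u_cube p : in_cube (u p).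
  by apply: pt_cube => c; have [/(_ c)] := vP p; lia.
have [x [xc xcl]] : exists x, in_cube x /\ cluster (u @ \oo) x.
  have [|x [xc xcl]] := @cube_compact (u @ \oo) _; last by exists x.
  by exists 0%N => // p _ /=; exact: u_cube.
exists x => // i; apply/eqP; rewrite -normr_le0; apply/ler_addgt0Pr => e e0; rewrite add0r.
have [d d0 dP] := Fc x xc e e0.
(* The cell has side [2 / p.+1 <= d / 2] and its base lies within [d / 2] of [x], so all its
   vertices lie within [d]. *)
have d2 : 0 < d / 4 by rewrite divr_gt0.
have [N NP] := exists_nat_inv_le d2.
have uA : (u @ \oo) [set u p | p in [set p | (N <= p)%N]] by exists N => // p Np; exists p.
have xB : nbhs x (ball x (d / 2)) by apply: nbhsx_ballx; rewrite divr_gt0.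
have [_ [[p Np <-] xp]] := xcl _ _ uA xB.
have up c : `|u p 0 c - x 0 c| <= d / 2.
  move: xp; rewrite -ball_normE /= distrC => /ltW; apply: le_trans.
  by have := mx_norm_coord (u p - x) 0 c; rewrite !mxE.
have mesh (w : 'I_n -> nat) c : (v p c <= w c <= (v p c).+1)%N -> `|pt p w 0 c - x 0 c| <= d.
  move=> /andP[w1 w2]; have := up c; have -> : u p 0 c = pt p (v p) 0 c by [].
  have p4 := NP p Np; rewrite !mxE.
  have : (v p c)%:R <= (w c)%:R :> R by rewrite ler_nat.
  have : (w c)%:R <= (v p c)%:R + 1 :> R by rewrite natr1 ler_nat.
  set r := p.+1%:R^-1 in p4 *; have r0 : 0 <= r by rewrite invr_ge0.
  rewrite -[_ / _]/(_ * r) -[in X in _ -> X]/(_ * r).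
  rewrite !ler_norml => w4 w3 /andP[? ?]; apply/andP; split; nra.
have [vp] := vP p; move=> /(_ i) [s [t [vs vt Fs Ft]]].
have wc (w : 'I_n -> nat) : (forall c, (v p c <= w c <= (v p c).+1)%N) -> in_cube (pt p w).
  by move=> vw; apply: pt_cube => c; have := vw c; have := vp c; lia.
have := dP _ (wc s vs) (fun c => mesh s c (vs c)) i.
have := dP _ (wc t vt) (fun c => mesh t c (vt c)) i.
by rewrite !ler_norml => /andP[? ?] /andP[? ?]; apply/andP; split; lra.
Qed.

End PoincareMiranda.

(** * Multiplier rule *)

Section ConeSeparation.
Context {R : realType}.

(** [D] need not be closed, so a nearest point may not exist. If [x] stays away from [D], the
    differences [x - d k] along a minimizing sequence are bounded and accumulate at some [phi],
    which plays the part of [x] minus its projection onto the closure. *)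
Lemma cone_dense_or_separated (J : finType) (D : set (J -> R)) :
  D (fun=> 0) ->
  (forall x y, D x -> D y -> D (fun j => x j + y j)) ->
  (forall t x, 0 <= t -> D x -> D (fun j => t * x j)) ->
  (forall x e, 0 < e -> exists2 d, D d & forall j, `|d j - x j| <= e) \/
  (exists phi : J -> R, (exists j, phi j != 0) /\
     forall d, D d -> \sum_j phi j * d j <= 0).
Proof.
move=> D0 DD DZ; apply: contrapT => /not_orP[/existsNP[x /existsNP[e0 /not_implyP[e00 nd]]] np].
apply: np.
pose sq (v : J -> R) := \sum_j v j ^+ 2.
have sq_coord v j : v j ^+ 2 <= sq v.
  by rewrite /sq (bigD1 j)//= lerDl sumr_ge0// => i _; rewrite sqr_ge0.
have sq_ge0 v : 0 <= sq v by apply: sumr_ge0 => j _; exact: sqr_ge0.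
pose S := [set sq (fun j => x j - d j) | d in D].
have S0 : has_inf S.
  split; first by exists (sq (fun j => x j - 0)), (fun=> 0).
  by exists 0 => _ [d _ <-].
pose m := inf S.
have mle d : D d -> m <= sq (fun j => x j - d j).
  by move=> Dd; apply: ge_inf; [case: S0|exists d].
have m_gt0 : e0 ^+ 2 <= m.
  apply: lb_le_inf; first by case: S0.
  move=> _ [d Dd <-]; rewrite leNgt; apply/negP => lt.
  apply: nd; exists d => // j; rewrite -ler_sqr ?nnegrE ?(ltW e00)//.
  rewrite real_normK ?num_real//; apply: le_trans (ltW lt).
  by rewrite -sqrrN opprB; exact: (sq_coord (fun j => x j - d j)).
have /choice[d dP] (k : nat) : exists d, D d /\ sq (fun j => x j - d j) <= m + k.+1%:R^-1.
  have k0 : 0 < k.+1%:R^-1 :> R by rewrite invr_gt0 ltr0n.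
  have [_ [d Dd <-] lt] := inf_adherent k0 S0.
  by exists d; split=> //; exact: ltW.
pose w k j := x j - d k j.
(* The squares of the coordinates are at most [m + 1]; as [B >= 1], the same [B] bounds the
   coordinates without a square root. *)
pose B := m + 2.
have B1 : 1 <= B by have := le_trans (sqr_ge0 _) m_gt0; rewrite /B; lra.
have wB k j : `|w k j| <= B.
  have : `|w k j| ^+ 2 <= B.
    rewrite real_normK ?num_real// (le_trans (sq_coord (w k) j))// (le_trans (dP k).2)//.
    rewrite /B lerD2l (@le_trans _ _ 1) ?ler1n// invf_le1 ?ltr0n// ler1n//.
  have [|w1] := leP `|w k j| 1; first by move=> /le_trans ->.
  by apply: le_trans; rewrite expr2 ler_peMr// ltW.
pose u k : 'rV[R]_#|J| := \row_i w k (enum_val i).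
have [|phi [phiB phicl]] := @rV_compact R #|J| (fun=> `[-B, B]%classic) (fun=> @segment_compact R _ _) (u @ \oo) _.
  by exists 0%N => // k _ i; rewrite /= mxE in_itv/= -ler_norml.
have near_phi e N : 0 < e -> exists2 k, (N <= k)%N & forall j, `|w k j - phi 0 (enum_rank j)| <= e.
  move=> e_gt0.
  have uA : (u @ \oo) [set u k | k in [set k | (N <= k)%N]] by exists N => // k Nk; exists k.
  have xB : nbhs phi (ball phi e) by apply: nbhsx_ballx.
  have [_ [[k Nk <-] phik]] := phicl _ _ uA xB.
  exists k => // j; move: phik; rewrite -ball_normE /= distrC => /ltW; apply: le_trans.
  by have := mx_norm_coord (u k - phi) 0 (enum_rank j); rewrite !mxE enum_rankK.
exists (fun j => phi 0 (enum_rank j)); split.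
  apply: contrapT => phi0.
  have {}phi0 j : phi 0 (enum_rank j) = 0 by apply/eqP/negPn/negP => pj; apply: phi0; exists j.
  have [k _ kP] := near_phi e0 0%N e00.
  apply: nd; exists (d k); first by case: (dP k).
  by move=> j; have := kP j; rewrite phi0 subr0 /w distrC.
move=> c Dc; apply/ler_addgt0Pr => e e_gt0; rewrite add0r.
pose n1 := \sum_j `|c j|; have n10 : 0 <= n1 by apply: sumr_ge0.
(* With this step, comparing [d k + t c] with the infimum gives
   [2 t <w k, c> <= t e / 2 + t^2 |c|^2], hence [<w k, c> <= e / 2]. *)
pose t := e / 2 / (sq c + 1).
have sc1 : 0 < sq c + 1 by rewrite ltr_wpDl.
have t0 : 0 < t by rewrite !divr_gt0.
have e3 : 0 < e / 4 / (n1 + 1) by rewrite !divr_gt0// ltr_wpDl.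
have te : 0 < t * (e / 2) by rewrite mulr_gt0// divr_gt0.
have [N NP] := exists_nat_inv_le te.
have [k Nk kP] := near_phi _ N e3.
have [Dk dk] := dP k.
have := mle _ (DD _ _ Dk (DZ _ _ (ltW t0) Dc)).
have -> : sq (fun j => x j - (d k j + t * c j)) = sq (w k) - 2 * t * \sum_j w k j * c j + t ^+ 2 * sq c.
  rewrite /sq !mulr_sumr -sumrB -big_split/=; apply: eq_bigr => j _; rewrite /w; ring.
move=> H1; have H2 : sq (w k) <= m + t * (e / 2) by rewrite (le_trans dk)// lerD2l NP.
have H3 : \sum_j w k j * c j <= e / 2.
  have ts : t * sq c <= e / 2.
    have tE : t * (sq c + 1) = e / 2 by rewrite divfK// gt_eqF.
    by rewrite -tE ler_wpM2l ?(ltW t0)// lerDl.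
  have : t * (2 * \sum_j w k j * c j) <= t * (e / 2 + t * sq c) by lra.
  by rewrite ler_pM2l//; lra.
have H4 : \sum_j phi 0 (enum_rank j) * c j - \sum_j w k j * c j <= e / 4 / (n1 + 1) * n1.
  rewrite -sumrB mulr_sumr; apply: ler_sum => j _; rewrite -mulrBl.
  rewrite (le_trans (ler_norm _))// normrM ler_wpM2r// distrC; exact: kP.
have : e / 4 / (n1 + 1) * n1 <= e / 4.
  by rewrite mulrAC ler_pdivrMr ?ltr_wpDl// ler_wpM2l ?lerDl// divr_ge0// ltW.
lra.
Qed.

End ConeSeparation.

Section MultiplierRule.
Context {R : realType} {I : finType} {q : nat}.

Definition direction : finType := option ('I_q * bool).

(* [None] asks for improvement only, [Some (j, s)] also moves the [j]-th
   equality constraint by [1] or [-1]. *)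
Definition direction_target (w : direction) (j : 'I_q) : R :=
  if w is Some (k, s) then if k == j then (if s then 1 else -1) else 0 else 0.

(** The separation lemma is applied to the cone of first-order images enlarged downwards in the
    coordinates of [I], which forces the multipliers there to be nonnegative. When the cone is
    dense, one finite combination is chosen for each of the [2 q + 1] directions and all of them are
    concatenated, tagged by their direction. *)
Lemma multiplier_alternative (G : Type) (L : G -> I -> R) (M : G -> 'I_q -> R) (eta : R) :
  0 < eta ->
  (exists (theta : I -> R) (mu : 'I_q -> R), [/\ forall k, 0 <= theta k,
      (exists k, theta k != 0) \/ (exists j, mu j != 0)
    & forall g, \sum_k theta k * L g k + \sum_j mu j * M g j <= 0]) \/
  (exists2 e : seq (G * R * direction), all (fun x => 0 <= x.1.2) e &
    forall w, (forall k, 1 <= \sum_(x <- e | x.2 == w) x.1.2 * L x.1.1 k) /\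
      forall j, `|\sum_(x <- e | x.2 == w) x.1.2 * M x.1.1 j - direction_target w j| <= eta).
Proof.
move=> eta0.
pose D : set (I + 'I_q -> R) := [set v | exists2 s : seq (G * R), all (fun x => 0 <= x.2) s &
  (forall k, v (inl k) <= \sum_(x <- s) x.2 * L x.1 k) /\
  (forall j, v (inr j) = \sum_(x <- s) x.2 * M x.1 j)].
have D0 : D (fun=> 0) by exists [::] => //; split=> ?; rewrite big_nil.
have DD x y : D x -> D y -> D (fun v => x v + y v).
  move=> [s s0 [sL sM]] [s' s'0 [s'L s'M]]; exists (s ++ s'); first by rewrite all_cat s0.
  by split=> k; rewrite big_cat/= ?lerD// sM s'M.
have DZ t x : 0 <= t -> D x -> D (fun v => t * x v).
  move=> t0 [s s0 [sL sM]]; exists [seq (z.1, t * z.2) | z <- s].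
    by rewrite all_map; apply: sub_all s0 => z /= z0; rewrite mulr_ge0.
  by split=> k; rewrite big_map/=; under eq_bigr do rewrite -mulrA;
    rewrite -mulr_sumr ?ler_wpM2l// sM.
have [dense|[phi [phi0 phiD]]] := cone_dense_or_separated D0 DD DZ.
- right.
  have /choice[s sP] (w : direction) : exists s : seq (G * R), [/\ all (fun x => 0 <= x.2) s,
      forall k, 1 <= \sum_(x <- s) x.2 * L x.1 k &
      forall j, `|\sum_(x <- s) x.2 * M x.1 j - direction_target w j| <= eta].
    (* Asking for [1 + eta] leaves at least 1 after an error of [eta]. *)
    have [d [s s0 [sL sM]] dP] := dense (fun v => match v with inl _ => 1 + eta | inr j => direction_target w j end) eta eta0.
    exists s; split=> // [k|j]; last by rewrite -sM; exact: (dP (inr j)).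
    by rewrite (le_trans _ (sL k))//; have := dP (inl k); rewrite ler_norml => /andP[]; lra.
  pose e := flatten [seq [seq (x.1, x.2, w) | x <- s w] | w <- enum direction].
  have eE (F : G -> R) w : \sum_(x <- e | x.2 == w) x.1.2 * F x.1.1 = \sum_(x <- s w) x.2 * F x.1.
    rewrite /e big_flatten big_map big_enum/=.
    under eq_bigr do rewrite big_map/=.
    rewrite (bigD1 w)//= [X in _ + X]big1 ?addr0.
      by apply: eq_bigl => x; rewrite eqxx.
    by move=> w' /negbTE w'w; rewrite w'w big_pred0.
  exists e.
    rewrite /e; elim: (enum _) => //= w ws ih; rewrite all_cat ih andbT all_map.
    by have [] := sP w.
  move=> w; have [_ s1 s2] := sP w.
  by split=> k; [rewrite (eE (fun g => L g k))|rewrite (eE (fun g => M g k))].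
left; exists (fun k => phi (inl k)), (fun j => phi (inr j)); split.
(* The negative unit vector belongs to [D] with the empty list, thanks to the downward
   enlargement. *)
- move=> k; have : D (fun v => if v == inl k then -1 else 0).
    exists [::] => //; split=> k'; rewrite big_nil//.
    by case: ifP => //; rewrite oppr_le0.
  move=> /phiD; rewrite (bigD1 (inl k))//= eqxx big1 ?addr0 ?mulrN1 ?oppr_le0//.
  by move=> v /negbTE ->; rewrite mulr0.
- by have [[k|j] vj] := phi0; [left; exists k|right; exists j].
- move=> g; have : D (fun v => match v with inl k => L g k | inr j => M g j end).
    by exists [:: (g, 1)]; [rewrite /= ler01|split=> k; rewrite big_seq1 mul1r].
  by move=> /phiD; rewrite big_sumType.
Qed.

(** Lengths [a y] are attached to each [y] of the cube so that [H (a y)] is [s * y] up to [s / 2]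
    while each [P] is at least [s - s / 4]. On a face of the cube the sign of [H] is then known, and
    Poincaré-Miranda supplies a [y] at which [H] vanishes exactly; the improvement survives for
    every [y]. *)
Lemma feasible_improvement (N : nat) (r : 'I_N -> R) (om : 'I_N -> direction)
    (L : 'I_N -> I -> R) (M : 'I_N -> 'I_q -> R)
    (P : ('I_N -> R) -> I -> R) (H : ('I_N -> R) -> 'I_q -> R) :
  (forall i, 0 <= r i) ->
  (forall w k, 1 <= \sum_(i | om i == w) r i * L i k) ->
  (forall w j, `|\sum_(i | om i == w) r i * M i j - direction_target w j| <= (4 * (q%:R + 1))^-1) ->
  (forall e, 0 < e -> \forall d \near 0^'+, forall a, (forall i, 0 <= a i) -> \sum_i a i <= d ->
     forall k, `|P a k - \sum_i a i * L i k| <= e * \sum_i a i) ->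
  (forall e, 0 < e -> \forall d \near 0^'+, forall a, (forall i, 0 <= a i) -> \sum_i a i <= d ->
     forall j, `|H a j - \sum_i a i * M i j| <= e * \sum_i a i) ->
  (\forall d \near 0^'+, forall a, (forall i, 0 <= a i) -> \sum_i a i <= d ->
     forall e, 0 < e -> exists2 d', 0 < d' & forall b, (forall i, 0 <= b i) ->
     \sum_i b i <= d -> \sum_i `|b i - a i| <= d' -> forall j, `|H b j - H a j| <= e) ->
  forall d, 0 < d -> exists a, [/\ forall i, 0 <= a i, \sum_i a i <= d,
    forall j, H a j = 0 & forall k, 0 < P a k].
Proof.
move=> r0 rL rM PL HM Hc d d0.
pose S := \sum_i r i + 1; have S0 : 0 < S by rewrite ltr_wpDl// sumr_ge0.
(* With [s * S = d1], the expansion error [e * \sum_i a i] is at most [s / 4]. The inexact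
   directions cost another [s / 4]: their total weight is at most [q + 1], which explains the
   tolerance [(4 * (q + 1))^-1]. *)
pose e := (4 * S)^-1; have e0 : 0 < e by rewrite invr_gt0 mulr_gt0.
have eS : e * S = 4^-1 by rewrite /e; field; rewrite gt_eqF.
have [d1 [d10 d1d PLd HMd Hcd]] : exists d1, [/\ 0 < d1, d1 <= d,
   forall a, (forall i, 0 <= a i) -> \sum_i a i <= d1 ->
     forall k, `|P a k - \sum_i a i * L i k| <= e * \sum_i a i,
   forall a, (forall i, 0 <= a i) -> \sum_i a i <= d1 ->
     forall j, `|H a j - \sum_i a i * M i j| <= e * \sum_i a i &
   forall a, (forall i, 0 <= a i) -> \sum_i a i <= d1 ->
     forall e, 0 < e -> exists2 d', 0 < d' & forall b, (forall i, 0 <= b i) ->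
     \sum_i b i <= d1 -> \sum_i `|b i - a i| <= d' -> forall j, `|H b j - H a j| <= e].
  near (0 : R)^'+ => d1; exists d1; split.
  - by near: d1; exact: nbhs_right_gt.
  - by near: d1; exact: nbhs_right_le.
  - by near: d1; exact: PL.
  - by near: d1; exact: HM.
  - by near: d1; exact: Hc.
pose s := d1 / S; have s0 : 0 < s by rewrite divr_gt0.
have sS : s * S = d1 by rewrite divfK// gt_eqF.
(* Positive and negative parts of the coordinates, so that [y] is the combination of the targets
   with nonnegative weights. Direction [None] keeps weight 1 and secures an improvement independent
   of [y]. *)
pose W (y : 'rV[R]_q) (w : direction) : R :=
  match w with None => 1 | Some (j, true) => Num.max (y 0 j) 0 | Some (j, false) => Num.max (- y 0 j) 0 end.
have W0 y w : 0 <= W y w by case: w => [[j []]|]//=; rewrite le_max lexx orbT.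
have W1 y w : in_cube y -> W y w <= 1.
  move=> yc; case: w => [[j []]|]//=; have := yc j; rewrite ler_norml => /andP[? ?];
  rewrite ge_max ler01 andbT; lra.
have maxL (u v : R) : `|Num.max u 0 - Num.max v 0| <= `|u - v|.
  have := ler_norm (u - v); have := ler_norm (v - u); rewrite distrC ler_norml.
  by case: (leP u 0) => ?; case: (leP v 0) => ? ? ?; apply/andP; split; lra.
have Wc (x y : 'rV[R]_q) w t : 0 <= t -> (forall c, `|y 0 c - x 0 c| <= t) -> `|W y w - W x w| <= t.
  move=> t0 yx; case: w => [[j []]|] /=; last by rewrite subrr normr0.
    by rewrite (le_trans (maxL _ _)).
  by rewrite (le_trans (maxL _ _))// opprK addrC distrC.
pose a y i := s * (r i * W y (om i)).
have a0 y i : 0 <= a y i by rewrite /a; apply: mulr_ge0 (ltW s0) (mulr_ge0 (r0 i) (W0 y (om i))).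
have aS y : in_cube y -> \sum_i a y i <= d1.
  move=> yc; rewrite -mulr_sumr -sS ler_wpM2l ?(ltW s0)// /S.
  rewrite (@le_trans _ _ (\sum_i r i)) ?lerDl// ler_sum// => i _.
  by rewrite ler_piMr ?W1.
have aE y (F : 'I_N -> R) : \sum_i a y i * F i = s * \sum_w W y w * \sum_(i | om i == w) r i * F i.
  rewrite (partition_big om predT)//= mulr_sumr; apply: eq_bigr => w _.
  by rewrite !mulr_sumr; apply: eq_bigr => i /eqP <-; rewrite /a; ring.
have WS y (F : direction -> R) : \sum_w W y w * F w =
    F None + \sum_j (Num.max (y 0 j) 0 * F (Some (j, true)) + Num.max (- y 0 j) 0 * F (Some (j, false))).
  rewrite (bigD1 None)//= mul1r; congr (_ + _).
  rewrite (reindex_omap Some id)/=; last by case.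
  under eq_bigl do rewrite eqxx.
  rewrite (eq_bigr (fun p : 'I_q * bool => W y (Some (p.1, p.2)) * F (Some (p.1, p.2)))); last by move=> [].
  by rewrite -(pair_bigA _ (fun j b => W y (Some (j, b)) * F (Some (j, b))))/=; apply: eq_bigr => j _; rewrite big_bool.
have maxB (t : R) : Num.max t 0 - Num.max (- t) 0 = t.
  by case: (ler0P t) => t0; [rewrite max_l ?oppr_ge0// sub0r opprK|rewrite max_r ?subr0// oppr_le0 ltW].
have maxD (t : R) : Num.max t 0 + Num.max (- t) 0 = `|t|.
  by case: (ler0P t) => t0; [rewrite max_l ?oppr_ge0// add0r|rewrite max_r ?addr0// oppr_le0 ltW].
have aM y j : in_cube y -> `|\sum_i a y i * M i j - s * y 0 j| <= s / 4.
  move=> yc; rewrite aE -mulrBr normrM gtr0_norm// ler_wpM2l ?(ltW s0)//.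
  have -> : y 0 j = \sum_w W y w * direction_target w j.
    rewrite WS/= add0r (bigD1 j)//= eqxx mulr1 mulrN1 maxB big1 ?addr0//.
    by move=> k /negbTE ->; rewrite !mulr0 addr0.
  rewrite -sumrB (le_trans (ler_norm_sum _ _ _))//.
  apply: (@le_trans _ _ (\sum_w W y w * (4 * (q%:R + 1))^-1)).
    by apply: ler_sum => w _; rewrite -mulrBr normrM ger0_norm// ler_wpM2l// rM.
  rewrite (WS y (fun=> (4 * (q%:R + 1))^-1)).
  apply: (@le_trans _ _ ((4 * (q%:R + 1))^-1 + \sum_(j < q) (4 * (q%:R + 1))^-1)).
    rewrite lerD2l; apply: ler_sum => k _; rewrite -mulrDl maxD.
    by rewrite ler_piMl ?yc// ?invr_ge0 ?mulr_ge0 ?addr_ge0.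
  rewrite sumr_const card_ord -mulr_natr le_eqVlt; apply/orP; left; apply/eqP.
  by field; rewrite gt_eqF// ltr_wpDl.
have err y : in_cube y -> e * \sum_i a y i <= s / 4.
  move=> yc; rewrite (le_trans (ler_wpM2l (ltW e0) (aS y yc)))//.
  by rewrite -sS mulrCA eS.
have HE y j : in_cube y -> `|H (a y) j - s * y 0 j| <= s / 2.
  move=> yc; rewrite -(subrKA (\sum_i a y i * M i j)) (le_trans (ler_normD _ _))//.
  have := HMd _ (a0 y) (aS y yc) j; have := aM y j yc; have := err y yc; lra.
have [x xc e' e'0|y j yc yj|y j yc yj|y yc y0] := @poincare_miranda R q (fun y => H (a y)).
- have [d' d'0 d'P] := Hcd _ (a0 x) (aS x xc) e' e'0.
  exists (d' / d1); first by rewrite divr_gt0.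
  move=> y yc yx j; apply: d'P => //; first exact: aS.
  have dd1 : 0 <= d' / d1 by rewrite divr_ge0 ?ltW.
  apply: (@le_trans _ _ (\sum_i s * r i * (d' / d1))).
    apply: ler_sum => i _.
    have -> : a y i - a x i = s * r i * (W y (om i) - W x (om i)) by rewrite /a; ring.
    have sr : 0 <= s * r i by exact: mulr_ge0 (ltW s0) (r0 i).
    by rewrite normrM (ger0_norm sr) ler_wpM2l// Wc.
  rewrite -mulr_suml -mulr_sumr -[leRHS](@divfK _ d1) ?gt_eqF// mulrC ler_wpM2l//.
  by rewrite -sS ler_wpM2l ?(ltW s0)// lerDl.
- by have := HE y j yc; rewrite yj ler_norml => /andP[]; lra.
- by have := HE y j yc; rewrite yj ler_norml => /andP[]; lra.
exists (a y); split=> //; first by rewrite (le_trans (aS y yc)).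
move=> k; have := PLd _ (a0 y) (aS y yc) k; rewrite ler_norml => /andP[+ _].
have := err y yc; suff : s <= \sum_i a y i * L i k by lra.
rewrite aE ler_peMr ?(ltW s0)// WS (le_trans (rL None k))// lerDl sumr_ge0// => j _.
by rewrite addr_ge0// mulr_ge0 ?le_max ?lexx ?orbT// (le_trans ler01).
Unshelve. all: by end_near. Qed.

End MultiplierRule.

(** * Piecewise regular functions *)

Section PiecewiseConversion.
Context {R : realType}.
Implicit Types (T t s : R).

Lemma tau_ltn T (s : seq R) i k : itv_partition 0 T s ->
  (i < k)%N -> (k <= size s)%N -> tau T s i < tau T s k.
Proof.
move=> [ps _] ik ks; rewrite /tau.
by rewrite (lt_sorted_ltn_nth T (s := 0 :: s) ps) ?inE /= ?ltnS// (leq_trans (ltnW ik) ks).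
Qed.

Lemma tau_size T (s : seq R) : itv_partition 0 T s -> tau T s (size s) = T.
Proof. by move=> [_ /eqP E]; rewrite /tau -[RHS]E (last_nth T). Qed.

Lemma tau_range T (s : seq R) i : itv_partition 0 T s -> (i < size s)%N ->
  0 <= tau T s i < T /\ 0 < tau T s i.+1 <= T.
Proof.
move=> ps si; split; apply/andP; split.
- case: i si => [//|i] si; rewrite ltW//.
  by rewrite -[ltLHS]/(tau T s 0) tau_ltn// ltnW.
- by rewrite -[ltRHS](tau_size ps) tau_ltn.
- by rewrite -[ltLHS]/(tau T s 0) tau_ltn.
- move: si; rewrite leq_eqVlt => /predU1P[->|si]; first by rewrite tau_size.
  by rewrite -[leRHS](tau_size ps) ltW// tau_ltn.
Qed.

Lemma mem_tau T (s : seq R) t : itv_partition 0 T s -> 0 <= t < T -> t \in 0 :: s ->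
  exists2 i, (i < size s)%N & t = tau T s i.
Proof.
move=> ps /andP[_ tT] ts; exists (index t (0%R :: s)); last by rewrite /tau nth_index.
have : (index t (0%R :: s) < size (0%R :: s))%N by rewrite index_mem.
rewrite /= ltnS leq_eqVlt => /predU1P[E|//].
by have := tau_size ps; rewrite /tau -E nth_index// => tE; rewrite tE ltxx in tT.
Qed.

Lemma mem_tau_gt0 T (s : seq R) t : itv_partition 0 T s -> 0 < t -> t \in 0 :: s ->
  exists2 i, (i < size s)%N & t = tau T s i.+1.
Proof.
move=> ps t0; rewrite inE => /predU1P[E|ts]; first by rewrite E ltxx in t0.
by exists (index t s); [rewrite index_mem|rewrite /tau/= nth_index].
Qed.

Lemma NPC0_cadlag (Y : topologicalType) T (u : R -> Y) :
  NPC0 T u -> cadlag 0 T u.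
Proof.
move=> [[s ps su] ur _]; split=> t ti; first by apply: ur; rewrite in_itv/=.
have /andP[t0 tT] := ti; have [ts|ts] := boolP (t \in 0 :: s).
  by have [i si ->] := mem_tau_gt0 ps t0 ts; have [] := su i si.
have [|i si ti'] := itv_partition_tau ps _ ts; first by rewrite (ltW t0).
have [uc _ _] := su i si; exists (u t).
exact/cvg_at_left_filter/uc.
Qed.

Lemma NPC0_continuous_off (Y : topologicalType) T (u : R -> Y) :
  NPC0 T u -> exists D : seq R, forall t, 0 < t < T -> t \notin D ->
    u s @[s --> t] --> u t.
Proof.
move=> [[s ps su] _ _]; exists (0 :: s) => t /andP[t0 tT] ts.
have [|i si ti] := itv_partition_tau ps _ ts; first by rewrite !ltW.
by have [uc _ _] := su i si; exact: uc.
Qed.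

(** The converse of the two preceding lemmas: being càdlàg and continuous off a finite list passes
    to pairs and compositions without refining subdivisions. The subdivision is recovered by sorting
    the exceptional times inside []0, T[] and appending [T]. *)
Lemma NPC0_of_cadlag (Y : topologicalType) T (u : R -> Y) (D : seq R) : 0 < T ->
  cadlag 0 T u -> u r @[r --> T^'-] --> u T ->
  (forall t, 0 < t < T -> t \notin D -> u s @[s --> t] --> u t) ->
  NPC0 T u.
Proof.
move=> T0 [ur ul] uT uD.
pose L := sort <=%R (undup [seq d <- D | 0 < d < T]).
have LP t : (t \in L) = (0 < t < T) && (t \in D).
  by rewrite mem_sort mem_undup mem_filter.
have Ls : sorted <%R L by rewrite sort_lt_sorted undup_uniq.
pose s := rcons L T.
have ps : itv_partition 0 T s.
  split; last by rewrite last_rcons.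
  rewrite /s rcons_path; apply/andP; split.
    rewrite lt_path_sortedE Ls andbT; apply/allP => t.
    by rewrite LP => /andP[/andP[]].
  have : last 0 L \in 0 :: L by exact: mem_last.
  rewrite inE => /predU1P[->//|]; by rewrite LP => /andP[/andP[]].
split; [|by move=> t; rewrite in_itv/=; exact: ur|by []].
exists s => // i si; have [i1 i2] := tau_range ps si; split.
- move=> t; rewrite in_itv/= => /andP[it ti].
  apply: uD; first by case/andP: i1 => /le_lt_trans -> // _; case/andP: i2 => _ /(lt_le_trans ti) ->.
  apply/negP => tD.
  have tL : t \in 0 :: s.
    rewrite /s in_cons mem_rcons in_cons LP tD andbT.
    by case/andP: i1 => /le_lt_trans -> // _; case/andP: i2 => _ /(lt_le_trans ti) ->; rewrite !orbT.
  have tE : t = tau T s (index t (0%R :: s)) by rewrite /tau nth_index.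
  have ks : (index t (0%R :: s) <= size s)%N by rewrite -ltnS -[X in (_ < X)%N]/(size (0%R :: s)) index_mem.
  have [ik|ki] := leqP i.+1 (index t (0%R :: s)).
    move: ik; rewrite leq_eqVlt => /predU1P[ik|ik]; first by move: ti; rewrite ik -tE ltxx.
    by have := tau_ltn ps ik ks; rewrite -tE => /(lt_trans ti); rewrite ltxx.
  move: ki; rewrite ltnS leq_eqVlt => /predU1P[ki|ki]; first by move: it; rewrite -ki -tE ltxx.
  by have := tau_ltn ps ki (ltnW si); rewrite -tE => /(lt_trans it); rewrite ltxx.
- by exists (u (tau T s i)); exact: ur.
- exact: ul.
Qed.

Lemma right_primitive_id (X : normedModType R) (a b c : R) (v : X) :
  right_primitive a b (fun s => (s - c) *: v) (fun=> v).
Proof.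
split=> t ti.
  apply: cvg_at_left_filter; apply: cvgZl; apply: cvgB; [exact: cvg_id|exact: cvg_cst].
move=> e e0; near=> s; rewrite -!scalerBl (_ : _ - _ - _ = 0); last by ring.
by rewrite scale0r normr0 mulr_ge0 ?(ltW e0)// subr_ge0 ltW.
Unshelve. all: by end_near. Qed.

Lemma right_primitive_affine (X : normedModType R) (a b e : R) (x g : R -> X) v :
  a <= b -> right_primitive a b x g -> (forall t, a <= t < b -> `|g t - v| <= e) ->
  `|x b - x a - (b - a) *: v| <= e * (b - a).
Proof.
move=> ab xg gv.
have := right_primitive_increment_cst ab (right_primitiveB xg (right_primitive_id a b a v)) gv.
by rewrite subrr scale0r subr0 addrAC.
Qed.

(** Near a continuity point the derivative is uniformly close to [g t], so [right_primitive_affine]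
    bounds the increments on both sides of [t], although only right derivatives are assumed. *)
Lemma right_primitive_derive1 (X : normedModType R) (a b : R) (x g : R -> X) t :
  right_primitive a b x g -> a < t < b -> g s @[s --> t] --> g t ->
  derivable x t 1 /\ derive1 x t = g t.
Proof.
move=> xg /andP[at_ tb] gt.
have : (fun h => h^-1 *: (x (h + t) - x t)) @ 0^' --> g t.
  apply/cvgrPdistC_le => e e0.
  move/cvgrPdistC_le : (gt) => /(_ e e0)/nbhs_ballP[d /= d0 dP].
  rewrite /dnbhs near_withinE; apply/nbhs_ballP.
  exists (Num.min d (Num.min (t - a) (b - t))); first by rewrite /= !lt_min d0 !subr_gt0 at_.
  move=> h; rewrite -ball_normE /= sub0r normrN !lt_min => /and3P[hd ha hb] h0.
  have gP r : `|r - t| <= `|h| -> `|g r - g t| <= e.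
    by move=> rt; apply: dP; rewrite -ball_normE/= distrC (le_lt_trans rt).
  have -> : h^-1 *: (x (h + t) - x t) - g t = h^-1 *: (x (h + t) - x t - h *: g t).
    by rewrite [RHS]scalerBr scalerA mulVf// scale1r.
  rewrite normrZ normfV mulrC ler_pdivrMr ?normr_gt0//.
  have [h_gt0|h_le0] := ltP 0 h.
    have th : t <= h + t by rewrite lerDr ltW.
    have htb : h + t <= b by move: hb; rewrite gtr0_norm//; lra.
    have := right_primitive_affine th (right_primitive_sub (ltW at_) htb xg) (v := g t) (e := e).
    rewrite addrK gtr0_norm//; apply => r /andP[tr rh]; apply: gP.
    by rewrite ger0_norm ?subr_ge0// gtr0_norm//; lra.
  have h_lt0 : h < 0 by rewrite lt_neqAle h0.
  have th : h + t <= t by rewrite gerDr.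
  have aht : a <= h + t by move: ha; rewrite ltr0_norm//; lra.
  have := right_primitive_affine th (right_primitive_sub aht (ltW tb) xg) (v := g t) (e := e).
  rewrite ltr0_norm// (_ : t - (h + t) = - h); last by ring.
  have -> : x (h + t) - x t - h *: g t = - (x t - x (h + t) - - h *: g t).
    by rewrite scaleNr !opprD !opprK (addrC (- x t)).
  rewrite normrN; apply.
  move=> r /andP[hr rt]; apply: gP.
  by rewrite ltr0_norm ?subr_lt0// ltr0_norm//; lra.
move=> H; split; last by apply: cvg_lim.
by apply/cvg_ex; exists (g t); under eq_fun do rewrite /= scaler1 /=.
Qed.

Lemma right_primitive_PC1 (X : normedModType R) T (x g : R -> X) : 0 < T ->
  right_primitive 0 T x g -> NPC0 T g ->
  PC1 T x /\ forall t, 0 <= t <= T -> ext_derive T x t = g t.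
Proof.
move=> T0 xg gN; have [[s ps gs] gr gT] := gN.
have dP i t : (i < size s)%N -> t \in `]tau T s i, tau T s i.+1[ ->
    derivable x t 1 /\ derive1 x t = g t.
  move=> si ti; have [i1 i2] := tau_range ps si; have [gc _ _] := gs i si.
  apply: (right_primitive_derive1 xg); last exact: gc.
  move: ti; rewrite in_itv/= => /andP[it ti].
  by case/andP: i1 => /le_lt_trans -> // _; case/andP: i2 => _ /(lt_le_trans ti) ->.
have dE i : (i < size s)%N -> {in `]tau T s i, tau T s i.+1[, derive1 x =1 g}.
  by move=> si t /(dP i t si) [].
have rE i (y : X) : (i < size s)%N -> g r @[r --> (tau T s i)^'+] --> y ->
    derive1 x r @[r --> (tau T s i)^'+] --> y.
  move=> si; apply: cvg_trans; apply: near_eq_cvg; near=> r.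
  apply/esym/(dE i si); rewrite in_itv/=; apply/andP; split; near: r.
    exact: nbhs_right_gt.
  by apply: nbhs_right_lt; exact: tau_ltn.
have lE i (y : X) : (i < size s)%N -> g r @[r --> (tau T s i.+1)^'-] --> y ->
    derive1 x r @[r --> (tau T s i.+1)^'-] --> y.
  move=> si; apply: cvg_trans; apply: near_eq_cvg; near=> r.
  apply/esym/(dE i si); rewrite in_itv/=; apply/andP; split; near: r.
    by apply: nbhs_left_gt; exact: tau_ltn.
  exact: nbhs_left_lt.
have xs : PC1_along T s x.
  split=> //.
  - by apply/(cont_on_within _ T0); exact: right_primitive_cont xg.
  - by move=> i si t /(dP i t si) [].
  - move=> i si; have [gc [y gy] [z gz]] := gs i si; split.
    + move=> t ti; have := gc t ti; rewrite /continuous_at (dE i si t ti).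
      apply: cvg_trans; apply: near_eq_cvg; near=> r; apply/esym/(dE i si).
      near: r; exact: near_in_itvoo.
    + by exists y; exact: rE.
    + by exists z; exact: lE.
split; first by exists s.
move=> t ti; rewrite (ext_deriveE xs) ?in_itv//= /ext_derive_along.
case: eqP => [->|/eqP tT].
  apply: cvg_lim => //; rewrite -{1}(tau_size ps).
  have s0 : (0 < size s)%N.
    case: (s) ps => [[_ /eqP/= E]|//]; by rewrite E ltxx in T0.
  have := lE (size s).-1 (g T); rewrite prednK//; apply.
    exact: leqnn.
  by rewrite tau_size.
have tT' : 0 <= t < T by case/andP: ti => -> tT'; rewrite lt_neqAle tT.
case: ifPn => ts.
  have [i si tE] := mem_tau ps tT' ts.
  apply: cvg_lim => //; rewrite {1}tE; apply: rE => //.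
  by rewrite -tE; apply: gr; rewrite in_itv.
have [i si ti'] := itv_partition_tau ps ti ts.
exact: (dE i si _ ti').
Unshelve. all: by end_near. Qed.

Lemma PC1_right_primitive (X : normedModType R) T (x g : R -> X) : 0 < T -> PC1 T x ->
  (forall t, 0 <= t <= T -> ext_derive T x t = g t) -> right_primitive 0 T x g.
Proof.
move=> T0 [s xs] xg; have [ps xc xd xpw] := xs.
have [xr xl] := (cont_on_within x T0).1 xc.
split=> // t /[dup] ti /andP[t0 tT].
have ti' : 0 <= t <= T by rewrite t0 ltW.
rewrite -xg// (ext_deriveE xs) ?in_itv//= /ext_derive_along (lt_eqF tT).
case: ifPn => ts; last first.
  have [i si tii] := itv_partition_tau ps ti' ts.
  by apply: rderiv_derive1; exact: xd tii.
have [i si tE] := mem_tau ps ti ts.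
have [_ [y xy] _] := xpw i si.
rewrite -tE in xy; rewrite (cvg_lim _ xy)// => e e0.
have /cvgrPdistC_le/(_ e e0)/near_rightP[d d0 dP] := xy.
have ti1 : t < tau T s i.+1 by rewrite tE tau_ltn.
apply/near_rightP; exists (Num.min d (tau T s i.+1 - t)); first by rewrite lt_min d0 subr_gt0.
move=> r /andP[tr]; rewrite -ltrBlDl lt_min => /andP[rd ri].
(* At a subdivision time the derivative is known only to the right of [t]. The estimate is proved
   from [z > t], and [z] then tends to [t] by continuity of [x]. *)
have rP z : t < z -> z < r -> `|x r - x z - (r - z) *: y| <= e * (r - z).
  move=> tz zr.
  have dz w : z <= w <= r -> derivable x w 1.
    move=> /andP[zw wr]; apply: (xd i si); rewrite in_itv/= -tE (lt_le_trans tz zw)/=.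
    by rewrite (le_lt_trans wr)//; move: ri; lra.
  apply: (@right_primitive_affine _ _ _ _ x (derive1 x)) => //; first exact: ltW.
    split=> w /andP[zw wr]; last by apply: rderiv_derive1; apply: dz; rewrite zw ltW.
    apply: cvg_at_left_filter; apply: differentiable_continuous.
    by apply/derivable1_diffP; apply: dz; rewrite wr ltW.
  move=> w /andP[zw wr]; apply: dP; rewrite (lt_le_trans tz zw) (lt_trans wr)//; lra.
have zc : `|x r - x z - (r - z) *: y| - e * (r - z) @[z --> t^'+] --> `|x r - x t - (r - t) *: y| - e * (r - t).
  have idc : r - z @[z --> t^'+] --> r - t.
    by apply: cvgB; [exact: cvg_cst|apply: cvg_at_right_filter; exact: cvg_id].
  apply: cvgB; last by apply: cvgM; [exact: cvg_cst|].
  apply: cvg_norm; apply: cvgB; last exact: cvgZl.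
  by apply: cvgB; [exact: cvg_cst|exact: xr].
rewrite -subr_le0; apply: (cvgr_to_le zc); near=> z; rewrite subr_le0; apply: rP; near: z.
  exact: nbhs_right_gt.
exact: nbhs_right_lt.
Unshelve. all: by end_near. Qed.

End PiecewiseConversion.

(** * From pointwise differentials on compact sets to uniform bounds in a tube *)

Section MeanValue.
Context {R : realType} {X Y : normedModType R}.

Lemma gateaux_rderiv (f : X -> Y) (x v : X) (s : R) (D : 'L(X, Y)) :
  is_gateaux f (x + s *: v) D -> rderiv (fun s => f (x + s *: v)) s (D v).
Proof.
move=> /(_ v)/cvgrPdistC_le fD e e0.
have := fD e e0 => /near_rightP[d d0 dP]; apply/near_rightP; exists d => // r /andP[sr rd].
have rs0 : 0 < r - s by rewrite subr_gt0.
have := dP (r - s); rewrite rs0 add0r ltrBlDl rd => /(_ isT).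
rewrite -addrA -scalerDl (addrC s) subrK => H.
have -> : f (x + r *: v) - f (x + s *: v) - (r - s) *: D v =
   (r - s) *: ((r - s)^-1 *: (f (x + r *: v) - f (x + s *: v)) - D v).
  by rewrite scalerBr scalerA divff ?gt_eqF// scale1r.
by rewrite normrZ gtr0_norm// mulrC ler_wpM2r// ltW.
Qed.

(** Along a segment the Gâteaux differential is a right derivative, and the same differential in the
    opposite direction gives left continuity; the right-primitive mean value inequality then
    applies. *)
Lemma gateaux_mean_value (f : X -> Y) (x z : X) (K : R) :
  (forall s, 0 <= s <= 1 -> gateaux_differentiable f (x + s *: (z - x)) /\
     `|DG f (x + s *: (z - x))| <= K) ->
  `|f z - f x| <= K * `|z - x|.
Proof.
move=> fK; set v := z - x in fK *.
have fP : right_primitive 0 1 (fun s => f (x + s *: v)) (fun s => DG f (x + s *: v) v).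
  split=> s /andP[s0 s1]; last first.
    by apply: gateaux_rderiv; apply: DGP; apply: (fK s _).1; rewrite s0 ltW.
  have /fK[/DGP fD _] : 0 <= s <= 1 by rewrite ltW.
  apply/cvg_at_leftNP.
  have : is_gateaux f (x + - s *: - v) (DG f (x + s *: v)) by rewrite scalerN scaleNr opprK.
  move=> /gateaux_rderiv/rderiv_cvg; rewrite scalerN scaleNr opprK.
  by apply: cvg_trans; apply: near_eq_cvg; near=> r; rewrite /= scalerN scaleNr.
have := right_primitive_increment_cst (M := K * `|v|) ler01 fP.
rewrite scale1r scale0r addr0 subr0 mulr1 (addrC x) /v subrK; apply => s /andP[s0 s1].
rewrite (le_trans (blin_norm_ub _ _))// ler_wpM2r//; apply: (fK s _).2.
by rewrite s0 ltW.
Unshelve. all: by end_near. Qed.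

End MeanValue.

Section CompactTube.
Context {R : realType}.

Lemma cvg_seq_compact (E : topologicalType) (u : nat -> E) (l : E) :
  u @ \oo --> l -> compact ([set l] `|` range u).
Proof.
move=> ul F FF FK; apply: contrapT => nc.
have [A [V [FA Vl AV]]] : exists A V, [/\ F A, nbhs l V & A `&` V = set0].
  apply: contrapT => H; apply: nc; exists l; split; first by left.
  move=> A V FA Vl; apply: contrapT => AV; apply: H; exists A, V; split => //.
  by apply/eqP/negPn/negP => /set0P.
have [N _ NP] := ul V Vl.
have FS : F [set u n | n in `I_N].
  apply: filterS (filterI FA FK) => x [Ax [xl|[n _ xn]]].
    by have : (A `&` V) x; [split=> //; rewrite xl; exact: nbhs_singleton|rewrite AV].
  exists n => //=; rewrite ltnNge; apply/negP => Nn.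
  have : (A `&` V) x by split=> //; rewrite -xn; exact: NP.
  by rewrite AV.
have fin : compact [set u n | n in `I_N].
  by apply: finite_compact; apply: finite_image; exact: finite_II.
have [x [[n _ xn] xF]] := fin F FF FS.
by apply: nc; exists x; split=> //; right; exists n.
Qed.

Lemma within_continuous_cvg (X Y : topologicalType) (A : set X) (phi : X -> Y)
    (I : Type) (F : set_system I) {FF : Filter F} (c : I -> X) (z : X) :
  {within A, continuous phi} -> A z -> c i @[i --> F] --> z ->
  (\forall i \near F, A (c i)) -> phi (c i) @[i --> F] --> phi z.
Proof.
move=> /subspace_continuousP phic Az cz Ac B /(phic z Az) zB.
have {}zB : nbhs z (fun x => A x -> B (phi x)) by [].
have cB : F (fun i => A (c i) -> B (phi (c i))) := cz _ zB.
suff : F (fun i => B (phi (c i))) by [].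
by near=> i; have := near cB i; apply => //; near: i.
Unshelve. all: by end_near. Qed.

(** The bound is known only on compact sets, and neighbourhoods in [E] need not be compact. If no
    tube worked near some [t], there would be points [xi n] tending to [x0 t] that leave [Omega] or
    have [Phi] above [n]; with their limit, a tail of them forms a compact subset of [Omega], on
    which [Phi] is bounded. Compactness of [[0, T]] makes the local tubes uniform. *)
Lemma tube_bound (E : normedModType R) (U : Type) (T : R) (Omega : set E) (x0 : R -> E)
    (M : set U) (Phi : R -> E -> U -> R) :
  open Omega -> {within `[0, T], continuous x0} ->
  (forall t, 0 <= t <= T -> Omega (x0 t)) ->
  (forall K : set E, K `<=` Omega -> K !=set0 -> compact K ->
     exists B, forall t x z, 0 <= t <= T -> K x -> M z -> Phi t x z <= B) ->
  exists2 r, 0 < r & exists B, forall t x, 0 <= t <= T -> `|x - x0 t| <= r ->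
    Omega x /\ forall z, M z -> Phi t x z <= B.
Proof.
move=> oO x0c x0O bd.
(* The same [n] governs the radius and the bound, so one large [n] settles both. *)
pose P (n : nat) t := forall x, `|x - x0 t| <= n.+1%:R^-1 ->
  Omega x /\ forall z, M z -> Phi t x z <= n%:R.
suff : \forall n \near \oo, `[0, T]%classic `<=` P n.
  move=> [n _ /(_ n (leqnn n)) nP].
  exists n.+1%:R^-1; first by rewrite invr_gt0 ltr0n.
  by exists n%:R => t x ti; apply: nP; rewrite /= in_itv.
have := @segment_compact R 0 T => /compact_near_coveringP/near_covering_withinP.
apply => t; rewrite /= in_itv/= => ti; apply: contrapT => H.
have {}H (k : nat) : exists nt : nat * R, [/\ (k <= nt.1)%N, `|t - nt.2| < k.+1%:R^-1,
    0 <= nt.2 <= T & ~ P nt.1 nt.2].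
  apply: contrapT => nk; apply: H.
  exists (ball t k.+1%:R^-1, [set n | (k <= n)%N]) => /=.
    by split; [apply: nbhsx_ballx; rewrite invr_gt0 ltr0n|exists k].
  move=> [s n] [/= ts kn]; rewrite in_itv/= => sT; apply: contrapT => nP.
  by apply: nk; exists (n, s).
have /choice[nt ntP] := H.
have /choice[xi xiP] (n : nat) : exists x, `|x - x0 (nt n).2| <= n.+1%:R^-1 /\
    ~ (Omega x /\ forall z, M z -> Phi (nt n).2 x z <= n%:R).
  apply: contrapT => nx; have [kn _ _] := ntP n; apply => x xn.
  have [Ox xB] : Omega x /\ forall z, M z -> Phi (nt n).2 x z <= n%:R.
    apply: contrapT => nO; apply: nx; exists x; split=> //.
    by rewrite (le_trans xn)// lef_pV2 ?posrE ?ltr0n// ler_nat.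
  by split=> // z Mz; rewrite (le_trans (xB z Mz))// ler_nat.
have tt : x0 (nt n).2 @[n --> \oo] --> x0 t.
  apply: (within_continuous_cvg x0c); first by rewrite /= in_itv.
    2: by near=> n; have [_ _ ? _] := ntP n; rewrite /= in_itv.
  apply/cvgrPdist_lt => e e0; have [N NP] := exists_nat_inv_le e0.
  by exists N => // n /= Nn; have [_ /lt_le_trans + _ _] := ntP n; apply; exact: NP.
have xit : xi n @[n --> \oo] --> x0 t.
  apply/cvgrPdistC_le => e e0; have e2 : 0 < e / 2 by rewrite divr_gt0.
  have [N NP] := exists_nat_inv_le e2.
  move/cvgrPdistC_le : tt => /(_ _ e2)[N' _ N'P].
  exists (maxn N N') => // n /=; rewrite geq_max => /andP[/NP Nn /N'P ne].
  rewrite -(subrKA (x0 (nt n).2)) (le_trans (ler_normD _ _))//.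
  by rewrite [e]splitr lerD// (le_trans (xiP n).1).
have [N _ NP] : \forall n \near \oo, Omega (xi n).
  by apply: xit; apply: open_nbhs_nbhs; split=> //; exact: x0O.
pose u n := xi (n + N)%N.
have ut : u @ \oo --> x0 t by rewrite /u (cvg_shiftn N (fun n => xi n)).
have KO : [set x0 t] `|` range u `<=` Omega.
  move=> _ [->|[n _ <-]]; first exact: x0O.
  by apply: NP; rewrite /= leq_addl.
have [|B BP] := bd _ KO _ (cvg_seq_compact ut); first by exists (x0 t); left.
have [n nB] : exists n : nat, B <= n%:R.
  by exists (Num.bound `|B|); rewrite (le_trans (ler_norm B))// ltW// archi_boundP.
have [_] := xiP (n + N)%N; apply; split; first by apply: NP; rewrite /= leq_addl.
move=> z Mz; rewrite (@le_trans _ _ n%:R) ?ler_nat ?leq_addr// (le_trans _ nB)//.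
by apply: BP => //; [case: (ntP (n + N)%N)|right; exists n].
Unshelve. all: by end_near. Qed.

End CompactTube.

Section CompactRange.
Context {R : realType}.

(** By induction on the pieces: on each one [u] is completed by its left limit at the right end into
    a continuous function [v], whose image of the closed piece is compact. *)
Lemma NPC0_compact_range (Y : topologicalType) (T : R) (u : R -> Y) : 0 < T ->
  NPC0 T u -> exists2 M, compact M & forall t, 0 <= t <= T -> M (u t).
Proof.
move=> T0 [[s ps us] ur uT].
suff H k : (k <= size s)%N -> exists2 M : set Y, compact M & forall t, 0 <= t < tau T s k -> M (u t).
  have [M cM MP] := H _ (leqnn _); rewrite tau_size// in MP.
  exists (M `|` [set u T]); first by apply: compactU => //; exact: compact_set1.
  move=> t /andP[t0]; rewrite le_eqVlt => /predU1P[->|tT]; first by right.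
  by left; apply: MP; rewrite t0.
elim: k => [_|i ih si].
  exists set0; first exact: compact0.
  by move=> t /andP[t0 /(le_lt_trans t0)]; rewrite ltxx.
have [M cM MP] := ih (ltnW si).
have [uc _ [z uz]] := us i si; have [/andP[i0 iT] _] := tau_range ps si.
have ii1 : tau T s i < tau T s i.+1 by exact: tau_ltn.
pose v t := if t <= tau T s i then u (tau T s i) else if t < tau T s i.+1 then u t else z.
have vc : continuous v.
  move=> t; have [ti|it] := ltP t (tau T s i).
    apply: (near_cst_continuous (u (tau T s i))); near=> r.
    by rewrite /v ifT// ltW//; near: r; exact: lt_nbhsl.
  have [ti1|] := ltP t (tau T s i.+1); last rewrite le_eqVlt => /predU1P[ti1|ti1].
  - move: it; rewrite le_eqVlt => /predU1P[ti|it].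
      apply/left_right_continuousP; rewrite -ti; split.
        rewrite [v (tau T s i)]/v lexx; apply: cvg_near_cst; near=> r.
        by rewrite /v ifT//; near: r; exact: nbhs_left_le.
      rewrite [v (tau T s i)]/v lexx; have := ur (tau T s i); rewrite in_itv/= i0 iT => /(_ isT).
      apply: cvg_trans; apply: near_eq_cvg; near=> r; rewrite /v leNgt ifF.
        by rewrite ifT//; near: r; exact: nbhs_right_lt.
      by apply/negbTE; rewrite negbK; near: r; exact: nbhs_right_gt.
    have := uc t; rewrite in_itv/= it ti1 => /(_ isT).
    rewrite /continuous_at [v t]/v leNgt it ti1/=; apply: cvg_trans; apply: near_eq_cvg; near=> r.
    rewrite /v leNgt ifF; first by rewrite ifT//; near: r; exact: lt_nbhsl.
    by apply/negbTE; rewrite negbK; near: r; exact: lt_nbhsr.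
  - apply/left_right_continuousP; rewrite -ti1 [v (tau T s i.+1)]/v leNgt ii1 ltxx/=; split.
      move: uz; apply: cvg_trans; apply: near_eq_cvg; near=> r; rewrite /v leNgt ifF.
        by rewrite ifT//; near: r; exact: nbhs_left_lt.
      by apply/negbTE; rewrite negbK; near: r; exact: nbhs_left_gt.
    apply: cvg_near_cst; near=> r; have : tau T s i.+1 < r by near: r; exact: nbhs_right_gt.
    by move=> ri; rewrite /v leNgt (lt_trans ii1 ri)/= ltNge ltW.
  - apply: (near_cst_continuous z); near=> r.
    have ri : tau T s i.+1 < r by near: r; exact: lt_nbhsr.
    by rewrite /v leNgt (lt_trans ii1 ri)/= ltNge ltW.
exists (M `|` (v @` `[tau T s i, tau T s i.+1])).
  apply: compactU => //; apply: continuous_compact; last exact: segment_compact.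
  exact: continuous_subspaceT.
move=> t /andP[t0 ti]; have [tti|it] := ltP t (tau T s i); first by left; apply: MP; rewrite t0.
right; exists t; first by rewrite /= in_itv/= it ltW.
rewrite /v; move: it; rewrite le_eqVlt => /predU1P[<-|it]; first by rewrite lexx.
by rewrite leNgt it ti.
Unshelve. all: by end_near. Qed.

End CompactRange.

Section RadialRetraction.
Context {R : realType} {E : normedModType R}.
Implicit Types (r : R) (e : E).

(** For [r > 0], the radial retraction onto the closed ball of radius [r]. *)
Definition radial r e : E := (r / Num.max r `|e|) *: e.

Lemma radial_id r e : 0 < r -> `|e| <= r -> radial r e = e.
Proof. by move=> r0 er; rewrite /radial max_l// divff ?gt_eqF// scale1r. Qed.

Lemma radial_le r e : 0 < r -> `|radial r e| <= r.
Proof.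
move=> r0; have m0 : 0 < Num.max r `|e| by rewrite lt_max r0.
rewrite /radial normrZ ger0_norm ?divr_ge0 ?(ltW r0) ?(ltW m0)//.
by rewrite mulrAC ler_pdivrMr// ler_wpM2l ?(ltW r0)// le_max lexx orbT.
Qed.

(** The constant 2 is for a general norm: one unit comes from moving the vector, one from the change
    of the scaling factor. *)
Lemma radial_lip r e e' : 0 < r -> `|radial r e - radial r e'| <= 2 * `|e - e'|.
Proof.
move=> r0; set m := Num.max r `|e|; set m' := Num.max r `|e'|.
have m0 : 0 < m by rewrite lt_max r0.
have m'0 : 0 < m' by rewrite lt_max r0.
have rm : r / m <= 1 by rewrite ler_pdivrMr// mul1r le_max lexx.
have mm : `|m' - m| <= `|e - e'|.
  have H : `| `|e| - `|e'| | <= `|e - e'| by exact: ler_dist_dist.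
  move: H; rewrite !ler_norml /m /m'.
  by case: (leP r `|e|) => ?; case: (leP r `|e'|) => ? /andP[? ?]; apply/andP; split; lra.
have -> : radial r e - radial r e' = (r / m) *: (e - e') + (r / m - r / m') *: e'.
  by rewrite /radial -/m -/m' scalerBr scalerBl addrA subrK.
rewrite mulr2n mulrDl mul1r (le_trans (ler_normD _ _))// lerD//.
  rewrite normrZ ger0_norm ?divr_ge0 ?(ltW r0) ?(ltW m0)//.
  by rewrite ler_piMl.
rewrite normrZ (_ : r / m - r / m' = (r / m) * ((m' - m) / m')); last first.
  by field; rewrite !gt_eqF.
rewrite normrM ger0_norm ?divr_ge0 ?(ltW r0) ?(ltW m0)// normrM normfV (gtr0_norm m'0).
have H1 : r / m * `|m' - m| <= `|m' - m| by exact: ler_piMl.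
have H2 : `|e'| / m' <= 1 by rewrite ler_pdivrMr// mul1r le_max lexx orbT.
have -> : r / m * (`|m' - m| / m') * `|e'| = r / m * `|m' - m| * (`|e'| / m') by ring.
rewrite (le_trans _ mm)// (le_trans _ H1)// ler_piMr//.
by rewrite mulr_ge0// divr_ge0 ?(ltW r0) ?(ltW m0).
Qed.

End RadialRetraction.

(** * Fréchet and Hadamard expansions *)

Section FrechetExpansion.
Context {R : realType} {X Y : normedModType R}.
Implicit Types (f : X -> Y) (D : 'L(X, Y)).

Lemma blin_continuous D : continuous D.
Proof.
have [M DM] := blin_bounded D.
apply/linear_bounded_continuous/linear_boundedP; near=> r => z.
by rewrite (le_trans (DM z))// ler_wpM2r//; near: r; exact: nbhs_pinfty_ge.
Unshelve. all: by end_near. Qed.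

Lemma frechet_expansion f x : differentiable f x -> forall e, 0 < e ->
  exists2 d, 0 < d & forall v, `|v| <= d -> `|f (x + v) - f x - DF f x v| <= e * `|v|.
Proof.
move=> fx e e0; have /(@diff_val _ _ _ _ _ _) dE := DFP fx.
have := diff_locally fx; rewrite dE => /eqaddoP/(_ e e0)/nbhs_ballP[d /= d0 dP].
have d2 : 0 < d / 2 by rewrite divr_gt0.
exists (d / 2) => // v vd; have := dP v; rewrite -ball_normE/= sub0r normrN.
rewrite (le_lt_trans vd) ?ltr_pdivrMr ?ltr_pMr ?ltr1n// => /(_ isT).
by rewrite -[(_ - _) v]/(f (v + x) - (f x + DF f x v)) opprD addrA (addrC v).
Qed.

Lemma DF_unique f x D :
  (forall e, 0 < e -> exists2 d, 0 < d & forall v, `|v| <= d ->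
     `|f (x + v) - f x - D v| <= e * `|v|) ->
  DF f x = D.
Proof.
move=> H.
have E : f \o shift x = cst (f x) + D +o_0 id.
  apply/eqaddoP => e e0; have [d d0 dP] := H e e0.
  apply/nbhs_ballP; exists d => // v; rewrite -ball_normE/= sub0r normrN => /ltW vd.
  by have := dP v vd; rewrite -[X in _ -> `|X| <= _]/(f (v + x) - (f x + D v)) opprD addrA (addrC x).
have dE := diff_unique (@blin_continuous D) E.
have fx : differentiable f x.
  by apply/diff_locallyP; rewrite dE; split=> //; exact: blin_continuous.
have /(@diff_val _ _ _ _ _ _) := DFP fx; rewrite dE => /= DE.
by apply: blinP => v; rewrite -DE.
Qed.

Lemma DF_lipschitz f x (K r : R) : differentiable f x -> 0 < r ->
  (forall v, `|v| <= r -> `|f (x + v) - f x| <= K * `|v|) -> forall v, `|DF f x v| <= K * `|v|.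
Proof.
move=> fx r0 fK v; have [->|v0] := eqVneq v 0; first by rewrite linear0 !normr0 mulr0.
have nv : 0 < `|v| by rewrite normr_gt0.
apply/ler_addgt0Pr => e e0.
have ev : 0 < e / `|v| by rewrite divr_gt0.
have [d d0 dP] := frechet_expansion fx ev.
pose s := Num.min r d / `|v|; have s0 : 0 < s by rewrite divr_gt0// lt_min r0.
have sv : `|s *: v| = Num.min r d by rewrite normrZ gtr0_norm// divfK// gt_eqF.
have := dP (s *: v); rewrite sv ge_min lexx orbT => /(_ isT) H1.
have := fK (s *: v); rewrite sv ge_min lexx => /(_ isT) H2.
have H3 : s * `|DF f x v| <= `|f (x + s *: v) - f x| + `|f (x + s *: v) - f x - DF f x (s *: v)|.
  rewrite -[X in X * _](gtr0_norm s0) -normrZ -linearZ/=.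
  by rewrite -{1}[DF f x (s *: v)](subKr (f (x + s *: v) - f x)) ler_normB.
rewrite -(ler_pM2l s0) (le_trans H3)// (le_trans (lerD H2 H1))//.
by rewrite -sv normrZ gtr0_norm// le_eqVlt; apply/orP; left; apply/eqP; field; rewrite gt_eqF.
Qed.

End FrechetExpansion.

Section BlinOperations.
Context {R : realType}.

Lemma blin_ub (X Y : normedModType R) (f : 'L(X, Y)) x : `|f x| <= `|f| * `|x|.
Proof. exact: blin_norm_ub. Qed.

Section Comp.
Context {X Y Z : normedModType R} (g : 'L(Y, Z)) (f : 'L(X, Y)).

Let comp_subproof : (g \o f : X -> Z) \in @blin_pred R X Z.
Proof.
apply/mem_set; split; first by move=> a u v /=; rewrite !linearP.
exists (`|g| * `|f|) => x /=; rewrite (le_trans (blin_ub _ _))// -mulrA.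
by rewrite ler_wpM2l// blin_ub.
Qed.

Definition blin_comp : 'L(X, Z) := Blin comp_subproof.

End Comp.

Lemma blinD (X Y : normedModType R) (f g : 'L(X, Y)) x : (f + g) x = f x + g x.
Proof. by []. Qed.

Lemma blinB (X Y : normedModType R) (f g : 'L(X, Y)) x : (f - g) x = f x - g x.
Proof. by []. Qed.

Lemma blin_sum (X Y : normedModType R) (I : Type) (r : seq I) (f : I -> 'L(X, Y)) x :
  (\sum_(i <- r) f i) x = \sum_(i <- r) f i x.
Proof. by elim/big_ind2 : _ => // f1 y1 f2 y2 <- <-. Qed.

Lemma seq_complete_blin (X Y : normedModType R) : seq_complete Y -> seq_complete 'L(X, Y).
Proof.
move=> cY u uC.
have /choice[L LP] (v : X) : exists w : Y, u n v @[n --> \oo] --> w.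
  apply: (cY (fun n => u n v)) => e e0.
  have v1 : 0 < `|v| + 1 by rewrite ltr_wpDl.
  have [N NP] := uC (e / (`|v| + 1)) (divr_gt0 e0 v1).
  exists N => n m Nn Nm; rewrite -blinB (le_trans (blin_ub _ _))//.
  rewrite (le_trans (ler_wpM2r _ (NP n m Nn Nm)))// mulrAC ler_pdivrMr//.
  by rewrite ler_wpM2l ?(ltW e0)// lerDl.
have Ldist e N : (forall n m, (N <= n)%N -> (N <= m)%N -> `|u n - u m| <= e) ->
    forall n v, (N <= n)%N -> `|u n v - L v| <= e * `|v|.
  move=> NP n v Nn.
  have H : `|u n v - u m v| @[m --> \oo] --> `|u n v - L v|.
    by apply: cvg_norm; apply: cvgB; [exact: cvg_cst|exact: LP].
  apply: (cvgr_to_le H); exists N => // m /= Nm.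
  by rewrite -blinB (le_trans (blin_ub _ _))// ler_wpM2r// NP.
have Lin : linear L.
  move=> a v w; apply: (cvg_unique _ (LP (a *: v + w))) => //.
  have -> : (fun n => u n (a *: v + w)) = (fun n => a *: u n v + u n w).
    by apply/funext => n; rewrite linearP.
  by apply: cvgD (LP w); apply: cvgZ (LP v); exact: cvg_cst.
have Lbd : exists M : R, forall v, `|L v| <= M * `|v|.
  have [N NP] := uC 1 ltr01; exists (`|u N| + 1) => v.
  have := Ldist _ _ NP N v (leqnn N); rewrite mul1r distrC => H.
  rewrite -(subrK (u N v) (L v)) (le_trans (ler_normD _ _))// mulrDl mul1r addrC lerD//.
  exact: blin_ub.
have LM : L \in @blin_pred R X Y by apply/mem_set; split.
exists (Blin LM); apply/cvgrPdistC_le => e e0.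
have [N NP] := uC e e0; exists N => // n /= Nn.
apply: blin_norm_le => v v1; rewrite blinB (le_trans (Ldist _ _ NP n v Nn))//.
by rewrite ler_piMr// ltW.
Qed.

Lemma seq_complete_prod (X Y : normedModType R) :
  seq_complete X -> seq_complete Y -> seq_complete (X * Y)%type.
Proof.
move=> cX cY u uC.
have [|x ux] := cX (fun n => (u n).1).
  move=> e /uC[N NP]; exists N => n m Nn Nm.
  by apply: le_trans (NP n m Nn Nm); rewrite prod_normE le_max lexx.
have [|y uy] := cY (fun n => (u n).2).
  move=> e /uC[N NP]; exists N => n m Nn Nm.
  by apply: le_trans (NP n m Nn Nm); rewrite prod_normE le_max lexx orbT.
exists (x, y); have -> : u = fun n => ((u n).1, (u n).2).
  by apply/funext => n; rewrite -surjective_pairing.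
exact: cvg_pair.
Qed.

Lemma seq_complete_rV n : seq_complete 'rV[R]_n.
Proof.
move=> u uC.
have /choice[v vP] (i : 'I_n) : exists v : R^o, (u k 0 i : R^o) @[k --> \oo] --> v.
  apply: (@complete_seq_complete _ R^o) => e /uC[N NP]; exists N => k m Nk Nm.
  by apply: le_trans (NP k m Nk Nm); have := mx_norm_coord (u k - u m) 0 i; rewrite !mxE.
exists (\row_i v i); apply/cvgrPdistC_le => e e0.
have : \forall k \near \oo, forall i, `|(u k 0 i : R^o) - v i| <= e.
  by apply: filter_forall => i; have /cvgrPdistC_le := vP i; exact.
apply: filterS => k kP; apply: mx_norm_le; first exact: ltW.
by move=> i j; rewrite ord1 !mxE; exact: kP.
Qed.

End BlinOperations.

Section HadamardChain.
Context {R : realType} {E Y : normedModType R}.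

(** Uniformity over the compact set formed by [h] and all the [hn n] lets the direction vary with
    the step. *)
Lemma hadamard_seq (g : E -> Y) (x : E) (D : 'L(E, Y)) (tn : nat -> R) (hn : nat -> E) (h : E) :
  is_hadamard g x D -> (forall n, 0 < tn n) -> tn @ \oo --> 0 -> hn @ \oo --> h ->
  forall e, 0 < e -> \forall n \near \oo,
    `|(tn n)^-1 *: (g (x + tn n *: hn n) - g x) - D (hn n)| < e.
Proof.
move=> gD tn0 tnc hnc e e0.
have K0 : ([set h] `|` range hn) !=set0 by exists h; left.
have tnr : tn @ \oo --> (0 : R)^'+.
  move=> A /near_rightP[d d0 dA].
  have /cvgrPdist_lt/(_ d d0)[N _ NP] := tnc.
  exists N => // n /= /NP; rewrite sub0r normrN gtr0_norm// => nd.
  by apply: dA; rewrite tn0 add0r.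
have H := cvg_comp _ _ tnr (gD _ (cvg_seq_compact hnc) K0).
have /H : nbhs (0%E : \bar R) [set y | (y < e%:E)%E] by apply: open_nbhs_nbhs; split; [exact: open_ereal_lt_ereal|rewrite /= lte_fin].
move=> [N _ NP]; exists N => // n /NP /=; rewrite -lte_fin; apply: le_lt_trans.
by apply: ereal_sup_ubound; exists (hn n) => //; right; exists n.
Qed.

(** By contradiction, along lengths [a k] tending to 0. The normalized lengths lie in a
    finite-dimensional cube and accumulate, so the directions [(X a - x) / S] converge along a
    subsequence. [hadamard_seq] then contradicts the violation, although nothing is assumed of [g]
    away from [x]. *)
Lemma hadamard_chain (N : nat) (X : ('I_N -> R) -> E) (x : E) (y : 'I_N -> E)
    (g : E -> Y) (D : 'L(E, Y)) :
  is_hadamard g x D ->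
  (forall e, 0 < e -> \forall d \near 0^'+, forall a, (forall i, 0 <= a i) -> \sum_i a i <= d ->
     `|X a - x - \sum_i a i *: y i| <= e * \sum_i a i) ->
  forall e, 0 < e -> \forall d \near 0^'+, forall a, (forall i, 0 <= a i) -> \sum_i a i <= d ->
     `|g (X a) - g x - \sum_i a i *: D (y i)| <= e * \sum_i a i.
Proof.
move=> gD Xy e e0; apply/near_rightP; apply: contrapT => H.
have Xy' e' : 0 < e' -> exists2 d, 0 < d & forall a, (forall i, 0 <= a i) -> \sum_i a i <= d ->
     `|X a - x - \sum_i a i *: y i| <= e' * \sum_i a i.
  move=> /Xy/near_rightP[d d0 dP]; have d2 : 0 < d / 2 by rewrite divr_gt0.
  by exists (d / 2) => //; apply: dP; rewrite d2 add0r ltr_pdivrMr// ltr_pMr// ltr1n.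
have [d1 d10 d1P] := Xy' 1 ltr01.
have /choice[a aP] (k : nat) : exists a : 'I_N -> R, [/\ forall i, 0 <= a i, \sum_i a i <= Num.min d1 k.+1%:R^-1
    & e * \sum_i a i < `|g (X a) - g x - \sum_i a i *: D (y i)|].
  apply: contrapT => nH; apply: H; exists (Num.min d1 k.+1%:R^-1).
    by rewrite lt_min d10 invr_gt0 ltr0n.
  move=> d /andP[_ dk] a a0 ad; rewrite leNgt; apply/negP => lt; apply: nH; exists a; split=> //.
  by rewrite (le_trans ad)// ltW// -[ltRHS]add0r.
pose S k := \sum_i a k i.
(* If all lengths vanished, the expansion would force [X (a k) = x], and the supposed violation
   would read [0 < 0]. *)
have S_gt0 k : 0 < S k.
  have [a0 ak lt] := aP k; rewrite lt_neqAle eq_sym sumr_ge0// andbT.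
  apply/negP => /eqP Sk; have := d1P (a k) a0; rewrite -/(S k) Sk (ltW d10) => /(_ isT).
  have ai i : a k i = 0.
    by apply/eqP; rewrite eq_le a0 andbT -Sk /S (bigD1 i)//= lerDl sumr_ge0.
  have s0 (Z : lmodType R) (w : 'I_N -> Z) : \sum_i a k i *: w i = 0.
    by rewrite big1// => i _; rewrite ai scale0r.
  rewrite s0 subr0 mulr0 normr_le0 subr_eq0 => /eqP XE.
  by move: lt; rewrite XE s0 subrr subr0 normr0 -/(S k) Sk mulr0 ltxx.
pose b k : 'rV[R]_N := \row_i (a k i / S k).
have [|b0 [_ bcl]] := @rV_compact R N (fun=> `[0, 1]%classic) (fun=> @segment_compact R _ _) (b @ \oo) _.
  exists 0%N => // k _ i /=; rewrite mxE in_itv/=; have [a0 _ _] := aP k.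
  rewrite divr_ge0 ?(ltW (S_gt0 k))//= ler_pdivrMr// mul1r.
  by rewrite /S (bigD1 i)//= lerDl sumr_ge0.
have /choice[kap kapP] (j : nat) : exists k, (j <= k)%N /\ forall i, `|b k 0 i - b0 0 i| <= j.+1%:R^-1.
  have uA : (b @ \oo) [set b k | k in [set k | (j <= k)%N]] by exists j => // k jk; exists k.
  have xB : nbhs b0 (ball b0 j.+1%:R^-1) by apply: nbhsx_ballx; rewrite invr_gt0 ltr0n.
  have [_ [[k jk <-] bk]] := bcl _ _ uA xB.
  exists k; split=> // i; move: bk; rewrite -ball_normE /= distrC => /ltW; apply: le_trans.
  by have := mx_norm_coord (b k - b0) 0 i; rewrite !mxE.
pose t j := S (kap j).
pose h j := (t j)^-1 *: (X (a (kap j)) - x).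
pose hb j := \sum_i b (kap j) 0 i *: y i.
have tS j : t j <= j.+1%:R^-1.
  have [_ + _] := aP (kap j); rewrite le_min => /andP[_ /le_trans]; apply.
  by rewrite lef_pV2 ?posrE ?ltr0n// ler_nat ltnS; case: (kapP j).
have hhb e' : 0 < e' -> \forall j \near \oo, `|h j - hb j| <= e'.
  move=> e'0; have [d' d'0 d'P] := Xy' e' e'0; have [M MP] := exists_nat_inv_le d'0.
  exists M => // j /= /MP Mj; have [a0 _ _] := aP (kap j).
  have := d'P _ a0 (le_trans (tS j) Mj); rewrite -/(S (kap j)) -/(t j) => H1.
  have -> : h j - hb j = (t j)^-1 *: (X (a (kap j)) - x - \sum_i a (kap j) i *: y i).
    rewrite scalerBr scaler_sumr; congr (_ - _); apply: eq_bigr => i _.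
    by rewrite mxE scalerA mulrC.
  by rewrite normrZ gtr0_norm ?invr_gt0 ?S_gt0// mulrC ler_pdivrMr ?S_gt0.
have hc : h @ \oo --> \sum_i b0 0 i *: y i.
  apply/cvgrPdistC_le => e' e'0; have e2 : 0 < e' / 2 by rewrite divr_gt0.
  pose Y1 := \sum_i `|y i| + 1; have Y10 : 0 < Y1 by rewrite ltr_wpDl// sumr_ge0.
  have [M MP] := exists_nat_inv_le (divr_gt0 e2 Y10).
  have : \forall j \near \oo, (M <= j)%N by exists M.
  move: (hhb _ e2); apply: filterS2 => j hj /MP Mj.
  rewrite -(subrKA (hb j)) (le_trans (ler_normD _ _))// [e']splitr lerD//.
  rewrite /hb -sumrB (le_trans (ler_norm_sum _ _ _))//.
  apply: (@le_trans _ _ (\sum_i e' / 2 / Y1 * `|y i|)).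
    apply: ler_sum => i _; rewrite -scalerBl normrZ ler_wpM2r//.
    by rewrite (le_trans _ Mj)//; case: (kapP j).
  rewrite -mulr_sumr mulrAC ler_pdivrMr// ler_wpM2l ?(ltW e2)// /Y1 lerDl//.
have tc : t @ \oo --> 0.
  apply/cvgrPdist_le => e' e'0; have [M MP] := exists_nat_inv_le e'0.
  exists M => // j /= /MP Mj; rewrite sub0r normrN gtr0_norm ?S_gt0//.
  exact: le_trans (tS j) Mj.
have e2 : 0 < e / 2 by rewrite divr_gt0.
have D1 : 0 < `|D| + 1 by rewrite ltr_wpDl.
have hs := hadamard_seq gD (fun j => S_gt0 (kap j)) tc hc e2.
have [j []] := filter_ex (filterI hs (hhb _ (divr_gt0 e2 D1))).
rewrite -/(t j) -[h j]/((t j)^-1 *: _) scalerA divff ?gt_eqF ?S_gt0// scale1r (addrC x) subrK -/(h j) => H1 H2.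
have [a0 _ lt] := aP (kap j).
have E1 : \sum_i a (kap j) i *: D (y i) = t j *: D (hb j).
  rewrite /hb linear_sum/= scaler_sumr; apply: eq_bigr => i _.
  by rewrite linearZ/= scalerA mxE mulrC divfK// gt_eqF// S_gt0.
have E2 : g (X (a (kap j))) - g x - t j *: D (hb j) =
    t j *: ((t j)^-1 *: (g (X (a (kap j))) - g x) - D (h j) + D (h j - hb j)).
  rewrite (linearB D)/= subrKA [RHS]scalerBr scalerA divff ?gt_eqF ?S_gt0// scale1r.
  by [].
move: lt; rewrite E1 E2 normrZ gtr0_norm ?S_gt0// mulrC ltr_pM2l ?S_gt0//.
apply/negP; rewrite -leNgt (le_trans (ler_normD _ _))// [e]splitr lerD//; first exact: ltW.
rewrite (le_trans (blin_ub _ _))//.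
have D2 : (`|D| + 1) * (e / 2 / (`|D| + 1)) = e / 2 by field; rewrite gt_eqF.
by rewrite -[leRHS]D2 ler_pM// lerDl.
Qed.

End HadamardChain.

(** * Needle variations of a control *)

Section NPC0Closure.
Context {R : realType}.
Implicit Types (T t s : R).

Lemma NPC0_of_cont (Y : normedModType R) T (x : R -> Y) : 0 < T ->
  {within `[0, T], continuous x} -> NPC0 T x.
Proof.
move=> T0 xc; have xcont := (cont_on_within x T0).1 xc.
apply: (@NPC0_of_cadlag _ _ _ _ [::]) => //; first exact: cont_on_cadlag.
  by apply: xcont.2; rewrite T0 lexx.
move=> t /andP[t0 tT] _; move: xc; rewrite continuous_within_itvP// => -[xi _ _].
by apply: xi; rewrite in_itv/= t0.
Qed.

Lemma NPC0_comp_within (Y Z : topologicalType) T (A : set Y) (phi : Y -> Z) (c : R -> Y) :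
  0 < T -> {within A, continuous phi} -> (forall t, 0 <= t <= T -> A (c t)) ->
  (forall t, 0 < t <= T -> exists2 y, A y & c s @[s --> t^'-] --> y) ->
  NPC0 T c -> NPC0 T (phi \o c).
Proof.
move=> T0 phic Ac Al cN; have [cr cl] := NPC0_cadlag cN.
have [D DP] := NPC0_continuous_off cN; have [_ _ cT] := cN.
have nearl t : 0 < t <= T -> \forall s \near t^'-, A (c s).
  move=> /andP[t0 tT]; near=> s; apply: Ac; apply/andP; split.
    by near: s; exact: nbhs_left_ge.
  have st : s < t by near: s; exact: nbhs_left_lt.
  by rewrite (le_trans (ltW st)).
have nearr t : 0 <= t < T -> \forall s \near t^'+, A (c s).
  move=> /andP[t0 tT]; near=> s; apply: Ac; apply/andP; split.
    have st : t < s by near: s; exact: nbhs_right_gt.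
    by rewrite (le_trans t0 (ltW st)).
  by near: s; exact: nbhs_right_le.
apply: (@NPC0_of_cadlag _ _ _ _ D) => //.
- split=> t ti; first last.
    have [y Ay cy] := Al t ti; exists (phi y).
    by apply: (within_continuous_cvg phic Ay cy); exact: nearl.
  apply: (within_continuous_cvg phic _ (cr t ti)); last exact: nearr.
  by apply: Ac; case/andP: ti => -> /ltW.
- apply: (within_continuous_cvg phic _ cT); first by apply: Ac; rewrite lexx ltW.
  by apply: nearl; rewrite T0 lexx.
- move=> t /andP[t0 tT] tD.
  apply: (within_continuous_cvg phic _ (DP t _ tD)); rewrite ?t0//.
    by apply: Ac; rewrite !ltW.
  near=> s; apply: Ac; apply/andP; split; apply: ltW; near: s.
    exact: lt_nbhsr.
  exact: lt_nbhsl.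
Unshelve. all: by end_near. Qed.

Lemma NPC0_comp (Y Z : topologicalType) T (phi : Y -> Z) (c : R -> Y) :
  0 < T -> continuous phi -> NPC0 T c -> NPC0 T (phi \o c).
Proof.
move=> T0 phic cN; apply: (@NPC0_comp_within _ _ _ setT) => //.
  exact: continuous_subspaceT.
by have [_ cl] := NPC0_cadlag cN => t /cl[y cy]; exists y.
Qed.

Lemma NPC0_pair (Y Z : topologicalType) T (u : R -> Y) (v : R -> Z) : 0 < T ->
  NPC0 T u -> NPC0 T v -> NPC0 T (fun t => (u t, v t)).
Proof.
move=> T0 uN vN; have [_ _ uT] := uN; have [_ _ vT] := vN.
have [D DP] := NPC0_continuous_off uN; have [D' D'P] := NPC0_continuous_off vN.
apply: (@NPC0_of_cadlag _ _ _ _ (D ++ D')) => //.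
- exact: cadlag_pair (NPC0_cadlag uN) (NPC0_cadlag vN).
- exact: cvg_pair.
move=> t ti; rewrite mem_cat negb_or => /andP[tD tD'].
by apply: cvg_pair; [exact: DP|exact: D'P].
Qed.

Lemma NPC0D (X : normedModType R) T (u v : R -> X) : 0 < T ->
  NPC0 T u -> NPC0 T v -> NPC0 T (fun t => u t + v t).
Proof.
move=> T0 uN vN.
apply: (NPC0_comp (phi := fun z : X * X => z.1 + z.2) T0 _ (NPC0_pair T0 uN vN)).
by move=> z; exact: add_continuous.
Qed.

Lemma NPC0Z (X : normedModType R) T (k : R) (u : R -> X) : 0 < T ->
  NPC0 T u -> NPC0 T (fun t => k *: u t).
Proof.
move=> T0; apply: (NPC0_comp (phi := fun z : X => k *: z) T0).
exact: scaler_continuous.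
Qed.

Lemma NPC0_cst (Y : topologicalType) T (y : Y) : 0 < T -> NPC0 T (fun=> y).
Proof.
move=> T0; apply: (@NPC0_of_cadlag _ _ _ _ [::]) => //.
- exact: cadlag_cst.
- exact: cvg_cst.
- by move=> *; exact: cvg_cst.
Qed.

Lemma NPC0_sum (X : normedModType R) T (I : Type) (r : seq I) (u : I -> R -> X) : 0 < T ->
  (forall i, NPC0 T (u i)) -> NPC0 T (fun t => \sum_(i <- r) u i t).
Proof.
move=> T0 uN; elim: r => [|i r ih].
  by under eq_fun do rewrite big_nil; exact: NPC0_cst.
by under eq_fun do rewrite big_cons; exact: NPC0D.
Qed.

Section Path.
Context {E : normedModType R} {U Z : topologicalType}.
Variables (T : R) (Omega : set E) (x : R -> E) (u : R -> U).
Hypotheses (T0 : 0 < T) (xc : {within `[0, T], continuous x}).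
Hypothesis xO : forall t, 0 <= t <= T -> Omega (x t).
Hypothesis uN : NPC0 T u.

Let idN : NPC0 T (fun t : R => t : R^o).
Proof. by apply: NPC0_of_cont => //; apply: continuous_subspaceT => t; exact: cvg_id. Qed.

Let left_limit t : 0 < t <= T -> exists2 z : U, True & u s @[s --> t^'-] --> z.
Proof. by have [_ ul] := NPC0_cadlag uN => /ul[z uz]; exists z. Qed.

Lemma NPC0_path_comp (phi : R * E * U -> Z) :
  {within `[0, T] `*` Omega `*` [set: U], continuous phi} ->
  NPC0 T (fun t => phi (t, x t, u t)).
Proof.
move=> phic; have xN := NPC0_of_cont T0 xc.
apply: (NPC0_comp_within T0 phic _ _ (NPC0_pair T0 (NPC0_pair T0 idN xN) uN)).
  by move=> t ti; split=> //; split; [rewrite /= in_itv|exact: xO].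
move=> t /[dup] ti /andP[t0 tT]; have [z _ uz] := left_limit ti.
exists (t, x t, z); first by split=> //; split; [rewrite /= in_itv/= ltW|apply: xO; rewrite ltW].
have tl : (s : R^o) @[s --> t^'-] --> (t : R^o) by apply: cvg_at_left_filter; exact: cvg_id.
refine (cvg_pair (cvg_pair tl _) uz).
by have [_ xl] := (cont_on_within x T0).1 xc; exact: xl.
Qed.

Lemma NPC0_time_comp (phi : R * U -> Z) :
  {within `[0, T] `*` [set: U], continuous phi} -> NPC0 T (fun t => phi (t, u t)).
Proof.
move=> phic; apply: (NPC0_comp_within T0 phic _ _ (NPC0_pair T0 idN uN)).
  by move=> t ti; split=> //=; rewrite in_itv.
move=> t /[dup] ti /andP[t0 tT]; have [z _ uz] := left_limit ti.
exists (t, z); first by split=> //=; rewrite in_itv/= ltW.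
have tl : (s : R^o) @[s --> t^'-] --> (t : R^o) by apply: cvg_at_left_filter; exact: cvg_id.
exact: cvg_pair tl uz.
Qed.

End Path.
End NPC0Closure.

Section PerturbedControl.
Context {R : realType} {U : topologicalType} {N : nat}.
Variables (T : R) (u0 : R -> U) (zeta : 'I_N -> U) (S e : 'I_N -> R).
Implicit Types (t s : R) (p : pred 'I_N).

(** Separates the set [p] of active needles from the time. On each side of a given time the active
    set is constant, so one-sided limits reduce to a fixed [p]. *)
Let select p t : U := if [pick i | p i] is Some i then zeta i else u0 t.

Definition perturbed_control t : U := select (fun i => S i <= t < e i) t.

Lemma perturbed_control_on t i : (forall j, S j <= t < e j -> j = i) ->
  S i <= t < e i -> perturbed_control t = zeta i.
Proof.
move=> uniq ti; rewrite /perturbed_control /select; case: pickP => [j /uniq ->//|/(_ i)].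
by rewrite ti.
Qed.

Lemma perturbed_control_off t : (forall i, ~~ (S i <= t < e i)) -> perturbed_control t = u0 t.
Proof.
move=> off; rewrite /perturbed_control /select; case: pickP => // i.
by rewrite (negbTE (off i)).
Qed.

Let select_cvg p (F : set_system R) {FF : Filter F} (l : U) : u0 s @[s --> F] --> l ->
  (\forall s \near F, forall i, (S i <= s < e i) = p i) ->
  perturbed_control s @[s --> F] --> if [pick i | p i] is Some i then zeta i else l.
Proof.
move=> ul near_p.
have : select p s @[s --> F] --> if [pick i | p i] is Some i then zeta i else l.
  by rewrite /select; case: pickP => // i _; exact: cvg_cst.
apply: cvg_trans; apply: near_eq_cvg; near=> s.
rewrite /perturbed_control /select; have Ep : forall i, (S i <= s < e i) = p i by near: s.
by rewrite (_ : (fun i => S i <= s < e i) = p)//; apply: funext.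
Unshelve. all: by end_near. Qed.

Let near_right t : \forall s \near t^'+, forall i, (S i <= s < e i) = (S i <= t < e i).
Proof.
apply: filter_forall => i; have := leP (S i) t; have := ltP t (e i).
case=> te [St|tS]; near=> s; have ts : t < s by near: s; exact: nbhs_right_gt.
- rewrite (le_trans St (ltW ts))/=; near: s; exact: nbhs_right_lt.
- by apply/negbTE; rewrite negb_and -ltNge; apply/orP; left; near: s; exact: nbhs_right_lt.
- by apply/negbTE; rewrite negb_and -leNgt (le_trans te (ltW ts)) orbT.
- by apply/negbTE; rewrite negb_and -leNgt (le_trans te (ltW ts)) orbT.
Unshelve. all: by end_near. Qed.

Let near_left t : \forall s \near t^'-, forall i, (S i <= s < e i) = (S i < t <= e i).
Proof.
apply: filter_forall => i; have := ltP (S i) t; have := leP t (e i).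
case=> te [St|tS]; near=> s; have ts : s < t by near: s; exact: nbhs_left_lt.
- rewrite (lt_le_trans ts te) andbT; near: s; exact: nbhs_left_ge.
- by apply/negbTE; rewrite negb_and -ltNge (lt_le_trans ts tS).
- by apply/negbTE; rewrite negb_and -leNgt; apply/orP; right; near: s; exact: nbhs_left_ge.
- by apply/negbTE; rewrite negb_and -ltNge (lt_le_trans ts tS).
Unshelve. all: by end_near. Qed.

Lemma perturbed_control_NPC0 : 0 < T -> (forall i, e i < T) -> NPC0 T u0 ->
  NPC0 T perturbed_control.
Proof.
move=> T0 eT uN; have [D DP] := NPC0_continuous_off uN.
have [ur ul] := NPC0_cadlag uN; have [_ _ uT] := uN.
have right t : 0 <= t < T -> perturbed_control s @[s --> t^'+] --> perturbed_control t.
  by move=> ti; apply: select_cvg (near_right t); exact: ur.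
apply: (@NPC0_of_cadlag _ _ _ _ (D ++ [seq S i | i <- enum 'I_N] ++ [seq e i | i <- enum 'I_N])) => //.
- split=> // t /ul[y uy]; exists (if [pick i | S i < t <= e i] is Some i then zeta i else y).
  exact: select_cvg (near_left t).
- have -> : perturbed_control T = if [pick i | S i < T <= e i] is Some i then zeta i else u0 T.
    rewrite perturbed_control_off; last by move=> i; rewrite negb_and -(leNgt _ T) (ltW (eT i)) orbT.
    by case: pickP => // i; rewrite leNgt eT andbF.
  exact: select_cvg (near_left T).
- move=> t /andP[t0 tT]; rewrite !mem_cat !negb_or => /and3P[tD tS te].
  apply/left_right_continuousP; split; last by apply: right; rewrite (ltW t0).
  have -> : perturbed_control t = if [pick i | S i < t <= e i] is Some i then zeta i else u0 t.
    rewrite /perturbed_control /select (_ : (fun i => S i <= t < e i) = (fun i => S i < t <= e i))//.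
    apply/funext => i; congr (_ && _).
      rewrite lt_neqAle; suff -> : S i != t by [].
      by apply/negP => /eqP E; move/negP: tS; apply; apply/mapP; exists i; rewrite ?mem_enum.
    rewrite lt_neqAle; suff -> : t != e i by [].
    by apply/negP => /eqP E; move/negP: te; apply; apply/mapP; exists i; rewrite ?mem_enum.
  apply: select_cvg (near_left t).
  by apply: cvg_at_left_filter; apply: DP; rewrite ?t0.
Qed.

End PerturbedControl.

Section RowVectors.
Context {R : realType}.

Lemma cvg_row n (I : Type) (F : set_system I) {FF : Filter F} (u : 'I_n -> I -> R)
    (v : 'I_n -> R) :
  (forall i, (u i s : R^o) @[s --> F] --> (v i : R^o)) ->
  (\row_i u i s) @[s --> F] --> \row_i v i.
Proof.
move=> uv; apply/cvgrPdist_le => e e0.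
have : \forall s \near F, forall i, `|(v i : R^o) - u i s| <= e.
  by apply: filter_forall => i; have /cvgrPdist_le := uv i; exact.
apply: filterS => s sP; apply: mx_norm_le; first exact: ltW.
by move=> i j; rewrite ord1 !mxE; exact: sP.
Qed.

Lemma pair_norm_le (X Y : normedModType R) (z : X * Y) M :
  `|z.1| <= M -> `|z.2| <= M -> `|z| <= M.
Proof. by move=> z1 z2; rewrite prod_normE ge_max z1. Qed.

Lemma norm_fst (X Y : normedModType R) (z : X * Y) : `|z.1| <= `|z|.
Proof. by rewrite prod_normE le_max lexx. Qed.

Lemma norm_snd (X Y : normedModType R) (z : X * Y) : `|z.2| <= `|z|.
Proof. by rewrite prod_normE le_max lexx orbT. Qed.

Lemma cont_on_fst (X Y : topologicalType) a b (z : R -> X * Y) :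
  cont_on a b z -> cont_on a b (fun t => (z t).1).
Proof.
move=> [zr zl]; split=> t ti.
  by apply: (cvg_comp _ _ (zr t ti)); exact: cvg_fst.
by apply: (cvg_comp _ _ (zl t ti)); exact: cvg_fst.
Qed.

End RowVectors.

Section ProductPrimitives.
Context {R : realType}.

Lemma right_primitive_image (X Y : normedModType R) (F : X -> Y) a b (x v : R -> X) :
  linear F -> (forall x, `|F x| <= `|x|) ->
  right_primitive a b x v -> right_primitive a b (fun t => F (x t)) (fun t => F (v t)).
Proof.
move=> linF F1 [xl xr].
have FB y y' : F (y - y') = F y - F y' by rewrite addrC -scaleN1r linF scaleN1r addrC.
have F0 : F 0 = 0 by have := FB 0 0; rewrite !subrr.
have FZ k y : F (k *: y) = k *: F y by rewrite -[k *: y]addr0 linF F0 addr0.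
split=> t ti.
  apply/cvgrPdist_le => e e0; have /cvgrPdist_le/(_ e e0) := xl t ti.
  by apply: filterS => s; apply: le_trans; rewrite -FB.
move=> e e0; apply: filterS (xr t ti e e0) => s; apply: le_trans.
by rewrite -FB -FZ -FB.
Qed.

Lemma right_primitive_fst (X Y : normedModType R) a b (z v : R -> X * Y) :
  right_primitive a b z v -> right_primitive a b (fun t => (z t).1) (fun t => (v t).1).
Proof. by apply: right_primitive_image => //; exact: norm_fst. Qed.

Lemma right_primitive_snd (X Y : normedModType R) a b (z v : R -> X * Y) :
  right_primitive a b z v -> right_primitive a b (fun t => (z t).2) (fun t => (v t).2).
Proof. by apply: right_primitive_image => //; exact: norm_snd. Qed.

Lemma right_primitive_coord n (i : 'I_n) a b (w v : R -> 'rV[R]_n) :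
  right_primitive a b w v ->
  right_primitive a b (fun t => w t 0 i : R^o) (fun t => v t 0 i : R^o).
Proof.
apply: (@right_primitive_image _ R^o (fun w : 'rV[R]_n => w 0 i)).
  by move=> k w1 w2; rewrite !mxE.
by move=> w1; exact: mx_norm_coord.
Qed.

Lemma right_primitive_pair (X Y : normedModType R) a b (x v : R -> X) (y w : R -> Y) :
  right_primitive a b x v -> right_primitive a b y w ->
  right_primitive a b (fun t => (x t, y t)) (fun t => (v t, w t)).
Proof.
move=> [xl xr] [yl yr]; split=> t ti; first by apply: cvg_pair; [exact: xl|exact: yl].
move=> e e0; apply: filterS2 (xr t ti e e0) (yr t ti e e0) => s xs ys.
exact: pair_norm_le.
Qed.

End ProductPrimitives.

Section NeedleVariation.
Context {R : realType} {E W : normedModType R} {U : topologicalType} {N : nat}.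
Variables (T : R) (Omega : set E) (phi : R -> E -> U -> E * W) (D : R -> E -> E * W).
Variables (x0 : R -> E) (w0 : R -> W) (u0 : R -> U).
Variables (tt : 'I_N -> R) (zeta : 'I_N -> U) (y : 'I_N -> R -> E * W).
Local Notation Z := (E * W)%type.
Local Notation z0 := (fun t => (x0 t, w0 t) : Z).

Hypotheses (T0 : 0 < T) (cZ : seq_complete Z).
Hypothesis phic : {within `[0, T] `*` Omega `*` [set: U],
  continuous (fun z : R * E * U => phi z.1.1 z.1.2 z.2)}.
Hypothesis phi_lip : forall M : set U, compact M -> M !=set0 ->
  exists2 r, 0 < r & exists2 K, 0 < K & forall t x z, 0 <= t <= T ->
    `|x - x0 t| <= r -> `|z - x0 t| <= r -> Omega x /\
    forall zeta, M zeta -> `|phi t x zeta - phi t z zeta| <= K * `|x - z|.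
Hypothesis D_linear : forall t, linear (D t).
Hypothesis D_bounded : exists2 K, 0 < K & forall t, 0 <= t <= T ->
  forall v, `|D t v| <= K * `|v|.
Hypothesis D_cadlag : forall v, cadlag 0 T v -> cadlag 0 T (fun t => D t (v t)).
Hypothesis phi_expansion : forall t, 0 <= t <= T -> forall e, 0 < e ->
  exists2 d, 0 < d & forall v, `|v| <= d ->
    `|phi t (x0 t + v) (u0 t) - phi t (x0 t) (u0 t) - D t v| <= e * `|v|.
Hypothesis z0P : right_primitive 0 T z0 (fun t => phi t (x0 t) (u0 t)).
Hypothesis u0N : NPC0 T u0.
Hypothesis tt_ltT : forall i, 0 <= tt i < T.
Hypothesis tt_sorted : forall i j : 'I_N, (i <= j)%N -> tt i <= tt j.
Hypothesis yP : forall i, right_primitive 0 T (y i) (fun t => D t (y i t).1).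
Hypothesis y_tt : forall i,
  y i (tt i) = phi (tt i) (x0 (tt i)) (zeta i) - phi (tt i) (x0 (tt i)) (u0 (tt i)).

Let z0cont : cont_on 0 T z0. Proof. exact: right_primitive_cont z0P. Qed.
Let x0cont : cont_on 0 T x0. Proof. exact: cont_on_fst z0cont. Qed.

(** [phi] is controlled only in a tube around [x0] inside [Omega]. Retracting the state onto the
    tube gives a globally Lipschitz field that agrees with [phi] there and equals it along [x0]. *)
Let trunc r t (xi : E) : E := x0 t + radial r (xi - x0 t).
Let field r t (xi : U) (z : Z) : Z := phi t (trunc r t z.1) xi.
Let control (a : 'I_N -> R) : R -> U :=
  perturbed_control u0 zeta (needle_start tt a) (fun i => needle_start tt a i + a i).

Let trunc_id r t xi : 0 < r -> `|xi - x0 t| <= r -> trunc r t xi = xi.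
Proof. by move=> r0 xr; rewrite /trunc radial_id// addrC subrK. Qed.

Let trunc_near r t xi : 0 < r -> `|trunc r t xi - x0 t| <= r.
Proof. by move=> r0; rewrite /trunc addrC addKr radial_le. Qed.

Let start_disjoint (a : 'I_N -> R) (i j : 'I_N) : (forall i, 0 <= a i) -> (i < j)%N ->
  needle_start tt a i + a i <= needle_start tt a j.
Proof.
move=> a0 ij; rewrite /needle_start -addrA lerD ?tt_sorted ?(ltnW ij)//.
rewrite [leRHS](bigD1 i)//= addrC lerD2l.
rewrite [leRHS](bigID (fun k : 'I_N => (k < i)%N))/=.
rewrite [X in _ <= X + _](eq_bigl (fun k : 'I_N => (k < i)%N)); first by rewrite lerDl sumr_ge0.
move=> k; rewrite andbC; case: ltnP => //= ki.
by rewrite (ltn_trans ki ij)/= -val_eqE/= neq_ltn ki.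
Qed.

Let needleE (a : 'I_N -> R) i t : (forall i, 0 <= a i) -> needle tt a i t =
  if needle_start tt a i <= t < needle_start tt a i + a i then 1 else 0.
Proof. by move=> a0; rewrite /needle pulseE. Qed.

Let start_uniq (a : 'I_N -> R) t i j : (forall i, 0 <= a i) ->
  needle_start tt a i <= t < needle_start tt a i + a i ->
  needle_start tt a j <= t < needle_start tt a j + a j -> j = i.
Proof.
move=> a0 /andP[it ti] /andP[jt tj]; case: (ltngtP i j) => [ij|ji|/val_inj//].
  by have := lt_le_trans ti (start_disjoint a0 ij); rewrite ltNge jt.
by have := lt_le_trans tj (start_disjoint a0 ji); rewrite ltNge it.
Qed.

Let rhs_control r a t z : (forall i, 0 <= a i) ->
  needle_rhs (fun t => field r t (u0 t)) (fun i t z => field r t (zeta i) z - field r t (u0 t) z)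
    tt a t z = field r t (control a t) z.
Proof.
move=> a0; rewrite /needle_rhs; under eq_bigr do rewrite needleE//.
have [/existsP[i ti]|/existsPn off] := boolP
    [exists i, needle_start tt a i <= t < needle_start tt a i + a i].
  rewrite (bigD1 i)//= ti scale1r big1 => [|j ji].
    rewrite addr0 addrC subrK; congr field; apply/esym.
    apply: (@perturbed_control_on _ _ _ _ _ (needle_start tt a) (fun i => needle_start tt a i + a i) _ _ _ ti) => j.
    exact: start_uniq a0 ti.
  case: ifP => [tj|_]; last by rewrite scale0r.
  by rewrite (start_uniq a0 ti tj) eqxx in ji.
rewrite big1 => [|i _]; last by rewrite (negbTE (off i)) scale0r.
by rewrite addr0 /control perturbed_control_off.
Qed.

Let trunc_cont r (z : R -> Z) : 0 < r -> cont_on 0 T z ->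
  {within `[0, T], continuous (fun t => trunc r t (z t).1)}.
Proof.
move=> r0 zc; apply/(cont_on_within _ T0).
have rc (F : set_system R) (FF : Filter F) (v : R -> E) w :
    v s @[s --> F] --> w -> radial r (v s) @[s --> F] --> radial r w.
  move=> vw; apply/cvgrPdist_le => e e0.
  have e2 : 0 < e / 2 by rewrite divr_gt0.
  have /cvgrPdist_le/(_ _ e2) := vw; apply: filterS => s le.
  rewrite (le_trans (radial_lip _ _ r0))//; lra.
have xc := cont_on_fst zc.
split=> t ti; apply: cvgD.
- exact: x0cont.1.
- by apply: rc; apply: cvgB; [exact: xc.1|exact: x0cont.1].
- exact: x0cont.2.
- by apply: rc; apply: cvgB; [exact: xc.2|exact: x0cont.2].
Qed.

Let field_cadlag r (z : R -> Z) u : 0 < r -> (forall t, 0 <= t <= T -> forall x, `|x - x0 t| <= r -> Omega x) ->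
  cont_on 0 T z -> NPC0 T u -> cadlag 0 T (fun t => field r t (u t) (z t)).
Proof.
move=> r0 rO zc uN; apply: NPC0_cadlag.
apply: (NPC0_path_comp T0 (trunc_cont r0 zc) _ uN phic) => t ti.
exact: rO (trunc_near _ _ r0).
Qed.

(** The [z a] solve the truncated equation, which is why the Lipschitz bound holds for all lengths.
    For small lengths they stay in the tube, where truncation is the identity, and become genuine
    trajectories of the switched control. *)
Lemma needle_variation :
  exists (z : ('I_N -> R) -> R -> Z) (u : ('I_N -> R) -> R -> U) (c : R), [/\ 0 <= c,
    forall a b, (forall i, 0 <= a i) -> (forall i, 0 <= b i) ->
      `|z a T - z b T| <= c * \sum_i `|a i - b i|,
    forall e, 0 < e -> \forall d \near 0^'+, forall a, (forall i, 0 <= a i) -> \sum_i a i <= d ->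
      `|z a T - z0 T - \sum_i a i *: y i T| <= e * \sum_i a i
  & \forall d \near 0^'+, forall a, (forall i, 0 <= a i) -> \sum_i a i <= d ->
      [/\ NPC0 T (u a), z a 0 = z0 0,
          forall t, 0 <= t <= T -> Omega (z a t).1
        & right_primitive 0 T (z a) (fun t => phi t (z a t).1 (u a t))]].
Proof.
have [M0 cM0 M0u] := NPC0_compact_range T0 u0N.
pose M := M0 `|` range zeta.
have cM : compact M.
  by apply: compactU => //; apply: finite_compact; exact: finite_image.
have Mu t : 0 <= t <= T -> M (u0 t) by move=> ti; left; exact: M0u.
have Mz i : M (zeta i) by right; exists i.
have Mne : M !=set0 by exists (u0 0); apply: Mu; rewrite lexx ltW.
have [r r0 [K1 K10 K1P]] := phi_lip cM Mne.
have [K2 K20 K2P] := D_bounded.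
(* One constant for three bounds: [2 K1] for [F], [4 K1] for [V], a difference of two truncated
   fields, and [K2] for the linearization. *)
pose K := 4 * K1 + K2.
have K0 : 0 < K by rewrite addr_gt0// mulr_gt0.
have rO t : 0 <= t <= T -> forall x, `|x - x0 t| <= r -> Omega x.
  by move=> ti x xr; have [] := K1P t x x ti xr xr.
have x0r t : `|x0 t - x0 t| <= r by rewrite subrr normr0 ltW.
have T01 t : 0 <= t < T -> 0 <= t <= T by move=> /andP[-> /ltW].
have flip t xi z z' : 0 <= t <= T -> M xi -> `|field r t xi z - field r t xi z'| <= 2 * K1 * `|z - z'|.
  move=> ti Mxi; have [_ /(_ _ Mxi) le] := K1P t _ _ ti (trunc_near t z.1 r0) (trunc_near t z'.1 r0).
  rewrite (le_trans le)// (mulrC 2) -mulrA ler_wpM2l ?(ltW K10)//.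
  rewrite /trunc opprD addrACA subrr add0r (le_trans (radial_lip _ _ r0))//.
  by rewrite ler_wpM2l// opprB addrA subrK; exact: (norm_fst (z - z')).
have [C C0 CP] : exists2 C, 0 <= C & forall i t, 0 <= t < T ->
    `|phi t (x0 t) (zeta i) - phi t (x0 t) (u0 t)| <= C.
  have /choice[C CP] i : exists C : R, forall t, 0 <= t < T ->
      `|phi t (x0 t) (zeta i) - phi t (x0 t) (u0 t)| <= C.
    have x0c' := (cont_on_within x0 T0).2 x0cont.
    have x0O t : 0 <= t <= T -> Omega (x0 t) by move=> ti; exact: rO (x0r t).
    have cphi u : NPC0 T u -> cadlag 0 T (fun t => phi t (x0 t) (u t)).
      by move=> uN; exact: NPC0_cadlag (NPC0_path_comp T0 x0c' x0O uN phic).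
    have [C _ CP] := cadlag_bounded (ltW T0) (cadlagB (cphi _ (NPC0_cst (zeta i) T0)) (cphi _ u0N)).
    by exists C.
  exists (\sum_i `|C i|); first by rewrite sumr_ge0.
  move=> i t ti; rewrite (le_trans (CP i t ti))// (le_trans (ler_norm _))//.
  by rewrite (bigD1 i)//= lerDl sumr_ge0.
pose F t z := field r t (u0 t) z.
pose V i t z := field r t (zeta i) z - field r t (u0 t) z.
have FE t : F t (z0 t) = phi t (x0 t) (u0 t) by rewrite /F /field/= trunc_id.
have z0F : right_primitive 0 T z0 (fun t => F t (z0 t)).
  by apply: right_primitive_eq z0P => t _; rewrite FE.
(* A bound for [V]: at most [C] along [x0], and each of its two fields moves by at most [K1 * r]
   inside the tube. *)
have C1 : 0 <= C + 2 * K1 * r by rewrite addr_ge0// !mulr_ge0// ltW.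
have F_cadlag z : cont_on 0 T z -> cadlag 0 T (fun t => F t (z t)).
  by move=> zc; exact: field_cadlag.
have V_cadlag i z : cont_on 0 T z -> cadlag 0 T (fun t => V i t (z t)).
  move=> zc; apply: cadlagB; first exact: (@field_cadlag r z (fun=> zeta i) r0 rO zc (NPC0_cst _ T0)).
  exact: field_cadlag.
have F_lip t : 0 <= t < T -> forall z z', `|F t z - F t z'| <= K * `|z - z'|.
  move=> /T01 ti z z'; rewrite (le_trans (flip t _ z z' ti (Mu t ti)))// ler_wpM2r// /K; lra.
have V_lip i t : 0 <= t < T -> forall z z', `|V i t z - V i t z'| <= K * `|z - z'|.
  move=> /T01 ti z z'; rewrite /V opprD addrACA -opprD (le_trans (ler_normB _ _))//.
  have := flip t _ z z' ti (Mu t ti); have := flip t _ z z' ti (Mz i).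
  have : 0 <= K2 * `|z - z'| by rewrite mulr_ge0// ltW.
  by rewrite /K; lra.
have V_bounded i t : 0 <= t < T -> forall z, `|V i t z| <= C + 2 * K1 * r.
  move=> /[dup] ti' /T01 ti z; have tr := trunc_near t z.1 r0.
  have [_ lip] := K1P t _ _ ti tr (x0r t).
  have le xi : M xi -> `|field r t xi z - phi t (x0 t) xi| <= K1 * r.
    by move=> /lip le; rewrite (le_trans le)// ler_wpM2l// ltW.
  have := CP i t ti'; have := le _ (Mz i); have := le _ (Mu t ti); rewrite /V.
  set p1 := field _ _ _ _; set p2 := phi _ _ _; set q1 := field _ _ _ _; set q2 := phi _ _ _.
  have -> : q1 - p1 = (q2 - p2) + ((q1 - q2) - (p1 - p2)).
    have -> : (q1 - q2) - (p1 - p2) = (q1 - p1) - (q2 - p2) by rewrite opprD addrACA -opprD.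
    by rewrite [RHS]addrC subrK.
  have := ler_normD (q2 - p2) ((q1 - q2) - (p1 - p2)).
  have := ler_normB (q1 - q2) (p1 - p2); lra.
have tt_ge0 i : 0 <= tt i by have /andP[] := tt_ltT i.
have tt_lt i : tt i < T by have /andP[] := tt_ltT i.
pose A t (z : Z) := D t z.1.
have A_lin t : linear (A t) by move=> k v w; rewrite /A D_linear.
have A_bd t : 0 <= t < T -> forall v, `|A t v| <= K * `|v|.
  move=> /T01 ti v; rewrite (le_trans (K2P t ti _))//.
  rewrite ler_pM ?(ltW K20) ?norm_fst// /K; lra.
have A_cadlag z : cont_on 0 T z -> cadlag 0 T (fun t => A t (z t)).
  by move=> zc; apply: D_cadlag; exact: cont_on_cadlag (cont_on_fst zc).
have F_fr t : 0 <= t < T -> forall e, 0 < e -> exists2 d, 0 < d & forall v, `|v| <= d ->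
    `|F t (z0 t + v) - F t (z0 t) - A t v| <= e * `|v|.
  move=> /T01 ti e e0; have [d d0 dP] := phi_expansion ti e0.
  exists (Num.min d r); first by rewrite lt_min d0.
  move=> v; rewrite le_min => /andP[vd vr].
  have v1d := le_trans (norm_fst v) vd; have v1r := le_trans (norm_fst v) vr.
  rewrite FE /F /field trunc_id//=; last by rewrite addrAC subrr add0r.
  by rewrite (le_trans (dP _ v1d))// ler_wpM2l ?(ltW e0) ?norm_fst.
have y_ttV i : y i (tt i) = V i (tt i) (z0 (tt i)).
  by rewrite y_tt /V /field/= trunc_id.
have /choice[z zP] a : exists z, (forall i, 0 <= a i) ->
    right_primitive 0 T z (fun t => needle_rhs F V tt a t (z t)) /\ z 0 = z0 0.
  have [a0|na] := pselect (forall i, 0 <= a i); last by exists z0.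
  by have [z zP z00] := needle_trajectory_exists z0 tt cZ T0 K0 F_cadlag V_cadlag F_lip V_lip a0; exists z.
pose c := needle_constant (N := N) T K (C + 2 * K1 * r).
have c0 : 0 <= c by rewrite /c /needle_constant mulr_ge0 ?expR_ge0// mulr_ge0// addr_ge0// mulr_ge0.
exists z, control, c; split=> //.
- move=> a b a0 b0; have [za za0] := zP a a0; have [zb zb0] := zP b b0.
  exact: (@needle_trajectory_lipschitz _ _ _ _ _ _ z0 _ _ _ T0 K0 C1 F_lip V_lip V_bounded
    _ _ _ _ a0 b0 za za0 zb zb0).
- move=> e e0.
  have := needle_trajectory_differential T0 K0 C1 tt_ge0 F_cadlag V_cadlag F_lip V_lip V_bounded z0F
    tt_lt A_lin A_bd A_cadlag F_fr yP y_ttV e0.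
  apply: filterS => d dP a a0 ad; have [za za0] := zP a a0; exact: dP.
have near_end i : \forall d \near 0^'+, tt i + d < T.
  by near=> d; rewrite -ltrBrDl; near: d; apply: nbhs_right_lt; rewrite subr_gt0.
have c1 : 0 < c + 1 by rewrite ltr_wpDl.
near=> d; have dr : d <= r / (c + 1) by near: d; apply: nbhs_right_le; rewrite divr_gt0.
have dT : forall i, tt i + d < T by near: d; exact: filter_forall.
move=> a a0 ad; have [za za0] := zP a a0.
have tube t : 0 <= t <= T -> `|(z a t).1 - x0 t| <= r.
  move=> ti.
  have := needle_trajectory_dist K0 C1 tt_ge0 F_lip V_bounded z0F a0 za za0 ti.
  move=> /(le_trans (norm_fst _)) le; apply: le_trans le _.
  have : (c + 1) * \sum_i a i <= r by rewrite mulrC -ler_pdivlMr// (le_trans ad).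
  have : 0 <= \sum_i a i by rewrite sumr_ge0.
  by rewrite -/c; lra.
have ends i : needle_start tt a i + a i < T.
  rewrite (le_lt_trans _ (dT i))// /needle_start -addrA lerD2l (le_trans _ ad)//.
  rewrite [leRHS](bigID (fun k : 'I_N => (k < i)%N))/= lerD2l.
  by rewrite (bigD1 i) ?ltnn//= lerDl sumr_ge0.
split=> //.
- exact: perturbed_control_NPC0.
- by move=> t ti; apply: rO (tube t ti).
apply: right_primitive_eq za => t /T01 ti.
by rewrite rhs_control// /field trunc_id ?tube.
Unshelve. all: by end_near. Qed.

End NeedleVariation.

(** * The Pontryagin rule *)

Section PontryaginRule.
Context {R : realType} {E : completeNormedModType R} {U : topologicalType}.
Context {l m q : nat}.
Variables (T : R) (Omega : set E) (xi0 : E).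
Variables (f : R -> E -> U -> E) (f0 : 'I_l -> R -> E -> U -> R).
Variables (g0 : 'I_l -> E -> R) (g : 'I_m -> E -> R) (h : 'I_q -> E -> R).
Variables (x0 : R -> E) (u0 : R -> U).
Local Notation Z := (E * 'rV[R]_l)%type.

(* The running costs are adjoined to the state as additional coordinates. *)
Definition dyn t xi zeta : Z := (f t xi zeta, \row_i f0 i t xi zeta).

Definition dyn_diff t zeta (v : E) : Z :=
  (DF (fun y => f t y zeta) (x0 t) v,
   \row_i DF (fun y => f0 i t y zeta : R^o) (x0 t) v).

Hypotheses (T0 : 0 < T) (Omega_open : open Omega).
Hypothesis l_gt0 : (0 < l)%N.
Hypothesis x0u0_pareto : pareto_optimal T Omega xi0 f f0 g0 g h x0 u0.
Hypothesis hyp_a : forall i,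
    [/\ {within `[0, T] `*` Omega `*` [set: U],
          continuous (fun z : R * E * U => f0 i z.1.1 z.1.2 z.2)},
        (forall (t : R) xi zeta, t \in `[0, T] -> Omega xi ->
           gateaux_differentiable (fun y => f0 i t y zeta : R^o) xi),
        (forall (t : R) zeta, t \in `[0, T] ->
           differentiable (fun y => f0 i t y zeta : R^o) (x0 t))
      & {within `[0, T] `*` [set: U], continuous (fun z : R * U =>
          DF (fun y => f0 i z.1 y z.2 : R^o) (x0 z.1))}].
Hypothesis hyp_b : forall i (K : set E) (M : set U),
    K `<=` Omega -> K !=set0 -> compact K -> M !=set0 -> compact M ->
    (ereal_sup [set (`|DG (fun y => f0 i z.1.1 y z.2 : R^o) z.1.2|%R)%:E
               | z in (`[0, T] `*` K `*` M : set (R * E * U))%R] < +oo)%E.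
Hypothesis hyp_c :
    [/\ {within `[0, T] `*` Omega `*` [set: U],
          continuous (fun z : R * E * U => f z.1.1 z.1.2 z.2)},
        (forall (t : R) xi zeta, t \in `[0, T] -> Omega xi ->
           gateaux_differentiable (fun y => f t y zeta) xi),
        (forall (t : R) zeta, t \in `[0, T] ->
           differentiable (fun y => f t y zeta) (x0 t))
      & {within `[0, T] `*` [set: U], continuous (fun z : R * U =>
          DF (fun y => f z.1 y z.2) (x0 z.1))}].
Hypothesis hyp_d : forall (K : set E) (M : set U),
    K `<=` Omega -> K !=set0 -> compact K -> M !=set0 -> compact M ->
    (ereal_sup [set (`|DG (fun y => f z.1.1 y z.2) z.1.2|%R)%:E
               | z in (`[0, T] `*` K `*` M : set (R * E * U))%R] < +oo)%E.

Hypothesis hyp_e :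
  (forall i, hadamard_differentiable (g0 i : E -> R^o) (x0 T)) /\
  (forall a, hadamard_differentiable (g a : E -> R^o) (x0 T)).
Hypothesis hyp_f : forall b,
  (exists2 V, nbhs (x0 T) V & {within V, continuous (h b)}) /\
  hadamard_differentiable (h b : E -> R^o) (x0 T).

Let x0c : {within `[0, T], continuous x0}.
Proof. by have [[[[[s [_ ? _ _]] _] _] _ _ _ _] _] := x0u0_pareto. Qed.

Let x0O t : 0 <= t <= T -> Omega (x0 t).
Proof.
have [[[[_ xO] _] _ _ _ _] _] := x0u0_pareto => ti; apply: xO.
by exists t => //=; rewrite in_itv.
Qed.

Let u0N : NPC0 T u0.
Proof. by have [[[_ ?] _ _ _ _] _] := x0u0_pareto. Qed.

Let x0P : right_primitive 0 T x0 (fun t => f t (x0 t) (u0 t)).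
Proof.
have [[[[xP _] _] xf _ _ _] _] := x0u0_pareto.
by apply: PC1_right_primitive => // t ti; apply: xf; rewrite in_itv.
Qed.

Let real_bound (A : Type) (D : set A) (n : A -> R) :
  (ereal_sup [set (n z)%:E | z in D] < +oo)%E -> exists B, forall z, D z -> n z <= B.
Proof.
move=> lt; have [[z0 Dz0]|nD] := pselect (D !=set0); last first.
  by exists 0 => z Dz; case: nD; exists z.
have ub z : D z -> ((n z)%:E <= ereal_sup [set (n z)%:E | z in D])%E.
  by move=> Dz; apply: ereal_sup_ubound; exists z.
move: lt ub; case: ereal_sup => [B _ ub|//|_ ub]; last by have := ub _ Dz0.
by exists B => z /ub; rewrite lee_fin.
Qed.

Lemma dyn_continuous : {within `[0, T] `*` Omega `*` [set: U],
  continuous (fun z : R * E * U => dyn z.1.1 z.1.2 z.2)}.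
Proof.
have [fc _ _ _] := hyp_c; apply/subspace_continuousP => z Dz.
move/subspace_continuousP : fc => /(_ z Dz) fz.
pose F := within (`[0, T] `*` Omega `*` [set: U]) (nbhs z).
suff gz : (\row_i f0 i w.1.1 w.1.2 w.2) @[w --> F] --> \row_i f0 i z.1.1 z.1.2 z.2.
  exact: (cvg_pair fz gz).
apply: cvg_row => i; have [f0c _ _ _] := hyp_a i.
by move/subspace_continuousP : f0c => /(_ z Dz).
Qed.

(** The sum of all Gâteaux norms is bounded in one tube. The ball around [x0 t] is convex, so the
    mean value inequality applies along the segment from [z] to [x], componentwise. *)
Lemma dyn_lipschitz (M : set U) : compact M -> M !=set0 ->
  exists2 r, 0 < r & exists2 K, 0 < K & forall t x z, 0 <= t <= T ->
    `|x - x0 t| <= r -> `|z - x0 t| <= r -> Omega x /\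
    forall zeta, M zeta -> `|dyn t x zeta - dyn t z zeta| <= K * `|x - z|.
Proof.
move=> cM M0.
pose Phi0 i t y (zeta : U) : R := `|DG (fun y => f0 i t y zeta : R^o) y|.
pose Phi1 t y (zeta : U) : R := `|DG (fun y => f t y zeta) y|.
have [|r r0 [B BP]] := @tube_bound _ _ _ T Omega x0 M
    (fun t y zeta => Phi1 t y zeta + \sum_i Phi0 i t y zeta) Omega_open x0c x0O.
  move=> K KO K0 cK; have [B BP] := real_bound (hyp_d KO K0 cK M0 cM).
  have /choice[b bP] i := real_bound (@hyp_b i _ _ KO K0 cK M0 cM).
  exists (B + \sum_i b i) => t x zeta ti Kx Mz; apply: lerD.
    by apply: (BP (t, x, zeta)); split=> //; split=> //=; rewrite in_itv.
  by apply: ler_sum => i _; apply: (bP i (t, x, zeta)); split=> //; split=> //=; rewrite in_itv.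
exists r => //; exists (`|B| + 1); first by rewrite ltr_wpDl.
move=> t x z ti xr zr; split; first by have [] := BP t x ti xr.
move=> zeta Mz.
have seg s : 0 <= s <= 1 -> `|z + s *: (x - z) - x0 t| <= r.
  move=> /andP[s0 s1]; rewrite (_ : _ - _ = (1 - s) *: (z - x0 t) + s *: (x - x0 t)).
    rewrite (le_trans (ler_normD _ _))// !normrZ !ger0_norm ?subr_ge0//.
    rewrite -[leRHS]mul1r -[X in X * r](subrK s) [leRHS]mulrDl.
    by rewrite lerD// ler_wpM2l// subr_ge0.
  rewrite [(1 - s) *: _]scalerBl scale1r -[RHS]addrA (addrC (- _)) -scalerBr.
  have -> : x - x0 t - (z - x0 t) = x - z by rewrite opprB addrA subrK.
  exact: addrAC.
have Phi1_ge0 t' y : 0 <= Phi1 t' y zeta by exact: normr_ge0.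
have Phi0_ge0 i t' y : 0 <= Phi0 i t' y zeta by exact: normr_ge0.
have leB s : 0 <= s <= 1 -> Phi1 t (z + s *: (x - z)) zeta + \sum_i Phi0 i t (z + s *: (x - z)) zeta <= `|B| + 1.
  move=> /seg /(BP t _ ti)[_ /(_ _ Mz)] le; rewrite (le_trans le)// (le_trans (ler_norm B))//.
  by rewrite lerDl.
have [_ fG _ _] := hyp_c.
have K0 : 0 <= (`|B| + 1) * `|x - z| by rewrite mulr_ge0// addr_ge0.
apply: pair_norm_le => /=.
  apply: (@gateaux_mean_value _ E E (fun y => f t y zeta)) => s /[dup] s01 /leB le; split.
    by apply: fG => //; have [] := BP t _ ti (seg _ s01).
  by rewrite (le_trans _ le)// lerDl sumr_ge0.
apply: mx_norm_le => // a i; rewrite ord1 !mxE.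
have [_ gG _ _] := hyp_a i.
apply: (@gateaux_mean_value _ E R^o (fun y => f0 i t y zeta)) => s /[dup] s01 /leB le; split.
  by apply: gG => //; have [] := BP t _ ti (seg _ s01).
rewrite (le_trans _ le)// (bigD1 i)//= addrCA lerDl addr_ge0 ?sumr_ge0//.
Qed.

Lemma dyn_diff_linear t zeta : linear (dyn_diff t zeta).
Proof.
move=> k v w; rewrite /dyn_diff linearP; congr (_, _).
by apply/rowP => i; rewrite !mxE linearP.
Qed.

Lemma dyn_expansion t zeta : 0 <= t <= T -> forall e, 0 < e ->
  exists2 d, 0 < d & forall v, `|v| <= d ->
    `|dyn t (x0 t + v) zeta - dyn t (x0 t) zeta - dyn_diff t zeta v| <= e * `|v|.
Proof.
move=> ti e e0; have tI : t \in `[0, T] by rewrite in_itv.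
have [_ _ fF _] := hyp_c; have [d d0 dP] := frechet_expansion (fF t zeta tI) e0.
have /choice[b bP] i : exists b : R, 0 < b /\ forall v, `|v| <= b ->
    `|(f0 i t (x0 t + v) zeta : R^o) - f0 i t (x0 t) zeta
       - DF (fun y => f0 i t y zeta : R^o) (x0 t) v| <= e * `|v|.
  have [_ _ gF _] := hyp_a i.
  by have [b b0 bP] := frechet_expansion (gF t zeta tI) e0; exists b.
exists (\big[Num.min/d]_i b i).
  by elim/big_ind : _ => // [a c a0 c0|i _]; [rewrite lt_min a0|case: (bP i)].
move=> v vd; apply: pair_norm_le => /=.
  by apply: dP; rewrite (le_trans vd)// bigmin_le_id.
apply: mx_norm_le => [|a i]; first by rewrite mulr_ge0// ltW.
by rewrite ord1 !mxE; case: (bP i) => _; apply; rewrite (le_trans vd)// bigmin_le.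
Qed.

(** A Lipschitz constant near [x0 t] bounds the Fréchet differential there, and it is uniform in [t]
    because [u0] has values in a compact set. *)
Lemma dyn_diff_bounded : exists2 K, 0 < K & forall t, 0 <= t <= T ->
  forall v, `|dyn_diff t (u0 t) v| <= K * `|v|.
Proof.
have [M cM Mu] := NPC0_compact_range T0 u0N.
have M0 : M !=set0 by exists (u0 0); apply: Mu; rewrite lexx ltW.
have [r r0 [K K0 KP]] := dyn_lipschitz cM M0; exists K => // t ti v.
have tI : t \in `[0, T] by rewrite in_itv.
have lip w : `|w| <= r -> `|dyn t (x0 t + w) (u0 t) - dyn t (x0 t) (u0 t)| <= K * `|w|.
  move=> wr; have [||_ /(_ _ (Mu t ti))] := KP t (x0 t + w) (x0 t) ti; rewrite ?subrr ?normr0 ?(ltW r0)// addrAC subrr add0r//.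
have [_ _ fF _] := hyp_c; apply: pair_norm_le => /=.
  apply: (DF_lipschitz (fF t _ tI) r0) => w /lip; apply: le_trans.
  exact: (norm_fst (dyn t (x0 t + w) (u0 t) - dyn t (x0 t) (u0 t))).
apply: mx_norm_le => [|a i]; first by rewrite mulr_ge0// ltW.
rewrite !mxE; have [_ _ gF _] := hyp_a i.
apply: (DF_lipschitz (gF t _ tI) r0) => w /lip; apply: le_trans.
apply: le_trans (norm_snd (dyn t (x0 t + w) (u0 t) - dyn t (x0 t) (u0 t))).
by have := mx_norm_coord (dyn t (x0 t + w) (u0 t) - dyn t (x0 t) (u0 t)).2 0 i; rewrite !mxE.
Qed.

Let cadlag_row (u : 'I_l -> R -> R) :
  (forall i, cadlag 0 T (u i : R -> R^o)) -> cadlag 0 T (fun t => \row_i u i t).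
Proof.
move=> uc; split=> t ti; first by apply: cvg_row => i; exact: (uc i).1.
have /choice[v vP] i := (uc i).2 t ti.
by exists (\row_i v i); exact: cvg_row.
Qed.

Let cadlag_eval (Y : normedModType R) (D : R -> 'L(E, Y)) (v : R -> E) :
  cadlag 0 T D -> cadlag 0 T v -> cadlag 0 T (fun t => D t (v t)).
Proof.
move=> cD cv; apply: (cadlag_comp (phi := fun z : 'L(E, Y) * E => z.1 z.2)) (cadlag_pair cD cv).
move=> z; apply: (@cvg_bilinear _ _ _ _ (fun (D : 'L(E, Y)) v => D v) 1) => //.
- by move=> D' v1 v2; rewrite linearB.
- by move=> D' v'; rewrite mul1r blin_ub.
- exact: cvg_fst.
- exact: cvg_snd.
Qed.

Lemma dyn_diff_cadlag v : cadlag 0 T v -> cadlag 0 T (fun t => dyn_diff t (u0 t) (v t)).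
Proof.
move=> cv; have [_ _ _ Dc] := hyp_c; apply: cadlag_pair.
  by apply: cadlag_eval => //; exact: NPC0_cadlag (NPC0_time_comp T0 u0N Dc).
apply: cadlag_row => i; have [_ _ _ D0c] := hyp_a i.
apply: (@cadlag_eval R^o) => //.
exact: NPC0_cadlag (NPC0_time_comp T0 u0N D0c).
Qed.

Let seq_complete_Z : seq_complete Z.
Proof. by apply: seq_complete_prod; [exact: complete_seq_complete|exact: seq_complete_rV]. Qed.

Lemma linearized_exists s z : 0 <= s <= T ->
  exists2 y : R -> Z, right_primitive 0 T y (fun t => dyn_diff t (u0 t) (y t).1) & y s = z.
Proof.
move=> si; have [K K0 KP] := dyn_diff_bounded.
apply: (@initial_value_problem _ _ 0 T s K (fun t (z : Z) => dyn_diff t (u0 t) z.1)) => //.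
  by move=> y yc; apply: dyn_diff_cadlag; exact: cont_on_cadlag (cont_on_fst yc).
move=> t /andP[t0 tT] y y'.
rewrite -[_ - _]addrC -scaleN1r -dyn_diff_linear scaleN1r addrC.
have ti : 0 <= t <= T by rewrite t0 ltW.
by rewrite (le_trans (KP t ti _))// ler_wpM2l ?(ltW K0)//; exact: (norm_fst (y - y')).
Qed.

Local Notation phi := dyn.

Let fst_sum N (a : 'I_N -> R) (y : 'I_N -> Z) : (\sum_i a i *: y i).1 = \sum_i a i *: (y i).1.
Proof. exact: (big_morph fst (fun z z' : Z => erefl (z + z').1) erefl). Qed.

Let snd_sum N (a : 'I_N -> R) (y : 'I_N -> Z) k : (\sum_i a i *: y i).2 0 k = \sum_i a i * (y i).2 0 k.
Proof.
rewrite (big_morph (fun z : Z => z.2 0 k) (id1 := 0) (op1 := +%R)) ?mxE//; last by move=> z z'; rewrite mxE.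
by apply: eq_bigr => i _; rewrite mxE.
Qed.

Lemma state_cost_exists : exists2 w0 : R -> 'rV[R]_l,
  right_primitive 0 T (fun t => (x0 t, w0 t) : Z) (fun t => phi t (x0 t) (u0 t)) & w0 0 = 0.
Proof.
have rN := NPC0_path_comp T0 x0c x0O u0N dyn_continuous.
have [z zP] := exists_right_primitive seq_complete_Z (ltW T0) (NPC0_cadlag rN).
exists (fun t => (z t).2 - (z 0).2); last by rewrite subrr.
apply: right_primitive_pair => //.
apply: right_primitive_eq (right_primitiveB (right_primitive_snd zP) (right_primitive_cst _ _ (z 0).2)).
by move=> t _; rewrite subr0.
Qed.

Section Trajectory.
Variables (z : R -> Z) (u : R -> U).
Hypotheses (uN : NPC0 T u) (zO : forall t, 0 <= t <= T -> Omega (z t).1).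
Hypothesis zP : right_primitive 0 T z (fun t => phi t (z t).1 (u t)).
Hypothesis z0 : z 0 = (xi0, 0).

Let zc : {within `[0, T], continuous (fun t => (z t).1)}.
Proof. by apply/(cont_on_within _ T0); exact: cont_on_fst (right_primitive_cont zP). Qed.

Lemma trajectory_admissible : (forall a, 0 <= g a (z T).1) -> (forall b, h b (z T).1 = 0) ->
  admissible T Omega xi0 f g h (fun t => (z t).1) u.
Proof.
move=> ga hb; have [fc _ _ _] := hyp_c.
have fN := NPC0_path_comp T0 zc zO uN fc.
have [PC1z dz] := right_primitive_PC1 T0 (right_primitive_fst zP) fN.
split; [ | | by rewrite z0 | exact: ga | exact: hb].
  by split=> //; split=> // _ [t + <-]; rewrite /= in_itv; exact: zO.
by move=> t; rewrite in_itv => /dz.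
Qed.

Lemma trajectory_objective i :
  bolza_objective T f0 g0 i (fun t => (z t).1) u = g0 i (z T).1 + (z T).2 0 i.
Proof.
have [f0c _ _ _] := hyp_a i.
have f0N := NPC0_path_comp (Z := R^o) T0 zc zO uN f0c.
rewrite /bolza_objective (cadlag_integral_cc (G := fun t => (z t).2 0 i) (ltW T0)).
- by rewrite z0 mxE subr0.
- exact: NPC0_cadlag f0N.
have := right_primitive_coord i (right_primitive_snd zP).
by apply: right_primitive_eq => t _ /=; rewrite mxE.
Qed.

End Trajectory.

Let J := ('I_l + 'I_m)%type.

(* An inactive inequality constraint only has to stay satisfied; giving it the
   constant derivative [1] forces its multiplier to vanish. *)
Definition first_order (v : Z) (k : J) : R := match k with
  | inl i => DH (g0 i : E -> R^o) (x0 T) v.1 + v.2 0 i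
  | inr a => if g a (x0 T) == 0 then DH (g a : E -> R^o) (x0 T) v.1 else 1
  end.

Definition equality_order (v : Z) (b : 'I_q) : R := DH (h b : E -> R^o) (x0 T) v.1.

Lemma continuous_near_constraints : \forall x \near x0 T, forall b e, 0 < e ->
  \forall x' \near x, `|h b x' - h b x| <= e.
Proof.
have /choice[V VP] b : exists V, nbhs (x0 T) V /\ {within V, continuous (h b)}.
  by have [[V VT hV] _] := hyp_f b; exists V.
have : \forall x \near x0 T, forall b, nbhs x (V b).
  by apply: filter_forall => b; apply: nbhs_interior; case: (VP b).
apply: filterS => x xV b e e0; have [_ /subspace_continuousP hc] := VP b.
have /cvgrPdist_le/(_ e e0) := hc x (nbhs_singleton (xV b)).
rewrite near_withinE => H; apply: filterS2 H (xV b) => x' + Vx'.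
by move=> /(_ Vx'); rewrite distrC.
Qed.

(** Needles with these first-order images give, through [feasible_improvement], an admissible
    trajectory on which every objective is strictly larger, contradicting Pareto optimality. *)
Lemma no_improving_needles N (r tt : 'I_N -> R) (zeta : 'I_N -> U) (y : 'I_N -> R -> Z)
    (om : 'I_N -> direction) :
  (forall i, 0 <= tt i < T) -> (forall i j : 'I_N, (i <= j)%N -> tt i <= tt j) ->
  (forall i, right_primitive 0 T (y i) (fun t => dyn_diff t (u0 t) (y i t).1)) ->
  (forall i, y i (tt i) =
    phi (tt i) (x0 (tt i)) (zeta i) - phi (tt i) (x0 (tt i)) (u0 (tt i))) ->
  (forall i, 0 <= r i) ->
  (forall w k, 1 <= \sum_(i | om i == w) r i * first_order (y i T) k) ->
  (forall w b, `|\sum_(i | om i == w) r i * equality_order (y i T) b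
    - direction_target w b| <= (4 * (q%:R + 1))^-1) ->
  False.
Proof.
move=> tt_lt tt_sorted yP y_tt r0 first eqn.
have [w0 z0P w00] := state_cost_exists.
have [z [u [c [c0 zlip zexp zadm]]]] := needle_variation T0 seq_complete_Z dyn_continuous
  dyn_lipschitz (fun t => dyn_diff_linear t (u0 t)) dyn_diff_bounded dyn_diff_cadlag
  (fun t ti => dyn_expansion (u0 t) ti) z0P u0N tt_lt tt_sorted yP y_tt.
have [g0H gH] := hyp_e; have hH b := (hyp_f b).2.
have xexp e : 0 < e -> \forall d \near 0^'+, forall a, (forall i, 0 <= a i) -> \sum_i a i <= d ->
    `|(z a T).1 - x0 T - \sum_i a i *: (y i T).1| <= e * \sum_i a i.
  move=> /zexp; apply: filterS => d dP a a0 ad; apply: le_trans (dP a a0 ad).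
  by rewrite -fst_sum; exact: (norm_fst (z a T - (x0 T, w0 T) - \sum_i a i *: y i T)).
have wexp e : 0 < e -> \forall d \near 0^'+, forall a, (forall i, 0 <= a i) -> \sum_i a i <= d ->
    forall k, `|(z a T).2 0 k - w0 T 0 k - \sum_i a i * (y i T).2 0 k| <= e * \sum_i a i.
  move=> /zexp; apply: filterS => d dP a a0 ad k; apply: le_trans (dP a a0 ad).
  apply: le_trans (norm_snd (z a T - (x0 T, w0 T) - \sum_i a i *: y i T)).
  have := mx_norm_coord (z a T - (x0 T, w0 T) - \sum_i a i *: y i T).2 0 k.
  by rewrite !mxE snd_sum.
have hexp (k : E -> R) : hadamard_differentiable (k : E -> R^o) (x0 T) ->
    forall e, 0 < e -> \forall d \near 0^'+, forall a, (forall i, 0 <= a i) -> \sum_i a i <= d ->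
    `|k (z a T).1 - k (x0 T) - \sum_i a i * DH (k : E -> R^o) (x0 T) (y i T).1| <= e * \sum_i a i.
  by move=> kH; exact: (hadamard_chain (DHP kH) xexp).
(* For an inactive constraint [P] is the total length, in accordance with its conventional
   derivative 1; that the constraint still holds comes from [gnear]. *)
pose P (a : 'I_N -> R) (k : J) : R := match k with
  | inl i => (g0 i (z a T).1 - g0 i (x0 T)) + ((z a T).2 0 i - w0 T 0 i)
  | inr b => if g b (x0 T) == 0 then g b (z a T).1 - g b (x0 T) else \sum_i a i
  end.
pose H (a : 'I_N -> R) b : R := h b (z a T).1.
have hT b : h b (x0 T) = 0 by have [[_ _ _ _ ->] _] := x0u0_pareto.
have gT b : 0 <= g b (x0 T) by have [[_ _ _ ->] _] := x0u0_pareto.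
have Pexp e : 0 < e -> \forall d \near 0^'+, forall a, (forall i, 0 <= a i) -> \sum_i a i <= d ->
    forall k, `|P a k - \sum_i a i * first_order (y i T) k| <= e * \sum_i a i.
  move=> e0; have e2 : 0 < e / 2 by rewrite divr_gt0.
  have : \forall d \near 0^'+, forall k, forall a, (forall i, 0 <= a i) -> \sum_i a i <= d ->
      `|P a k - \sum_i a i * first_order (y i T) k| <= e * \sum_i a i.
    apply: filter_forall => -[i|b]; rewrite /P /first_order.
      apply: filterS2 (hexp _ (g0H i) _ e2) (wexp _ e2) => d d1 d2 a a0 ad.
      have := d1 a a0 ad; have := d2 a a0 ad i.
      under [X in _ -> _ -> `|_ - X| <= _]eq_bigr do rewrite mulrDr.
      rewrite big_split/= opprD addrACA => A B.
      rewrite (le_trans (ler_normD _ _))//; lra.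
    case: (g b (x0 T) == 0); first exact: hexp.
    near=> d => a a0 ad; rewrite -mulr_suml mulr1.
    by rewrite subrr normr0 mulr_ge0 ?(ltW e0) ?sumr_ge0.
  by apply: filterS => d dP a a0 ad k; exact: dP.
have Hexp e : 0 < e -> \forall d \near 0^'+, forall a, (forall i, 0 <= a i) -> \sum_i a i <= d ->
    forall b, `|H a b - \sum_i a i * equality_order (y i T) b| <= e * \sum_i a i.
  move=> e0; have : \forall d \near 0^'+, forall b a, (forall i, 0 <= a i) -> \sum_i a i <= d ->
      `|H a b - \sum_i a i * equality_order (y i T) b| <= e * \sum_i a i.
    by apply: filter_forall => b; apply: filterS (hexp _ (hH b) e e0) => d dP a a0 /(dP a a0); rewrite hT subr0.
  by apply: filterS => d dP a a0 ad b; exact: dP.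
have xT : exists2 c', 0 < c' & \forall d \near 0^'+, forall a, (forall i, 0 <= a i) -> \sum_i a i <= d ->
    `|(z a T).1 - x0 T| <= c' * \sum_i a i.
  exists (1 + \sum_i `|(y i T).1|); first by rewrite ltr_pwDl// sumr_ge0.
  apply: filterS (xexp 1 ltr01) => d dP a a0 ad; have := dP a a0 ad; set v := _ - x0 T => le.
  rewrite -(subrK (\sum_i a i *: (y i T).1) v) (le_trans (ler_normD _ _))// mulrDl lerD//.
  rewrite (le_trans (ler_norm_sum _ _ _))// mulr_suml ler_sum// => i _.
  rewrite normrZ ger0_norm// mulrC ler_wpM2l//.
  by rewrite (bigD1 i)//= lerDl sumr_ge0.
have xTnear (Q : set E) : nbhs (x0 T) Q -> \forall d \near 0^'+,
    forall a, (forall i, 0 <= a i) -> \sum_i a i <= d -> Q (z a T).1.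
  move=> /nbhs_ballP[e /= e0 eQ]; have [c' c'0 c'P] := xT.
  near=> d => a a0 ad; apply: eQ; rewrite -ball_normE/= distrC.
  have /(_ a a0 ad) le : forall a, (forall i, 0 <= a i) -> \sum_i a i <= d ->
    `|(z a T).1 - x0 T| <= c' * \sum_i a i by near: d.
  rewrite (le_lt_trans le)// mulrC -ltr_pdivlMr// (le_lt_trans ad)//.
  by near: d; apply: nbhs_right_lt; rewrite divr_gt0.
have Hcont : \forall d \near 0^'+, forall a, (forall i, 0 <= a i) -> \sum_i a i <= d ->
    forall e, 0 < e -> exists2 d', 0 < d' & forall b, (forall i, 0 <= b i) -> \sum_i b i <= d ->
    \sum_i `|b i - a i| <= d' -> forall j, `|H b j - H a j| <= e.
  apply: filterS (xTnear _ continuous_near_constraints) => d dP a a0 ad e e0.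
  have : \forall x' \near (z a T).1, forall j, `|h j x' - h j (z a T).1| <= e.
    by apply: filter_forall => j; exact: dP.
  move=> /nbhs_ballP[rho /= rho0 rhoP]; exists (rho / (c + 1) / 2).
    by rewrite !divr_gt0// ltr_wpDl.
  move=> b b0 bd ba j; apply: rhoP; rewrite -ball_normE/= distrC.
  apply: le_lt_trans (norm_fst (z b T - z a T)) _; apply: le_lt_trans (zlip b a b0 a0) _.
  have c1 : 0 < c + 1 by rewrite ltr_wpDl.
  have : (c + 1) * \sum_i `|b i - a i| <= rho / 2.
    by rewrite mulrC -ler_pdivlMr// mulrAC.
  have : 0 <= \sum_i `|b i - a i| by rewrite sumr_ge0.
  lra.
have gnear : \forall d \near 0^'+, forall a, (forall i, 0 <= a i) -> \sum_i a i <= d ->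
    forall b, g b (x0 T) != 0 -> 0 <= g b (z a T).1.
  have : \forall d \near 0^'+, forall b a, (forall i, 0 <= a i) -> \sum_i a i <= d ->
      g b (x0 T) != 0 -> 0 <= g b (z a T).1.
    apply: filter_forall => b; have [gb|gb] := eqVneq (g b (x0 T)) 0.
      by near=> d.
    have gb0 : 0 < g b (x0 T) by rewrite lt_neqAle eq_sym gb gT.
    pose k i := DH (g b : E -> R^o) (x0 T) (y i T).1.
    have k0 : 0 < 1 + \sum_i `|k i| by rewrite ltr_pwDl// sumr_ge0.
    near=> d => a a0 ad _.
    have /(_ a a0 ad) : forall a, (forall i, 0 <= a i) -> \sum_i a i <= d ->
      `|g b (z a T).1 - g b (x0 T) - \sum_i a i * k i| <= 1 * \sum_i a i.
      by near: d; exact: hexp.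
    have : `|\sum_i a i * k i| <= (\sum_i `|k i|) * \sum_i a i.
      rewrite (le_trans (ler_norm_sum _ _ _))// mulr_suml ler_sum// => i _.
      rewrite normrM ger0_norm// mulrC ler_wpM2l//.
      by rewrite (bigD1 i)//= lerDl sumr_ge0.
    have : (1 + \sum_i `|k i|) * \sum_i a i <= g b (x0 T).
      rewrite mulrC -ler_pdivlMr// (le_trans ad)//; near: d; apply: nbhs_right_le.
      by rewrite divr_gt0.
    by rewrite !ler_norml => ? /andP[? ?] /andP[? ?]; lra.
  by apply: filterS => d dP a a0 ad b; exact: dP.
have : \forall d \near 0^'+, 0 < d /\ forall a, (forall i, 0 <= a i) -> \sum_i a i <= d ->
    (forall b, g b (x0 T) != 0 -> 0 <= g b (z a T).1) /\
    [/\ NPC0 T (u a), z a 0 = (x0 0, w0 0), forall t, 0 <= t <= T -> Omega (z a t).1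
      & right_primitive 0 T (z a) (fun t => phi t (z a t).1 (u a t))].
  near=> d; split=> // a a0 ad; split; move: a a0 ad; near: d; [exact: gnear|exact: zadm].
move=> /filter_ex[d [d0 dP]].
have [a [a0 ad Ha Pa]] := feasible_improvement r0 first eqn Pexp Hexp Hcont d0.
have [ga [uN za0 zO zP]] := dP a a0 ad.
have za00 : z a 0 = (xi0, 0) by rewrite za0 w00; have [[_ _ -> _ _] _] := x0u0_pareto.
have Jlt i : bolza_objective T f0 g0 i x0 u0 < bolza_objective T f0 g0 i (fun t => (z a t).1) (u a).
  rewrite trajectory_objective//.
  have z00 : (x0 0, w0 0) = (xi0, 0) :> Z by rewrite -za0.
  rewrite (@trajectory_objective (fun t => (x0 t, w0 t)) u0 u0N x0O z0P z00)/=.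
  by have := Pa (inl i); rewrite /P; lra.
have [_ []] := x0u0_pareto; exists (fun t => (z a t).1), (u a); split=> [|i|].
- apply: trajectory_admissible => // b.
  have [gb|] := eqVneq (g b (x0 T)) 0; last exact: ga.
  by have := Pa (inr b); rewrite /P gb eqxx subr0 => /ltW.
- exact: ltW.
- by exists (Ordinal l_gt0).
Unshelve. all: by end_near. Qed.

Lemma linearized_zero y : right_primitive 0 T y (fun t => dyn_diff t (u0 t) (y t).1) ->
  y 0 = 0 -> y T = 0.
Proof.
move=> yP y0; have [K K0 KP] := dyn_diff_bounded.
have := gronwall (ltW T0) (ltW K0) yP (right_primitive_cst 0 T (0 : R^o)).
rewrite y0 normr0 subrr addr0 mulr0 => H; apply/eqP; rewrite -normr_le0; apply: H => //.
move=> t /andP[t0 tT]; have ti : 0 <= t <= T by rewrite t0 ltW.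
by rewrite addr0 (le_trans (KP t ti _))// ler_wpM2l ?norm_fst// ltW.
Qed.

Definition terminal_covector (theta : 'rV[R]_l) (lambda : 'rV[R]_m) (mu : 'rV[R]_q) : 'L(E, R^o) :=
  \sum_(i < l) theta 0 i *: DH (g0 i : E -> R^o) (x0 T)
  + \sum_(a < m) lambda 0 a *: DH (g a : E -> R^o) (x0 T)
  + \sum_(b < q) mu 0 b *: DH (h b : E -> R^o) (x0 T).

(** The generators of the cone are the pairs of a time and a control value. The alternative of a
    dense cone is excluded by [no_improving_needles], and the separating functional provides the
    multipliers. *)
Lemma multipliers_exist : exists (theta : 'rV[R]_l) (lambda : 'rV[R]_m) (mu : 'rV[R]_q),
  [/\ (theta, lambda, mu) <> (0, 0, 0),
      (forall i, 0 <= theta 0 i) /\ (forall a, 0 <= lambda 0 a),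
      forall a, lambda 0 a * g a (x0 T) = 0
    & forall t zeta, 0 <= t < T -> exists y : R -> Z,
      [/\ right_primitive 0 T y (fun s => dyn_diff s (u0 s) (y s).1),
          y t = phi t (x0 t) zeta - phi t (x0 t) (u0 t)
        & terminal_covector theta lambda mu (y T).1 + \sum_i theta 0 i * (y T).2 0 i <= 0]].
Proof.
(* Times outside [[0, T[] are sent to 0, so that the plain product [R * U] can index the needles. *)
pose time (c : R * U) : R := if 0 <= c.1 < T then c.1 else 0.
have time_lt c : 0 <= time c < T by rewrite /time; case: ifP => //; rewrite lexx T0.
have /choice[y yP] c : exists y : R -> Z,
    right_primitive 0 T y (fun s => dyn_diff s (u0 s) (y s).1) /\
    y (time c) = phi (time c) (x0 (time c)) c.2 - phi (time c) (x0 (time c)) (u0 (time c)).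
  have [|y yP yt] := @linearized_exists (time c)
    (phi (time c) (x0 (time c)) c.2 - phi (time c) (x0 (time c)) (u0 (time c))).
    by have /andP[-> /ltW] := time_lt c.
  by exists y.
have eta0 : 0 < (4 * (q%:R + 1))^-1 :> R by rewrite invr_gt0 mulr_gt0// ltr_wpDl.
have [[th [mu [th0 nz le]]]|[e e0 eP]] := multiplier_alternative
    (fun c => first_order (y c T)) (fun c => equality_order (y c T)) eta0; last first.
  (* Disjointness of needles requires sorted times; the finite list is sorted, which leaves the sums
     unchanged. *)
  exfalso; pose leT (b c : (R * U) * R * @direction q) := time b.1.1 <= time c.1.1.
  pose s := sort leT e.
  have es F w : \sum_(x <- e | x.2 == w) F x = \sum_(i < size s | (tnth (in_tuple s) i).2 == w)
      F (tnth (in_tuple s) i) :> R.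
    by rewrite -(big_tnth _ _ s (fun x => x.2 == w)); apply: perm_big; rewrite perm_sym perm_sort.
  apply: (@no_improving_needles (size s) (fun i => (tnth (in_tuple s) i).1.2)
    (fun i => time (tnth (in_tuple s) i).1.1) (fun i => (tnth (in_tuple s) i).1.1.2)
    (fun i => y (tnth (in_tuple s) i).1.1) (fun i => (tnth (in_tuple s) i).2)).
  - by move=> i; exact: time_lt.
  - move=> i j ij; have [x0' _] : exists x : (R * U) * R * @direction q, True by exists (tnth (in_tuple s) i).
    rewrite !(tnth_nth x0')/=.
    have leT_trans : transitive leT by move=> b1 b2 b3; rewrite /leT; exact: le_trans.
    have leT_refl : reflexive leT by move=> b1; exact: lexx.
    have srt : sorted leT s by apply: sort_sorted => b1 b2; exact: le_total.
    exact: (sorted_leq_nth leT_trans leT_refl x0' srt i j (ltn_ord i) (ltn_ord j) ij).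
  - by move=> i; case: (yP (tnth (in_tuple s) i).1.1).
  - by move=> i; case: (yP (tnth (in_tuple s) i).1.1).
  - move=> i; have /allP := e0; apply; rewrite -(mem_sort leT); exact: mem_tnth.
  - by move=> w k; have [/(_ k)] := eP w; rewrite (es (fun x => x.1.2 * _)).
  - by move=> w k; have [_ /(_ k)] := eP w; rewrite (es (fun x => x.1.2 * _)).
(* The trivial needle, with control value [u0 0] at time 0, has zero variation, so only the
   conventional derivatives 1 survive: the nonnegative multipliers of the inactive constraints have
   a sum at most 0. *)
have inactive a : g a (x0 T) != 0 -> th (inr a) = 0.
  move=> ga; have := le (0, u0 0); have [y0P y0] := yP (0, u0 0).
  have time0 : time (0, u0 0) = 0 by rewrite /time/=; case: ifP.
  rewrite linearized_zero//; last by rewrite time0 subrr in y0.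
  have first0 k : first_order 0 k = if k is inr b then (g b (x0 T) != 0)%:R else 0.
    case: k => [i|b]; rewrite /first_order -[(0 : Z).1]/(0 : E) linear0 ?mxE ?addr0//.
    by case: eqP.
  under eq_bigr do rewrite first0.
  rewrite /equality_order -[(0 : Z).1]/(0 : E) [X in _ + X]big1 => [|b _]; last by rewrite linear0 mulr0.
  rewrite addr0 (bigD1 (inr a))//= ga mulr1 => H.
  apply/eqP; rewrite eq_le th0 andbT (le_trans _ H)// lerDl sumr_ge0// => -[i|b] _ /=.
    by rewrite mulr0.
  by rewrite mulr_ge0.
exists (\row_i th (inl i)), (\row_a th (inr a)), (\row_b mu b); split.
- case=> t0 l0 m0; case: nz => [[[i|a]]|[b]]; apply/negP; rewrite negbK; apply/eqP.
  + by have := congr1 (fun M : 'rV_l => M 0 i) t0; rewrite !mxE.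
  + by have := congr1 (fun M : 'rV_m => M 0 a) l0; rewrite !mxE.
  + by have := congr1 (fun M : 'rV_q => M 0 b) m0; rewrite !mxE.
- by split=> i; rewrite mxE.
- move=> a; rewrite mxE; have [->|ga] := eqVneq (g a (x0 T)) 0; first by rewrite mulr0.
  by rewrite inactive// mul0r.
move=> t zeta ti; exists (y (t, zeta)); have [] := yP (t, zeta).
have -> : time (t, zeta) = t by rewrite /time/= ti.
move=> y1 y2; split=> //; apply: le_trans (le (t, zeta)).
rewrite /terminal_covector !blinD !blin_sum big_sumType/= -!addrA le_eqVlt; apply/orP; left; apply/eqP.
rewrite [RHS](_ : _ = \sum_i th (inl i) * DH (g0 i : E -> R^o) (x0 T) (y (t, zeta) T).1 +
  \sum_i th (inl i) * (y (t, zeta) T).2 0 i +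
  (\sum_a th (inr a) * DH (g a : E -> R^o) (x0 T) (y (t, zeta) T).1 +
   \sum_b mu b * DH (h b : E -> R^o) (x0 T) (y (t, zeta) T).1)); last first.
  rewrite -big_split/=; congr (_ + (_ + _)).
    by apply: eq_bigr => i _; rewrite mulrDr.
  apply: eq_bigr => a _; case: eqVneq => // ga.
  by rewrite inactive// !mul0r.
rewrite [RHS]addrAC -!addrA; congr (_ + (_ + (_ + _))); apply: eq_bigr => i _; rewrite mxE//.
Qed.

(** * The adjoint equation and the maximum principle *)

Section Adjoint.
Variables (theta : 'rV[R]_l) (covector : 'L(E, R^o)).

Local Notation A t := (DF (fun y => f t y (u0 t)) (x0 t)).
Local Notation B i t := (DF (fun y => f0 i t y (u0 t) : R^o) (x0 t)).

(** The covector of the augmented state: [theta] is the constant adjoint variable of the cost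
    coordinates, and the Hamiltonian is the pairing with [dyn]. *)
Definition pairing (p : 'L(E, R^o)) (z : Z) : R := p z.1 + \sum_i theta 0 i * z.2 0 i.

Definition adjoint_rhs t (p : 'L(E, R^o)) : 'L(E, R^o) :=
  - (blin_comp p (A t) + \sum_i theta 0 i *: B i t).

Let hamiltonianE t xi zeta p : hamiltonian f f0 t xi zeta p theta = pairing p (phi t xi zeta).
Proof. by rewrite /hamiltonian /pairing addrC; under [in RHS]eq_bigr do rewrite mxE. Qed.

Let pairingB p z z' : pairing p (z - z') = pairing p z - pairing p z'.
Proof.
rewrite /pairing linearB opprD addrACA; congr (_ + _); rewrite -sumrB.
by apply: eq_bigr => i _; rewrite !mxE mulrBr.
Qed.

Let pairing_le p z : `|pairing p z| <= (`|p| + \sum_i `|theta 0 i|) * `|z|.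
Proof.
rewrite (le_trans (ler_normD _ _))// mulrDl lerD//.
  by rewrite (le_trans (blin_ub p z.1))// ler_wpM2l// norm_fst.
rewrite mulr_suml (le_trans (ler_norm_sum _ _ _))// ler_sum// => i _.
by rewrite normrM ler_wpM2l// (le_trans (mx_norm_coord _ _ _))// norm_snd.
Qed.

Let pairing_diff t p v : pairing p (dyn_diff t (u0 t) v) = - adjoint_rhs t p v.
Proof.
rewrite -[adjoint_rhs t p v]/(- (blin_comp p (A t) + \sum_i theta 0 i *: B i t) v) opprK.
rewrite blinD blin_sum.
by congr (_ + _); apply: eq_bigr => i _; rewrite mxE.
Qed.

Let blin_comp_le (p : 'L(E, R^o)) (D : 'L(E, E)) : `|blin_comp p D| <= `|p| * `|D|.
Proof.
apply: blin_norm_le => v v1; rewrite (le_trans (blin_ub p (D v)))// ler_wpM2l//.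
by rewrite (le_trans (blin_ub D v))// ler_piMr.
Qed.

Let blin_compBl (D : 'L(E, E)) (p p' : 'L(E, R^o)) :
  blin_comp (p - p') D = blin_comp p D - blin_comp p' D.
Proof. by apply: blinP. Qed.

Let blin_comp_continuous : continuous (fun z : 'L(E, R^o) * 'L(E, E) => blin_comp z.1 z.2).
Proof.
move=> z; apply: (@cvg_bilinear _ _ _ _ (fun p D => blin_comp p D) 1) => //.
- by move=> p D D'; apply: blinP => v; rewrite /= linearB.
- by move=> p D; rewrite mul1r blin_comp_le.
- exact: cvg_fst.
- exact: cvg_snd.
Qed.

Let A_NPC0 : NPC0 T (fun t => A t).
Proof. by have [_ _ _ Dc] := hyp_c; exact: (NPC0_time_comp T0 u0N Dc). Qed.

Let B_NPC0 i : NPC0 T (fun t => B i t).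
Proof. by have [_ _ _ Dc] := hyp_a i; exact: (NPC0_time_comp T0 u0N Dc). Qed.

Let adjoint_rhs_NPC0 p : {within `[0, T], continuous p} ->
  NPC0 T (fun t => adjoint_rhs t (p t)).
Proof.
move=> pc; apply: (NPC0_comp (phi := -%R) T0); first exact: opp_continuous.
apply: NPC0D => //.
  exact: NPC0_comp T0 blin_comp_continuous (NPC0_pair T0 (NPC0_of_cont T0 pc) A_NPC0).
by apply: NPC0_sum => // i; exact: NPC0Z.
Qed.

Lemma adjoint_exists : exists2 p, right_primitive 0 T p (fun t => adjoint_rhs t (p t)) & p T = covector.
Proof.
have [K K0 KP] := cadlag_bounded (ltW T0) (NPC0_cadlag A_NPC0).
apply: (initial_value_problem (K := K)) => //.
- exact/seq_complete_blin/complete_seq_complete.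
- by rewrite lexx ltW.
- by move=> p pc; apply/NPC0_cadlag/adjoint_rhs_NPC0/(cont_on_within _ T0).
move=> t ti p p'.
have -> : adjoint_rhs t p - adjoint_rhs t p' = blin_comp (p' - p) (A t).
  by rewrite blin_compBl /adjoint_rhs opprK addrC opprD addrACA subrr addr0.
by rewrite (le_trans (blin_comp_le _ _))// mulrC distrC ler_wpM2r// KP.
Qed.

Section Maximum.
Variable p : R -> 'L(E, R^o).
Hypothesis pP : right_primitive 0 T p (fun t => adjoint_rhs t (p t)).

Let pc : {within `[0, T], continuous p}.
Proof. by apply/(cont_on_within _ T0); exact: right_primitive_cont pP. Qed.

Local Notation H t zeta := (hamiltonian f f0 t (x0 t) zeta (p t) theta).

Lemma adjoint_PC1 : PC1 T p /\ forall t, 0 <= t <= T -> ext_derive T p t =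
  - DF (fun y => hamiltonian f f0 t y (u0 t) (p t) theta : R^o) (x0 t).
Proof.
have [? dp] := right_primitive_PC1 T0 pP (adjoint_rhs_NPC0 pc); split=> // t ti.
rewrite dp// /adjoint_rhs; congr (- _); apply/esym/DF_unique => e e0.
set c := `|p t| + \sum_i `|theta 0 i|.
have c1 : 0 < c + 1 by rewrite ltr_wpDl// addr_ge0// sumr_ge0.
have [d d0 dP] := dyn_expansion (u0 t) ti (divr_gt0 e0 c1).
exists d => // v /dP le; rewrite !hamiltonianE.
have -> : (blin_comp (p t) (A t) + \sum_i theta 0 i *: B i t) v = pairing (p t) (dyn_diff t (u0 t) v).
  by rewrite pairing_diff -[adjoint_rhs t (p t) v]/(- (blin_comp (p t) (A t) + \sum_i theta 0 i *: B i t) v) opprK.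
rewrite -!pairingB (le_trans (pairing_le _ _))// -/c (le_trans (ler_wpM2l _ le)) ?addr_ge0 ?sumr_ge0//.
rewrite mulrA ler_wpM2r// mulrCA ler_piMr ?(ltW e0)// ler_pdivrMr// mul1r lerDl//.
Qed.

(** The product rule gives the right derivative [D], whose two terms cancel by the definition of
    [adjoint_rhs]; a zero right derivative makes the pairing constant. *)
Lemma pairing_conserved y : right_primitive 0 T y (fun t => dyn_diff t (u0 t) (y t).1) ->
  forall t, 0 <= t <= T -> pairing (p t) (y t) = pairing (p T) (y T).
Proof.
move=> yP t /andP[t0 tT].
pose D s : R^o := adjoint_rhs s (p s) (y s).1 + pairing (p s) (dyn_diff s (u0 s) (y s).1).
have wP : right_primitive 0 T (fun s => pairing (p s) (y s) : R^o) D.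
  have y1P : right_primitive 0 T (fun s => p s (y s).1)
      (fun s => adjoint_rhs s (p s) (y s).1 + p s (dyn_diff s (u0 s) (y s).1).1).
    apply: (@right_primitive_bilinear _ _ _ R^o (fun (p : 'L(E, R^o)) v => p v) 1)
      pP (right_primitive_fst yP) => //.
    - by move=> D' v1 v2; rewrite linearB.
    - by move=> k D' v'; rewrite linearZ.
    - by move=> D' v'; rewrite mul1r blin_ub.
  have y2P : right_primitive 0 T (fun s => \sum_i theta 0 i *: ((y s).2 0 i : R^o))
      (fun s => \sum_i theta 0 i *: ((dyn_diff s (u0 s) (y s).1).2 0 i : R^o)).
    apply: right_primitive_sum => i; apply: right_primitiveZ.
    exact: right_primitive_coord (right_primitive_snd yP).
  apply: right_primitive_eq (right_primitiveD y1P y2P) => s _.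
  by rewrite /D /pairing -addrA.
have := right_primitive_increment_cst (M := 0) tT (right_primitive_sub t0 (lexx T) wP).
rewrite mul0r normr_le0 subr_eq0 => /(_ _)/eqP-> // s _.
by rewrite /D pairing_diff subrr normr0.
Qed.

(** The limit [zeta] of the control need not be its value at [t], so the lemma covers one-sided
    limits at jumps and comparison with a frozen control value. *)
Lemma hamiltonian_cvg (F : set_system R) {FF : Filter F} t (u : R -> U) zeta :
  0 <= t <= T -> s @[s --> F] --> t -> (\forall s \near F, 0 <= s <= T) ->
  u s @[s --> F] --> zeta -> (H s (u s) : R^o) @[s --> F] --> (H t zeta : R^o).
Proof.
move=> ti st sI uz.
have tI : `[0, T]%classic t by rewrite /= in_itv.
have {}sI : \forall s \near F, `[0, T]%classic s by apply: filterS sI => s; rewrite /= in_itv.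
have x0s : x0 s @[s --> F] --> x0 t by exact: (within_continuous_cvg x0c tI st sI).
have ps : p s @[s --> F] --> p t by exact: (within_continuous_cvg pc tI st sI).
have phis : phi s (x0 s) (u s) @[s --> F] --> phi t (x0 t) zeta.
  apply: (within_continuous_cvg (c := fun s => (s, x0 s, u s)) (z := (t, x0 t, zeta)) dyn_continuous).
  - by split=> //; split=> //=; exact: x0O.
  - exact: (cvg_pair (cvg_pair st x0s) uz).
  - by apply: filterS sI => s si; split=> //; split=> //=; apply: x0O; rewrite /= in_itv in si.
under eq_fun do rewrite hamiltonianE; rewrite hamiltonianE /pairing; apply: cvgD.
  apply: (@cvg_bilinear _ _ _ R^o (fun (p : 'L(E, R^o)) v => p v) 1) => //.
  - by move=> D' v1 v2; rewrite linearB.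
  - by move=> D' v'; rewrite mul1r blin_ub.
  - exact: (cvg_comp _ _ phis cvg_fst).
elim: (index_enum _) => [|i r ih]; first by under eq_fun do rewrite big_nil; rewrite big_nil; exact: cvg_cst.
under eq_fun do rewrite big_cons; rewrite big_cons; apply: cvgD ih; apply: cvgMr.
have phi2 : (phi s (x0 s) (u s)).2 @[s --> F] --> (phi t (x0 t) zeta).2.
  exact: (cvg_comp _ _ phis cvg_snd).
exact: (cvg_comp _ _ phi2 (@coord_continuous _ _ _ 0 i _)).
Qed.

Let near_right t : 0 <= t < T -> \forall s \near t^'+, 0 <= s <= T.
Proof.
move=> /andP[t0 tT]; near=> s; apply/andP; split.
  have st : t < s by near: s; exact: nbhs_right_gt.
  by rewrite (le_trans t0 (ltW st)).
by near: s; exact: nbhs_right_le.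
Unshelve. all: by end_near. Qed.

Let near_left t : 0 < t <= T -> \forall s \near t^'-, 0 <= s <= T.
Proof.
move=> /andP[t0 tT]; near=> s; apply/andP; split.
  by near: s; exact: nbhs_left_ge.
have st : s < t by near: s; exact: nbhs_left_lt.
by rewrite (le_trans (ltW st)).
Unshelve. all: by end_near. Qed.

Hypothesis variations : forall t zeta, 0 <= t < T -> exists y : R -> Z,
  [/\ right_primitive 0 T y (fun s => dyn_diff s (u0 s) (y s).1),
      y t = phi t (x0 t) zeta - phi t (x0 t) (u0 t)
    & pairing (p T) (y T) <= 0].

Lemma maximum_principle t zeta : 0 <= t <= T -> H t zeta <= H t (u0 t).
Proof.
have HltT s z : 0 <= s < T -> H s z <= H s (u0 s).
  move=> /[dup] si /(variations z)[y [yP ys yT]]; rewrite -subr_le0 !hamiltonianE -pairingB -ys.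
  by rewrite (pairing_conserved yP)//; case/andP: si => -> /ltW.
move=> /andP[t0]; rewrite le_eqVlt => /predU1P[->|tT]; last by rewrite HltT// t0.
(* A needle needs room to its right, so [T] is reached from the left; the convention that [u0] is
   left continuous at [T] identifies the limit. *)
have [_ _ uT] := u0N; have TT : 0 <= T <= T by rewrite lexx ltW.
have T0T : 0 < T <= T by rewrite T0 lexx.
have idT : s @[s --> T^'-] --> T by apply: cvg_at_left_filter; exact: cvg_id.
have Hz : (H s zeta : R^o) @[s --> T^'-] --> (H T zeta : R^o).
  by apply: hamiltonian_cvg TT idT (near_left T0T) _; exact: cvg_cst.
have Hu : (H s (u0 s) : R^o) @[s --> T^'-] --> (H T (u0 T) : R^o).
  exact: hamiltonian_cvg TT idT (near_left T0T) uT.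
apply: (ler_cvg_to Hz Hu); near=> s.
rewrite HltT//; apply/andP; split; near: s; first exact: nbhs_left_ge.
exact: nbhs_left_lt.
Unshelve. all: by end_near. Qed.

Lemma hamiltonian_continuous : {within `[0, T], continuous (fun t => H t (u0 t))}.
Proof.
apply/(cont_on_within (fun t => H t (u0 t) : R^o) T0); have [ur ul] := NPC0_cadlag u0N.
split=> t /[dup] ti /andP[t0 tT].
  apply: hamiltonian_cvg (near_right ti) (ur t ti); first by rewrite t0 ltW.
  by apply: cvg_at_right_filter; exact: cvg_id.
have ti' : 0 <= t <= T by rewrite ltW.
have idt : s @[s --> t^'-] --> t by apply: cvg_at_left_filter; exact: cvg_id.
have [z uz] := ul t ti.
have Hz : (H s (u0 s) : R^o) @[s --> t^'-] --> (H t z : R^o).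
  exact: hamiltonian_cvg ti' idt (near_left ti) uz.
suff -> : H t (u0 t) = H t z by [].
apply/eqP; rewrite eq_le maximum_principle// andbT.
have Hu : (H s (u0 t) : R^o) @[s --> t^'-] --> (H t (u0 t) : R^o).
  by apply: hamiltonian_cvg ti' idt (near_left ti) _; exact: cvg_cst.
apply: (ler_cvg_to Hu Hz).
by apply: filterS (near_left ti) => s si; exact: maximum_principle.
Qed.

End Maximum.
End Adjoint.

End PontryaginRule.

Theorem theorem4p9 (R : realType) (E : completeNormedModType R)
  (U : topologicalType) (T : R) (Omega : set E) (xi0 : E) (l m q : nat)
  (f : R -> E -> U -> E) (f0 : 'I_l -> R -> E -> U -> R)
  (g0 : 'I_l -> E -> R) (g : 'I_m -> E -> R) (h : 'I_q -> E -> R)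
  (x0 : R -> E) (u0 : R -> U)
  (T_gt0 : 0 < T) (U_hausdorff : hausdorff_space U)
  (Omega_open : open Omega) (Omega_xi0 : Omega xi0)
  (l_gt0 : (0 < l)%N) (m_gt0 : (0 < m)%N) (q_gt0 : (0 < q)%N)
  (x0u0_pareto : pareto_optimal T Omega xi0 f f0 g0 g h x0 u0)
  (hyp_a : forall i,
    [/\ {within `[0, T] `*` Omega `*` [set: U],
          continuous (fun z : R * E * U => f0 i z.1.1 z.1.2 z.2)},
        (forall (t : R) xi zeta, t \in `[0, T] -> Omega xi ->
           gateaux_differentiable (fun y => f0 i t y zeta : R^o) xi),
        (forall (t : R) zeta, t \in `[0, T] ->
           differentiable (fun y => f0 i t y zeta : R^o) (x0 t))
      & {within `[0, T] `*` [set: U], continuous (fun z : R * U =>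
          DF (fun y => f0 i z.1 y z.2 : R^o) (x0 z.1))}])
  (hyp_b : forall i (K : set E) (M : set U),
    K `<=` Omega -> K !=set0 -> compact K -> M !=set0 -> compact M ->
    (ereal_sup [set (`|DG (fun y => f0 i z.1.1 y z.2 : R^o) z.1.2|%R)%:E
               | z in (`[0, T] `*` K `*` M : set (R * E * U))%R] < +oo)%E)
  (hyp_c :
    [/\ {within `[0, T] `*` Omega `*` [set: U],
          continuous (fun z : R * E * U => f z.1.1 z.1.2 z.2)},
        (forall (t : R) xi zeta, t \in `[0, T] -> Omega xi ->
           gateaux_differentiable (fun y => f t y zeta) xi),
        (forall (t : R) zeta, t \in `[0, T] ->
           differentiable (fun y => f t y zeta) (x0 t))
      & {within `[0, T] `*` [set: U], continuous (fun z : R * U =>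
          DF (fun y => f z.1 y z.2) (x0 z.1))}])
  (hyp_d : forall (K : set E) (M : set U),
    K `<=` Omega -> K !=set0 -> compact K -> M !=set0 -> compact M ->
    (ereal_sup [set (`|DG (fun y => f z.1.1 y z.2) z.1.2|%R)%:E
               | z in (`[0, T] `*` K `*` M : set (R * E * U))%R] < +oo)%E)
  (hyp_e :
    (forall i, hadamard_differentiable (g0 i : E -> R^o) (x0 T)) /\
    (forall a, hadamard_differentiable (g a : E -> R^o) (x0 T)))
  (hyp_f : forall b,
    (exists2 V, nbhs (x0 T) V & {within V, continuous (h b)}) /\
    hadamard_differentiable (h b : E -> R^o) (x0 T)) :
  exists (theta : 'rV[R]_l) (lambda : 'rV[R]_m) (mu : 'rV[R]_q)
         (p : R -> 'L(E, R^o)),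
    PC1 T p /\
    [/\ (* NN *) (theta, lambda, mu) <> (0, 0, 0),
        (* Si *) (forall i, 0 <= theta 0 i) /\ (forall a, 0 <= lambda 0 a),
        (* Sl *) forall a, lambda 0 a * g a (x0 T) = 0,
        (* TC *) \sum_(i < l) theta 0 i *: DH (g0 i : E -> R^o) (x0 T)
          + \sum_(a < m) lambda 0 a *: DH (g a : E -> R^o) (x0 T)
          + \sum_(b < q) mu 0 b *: DH (h b : E -> R^o) (x0 T) = p T
      & [/\ (* AE.B *) {in `[0, T], forall t, ext_derive T p t =
              - DF (fun y => hamiltonian f f0 t y (u0 t) (p t) theta : R^o)
                   (x0 t)},
            (* MP.B *) {in `[0, T], forall t, forall zeta,
              hamiltonian f f0 t (x0 t) zeta (p t) theta
              <= hamiltonian f f0 t (x0 t) (u0 t) (p t) theta}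
          & (* CH.B *) {within `[0, T], continuous (fun t =>
              hamiltonian f f0 t (x0 t) (u0 t) (p t) theta)}]].
Proof.
have [theta [lambda [mu [nz nonneg slack variations]]]] := multipliers_exist T_gt0 Omega_open
  l_gt0 x0u0_pareto hyp_a hyp_b hyp_c hyp_d hyp_e hyp_f.
(* The terminal value imposed on [p] is the left-hand side of the transversality condition, which
   therefore holds by construction. *)
have [p pP pT] := adjoint_exists T_gt0 x0u0_pareto hyp_a hyp_c theta
  (terminal_covector T g0 g h x0 theta lambda mu).
have [pPC1 dp] := adjoint_PC1 T_gt0 x0u0_pareto hyp_a hyp_c pP.
have {}variations t zeta : 0 <= t < T -> exists y : R -> E * 'rV[R]_l,
    [/\ right_primitive 0 T y (fun s => dyn_diff f f0 x0 s (u0 s) (y s).1),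
        y t = dyn f f0 t (x0 t) zeta - dyn f f0 t (x0 t) (u0 t)
      & pairing theta (p T) (y T) <= 0].
  by move=> /(variations t zeta)[y [yP yt yT]]; exists y; split=> //; rewrite /pairing pT.
exists theta, lambda, mu, p; split=> //; split=> //; split.
- by move=> t; rewrite in_itv => /dp.
- move=> t; rewrite in_itv => ti zeta.
  exact: (maximum_principle T_gt0 x0u0_pareto hyp_a hyp_c pP variations).
- exact: (hamiltonian_continuous T_gt0 x0u0_pareto hyp_a hyp_c pP variations).
Qed.
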